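(* Let $F:\mathbb{C}\to\mathbb{C}$ be an entire function, $F\not\equiv 0$, let $a\in\mathbb{C}$ be a node or focus of $\dot{x}=F(x)$, and let $\mathcal{N}$ be the basin of $F$ in $a$. Then for every $\tilde{a}\in\partial\mathcal{N}\cap F^{-1}(\{0\})$ and every $\rho>0$ one has $$\left(\mathcal{B}_\rho(\tilde{a})\cap\partial\mathcal{N}\right)\setminus\{\tilde{a}\}\neq\emptyset,$$ i.e. no equilibrium on $\partial\mathcal{N}$ is an isolated point of $\partial\mathcal{N}$ with respect to the subspace topology. Moreover, for every $\tilde{a}\in\partial\mathcal{N}\cap F^{-1}(\{0\})$ there exists an unbounded orbit $\Gamma\subset\partial\mathcal{N}$ with $\tilde{a}\in w_+(\Gamma)\cup w_-(\Gamma)$.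
   Context: Consider the autonomous planar system $\dot{x}=F(x)$, $x\in\mathbb{C}$, $t\in\mathbb{R}$. $\Phi(t,x)$ denotes its flow on the maximal interval of existence, and $\Gamma(x)=\{\Phi(t,x)\}$ the (full) orbit through $x$. For an orbit $\Gamma=\Gamma(x)$, $w_+(\Gamma)$ (resp. $w_-(\Gamma)$) is the positive (resp. negative) limit set: all limits in $\mathbb{C}$ of sequences $\Phi(t_n,x)$ with $t_n$ tending to the right (resp. left) endpoint of the maximal interval of existence. Equilibria are the zeros of $F$. A node or focus is a simple zero $a$ of $F$ that is attracting (stable) or repelling (unstable), i.e. all orbits through some neighborhood of $a$ tend to $a$ in positive time (attracting) or in negative time (repelling). The basin of $a$ is $\mathcal{N}=\{x\in\mathbb{C}: w_{+}(\Gamma(x))=\{a\}\}$ if $a$ is attracting, and $\mathcal{N}=\{x\in\mathbb{C}: w_{-}(\Gamma(x))=\{a\}\}$ if $a$ is repelling. $\partial\mathcal{N}$ is the topological boundary in $\mathbb{C}$; $\mathcal{B}_\rho(\tilde a)$ is the open disc of radius $\rho$ around $\tilde a$. An orbit is unbounded if it is an unbounded subset of $\mathbb{C}$. *)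

(* Defs.v *)
From Stdlib Require Export Reals.
From Coquelicot Require Export Coquelicot.
Open Scope R_scope.

Definition entire (F : C -> C) : Prop := forall z : C, ex_derive F z.

Definition simple_zero (F : C -> C) (a : C) : Prop :=
  F a = RtoC 0 /\ exists l : C, is_derive F a l /\ l <> RtoC 0.

(* Real-time derivative: the curve [phi] takes values in [C] seen as a normed
   space over [R].  Values of [phi] outside ]alpha, beta[ are irrelevant. *)
Definition solution (F : C -> C) (x : C) (alpha beta : Rbar) (phi : R -> C) : Prop :=
  Rbar_lt alpha 0 /\ Rbar_lt 0 beta /\ phi 0 = x /\
  forall t : R, Rbar_lt alpha t -> Rbar_lt t beta ->
    @is_derive R_AbsRing C_R_NormedModule phi t (F (phi t)).

(* [phi] is [fun t => Phi(t, x)], with maximal interval ]alpha, beta[. *)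
Definition flow (F : C -> C) (x : C) (alpha beta : Rbar) (phi : R -> C) : Prop :=
  solution F x alpha beta phi /\
  forall (alpha' beta' : Rbar) (psi : R -> C),
    solution F x alpha' beta' psi -> Rbar_le alpha alpha' /\ Rbar_le beta' beta.

Definition orbit (F : C -> C) (x y : C) : Prop :=
  exists (alpha beta : Rbar) (phi : R -> C), flow F x alpha beta phi /\
  exists t : R, Rbar_lt alpha t /\ Rbar_lt t beta /\ phi t = y.

(* Limit sets of the orbit through [x]; they do not depend on the choice of
   [x] on the orbit. *)
Definition w_plus (F : C -> C) (x p : C) : Prop :=
  exists (alpha beta : Rbar) (phi : R -> C), flow F x alpha beta phi /\
  exists u : nat -> R,
    (forall n, Rbar_lt alpha (u n) /\ Rbar_lt (u n) beta) /\
    is_lim_seq u beta /\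
    filterlim (fun n => phi (u n)) eventually (locally p).

Definition w_minus (F : C -> C) (x p : C) : Prop :=
  exists (alpha beta : Rbar) (phi : R -> C), flow F x alpha beta phi /\
  exists u : nat -> R,
    (forall n, Rbar_lt alpha (u n) /\ Rbar_lt (u n) beta) /\
    is_lim_seq u alpha /\
    filterlim (fun n => phi (u n)) eventually (locally p).

(* [within ... (Rbar_locally e)] is the one-sided filter at the endpoint [e] of
   the maximal interval, whether [e] is finite or infinite. *)
Definition tends_forward (F : C -> C) (x a : C) : Prop :=
  exists (alpha beta : Rbar) (phi : R -> C), flow F x alpha beta phi /\
  filterlim phi (within (fun t : R => Rbar_lt t beta) (Rbar_locally beta)) (locally a).

Definition tends_backward (F : C -> C) (x a : C) : Prop :=
  exists (alpha beta : Rbar) (phi : R -> C), flow F x alpha beta phi /\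
  filterlim phi (within (fun t : R => Rbar_lt alpha t) (Rbar_locally alpha)) (locally a).

Definition attracting (F : C -> C) (a : C) : Prop :=
  locally a (fun x => tends_forward F x a).

Definition repelling (F : C -> C) (a : C) : Prop :=
  locally a (fun x => tends_backward F x a).

Definition node_or_focus (F : C -> C) (a : C) : Prop :=
  simple_zero F a /\ (attracting F a \/ repelling F a).

Definition basin (F : C -> C) (a x : C) : Prop :=
  (attracting F a /\ forall p : C, w_plus F x p <-> p = a) \/
  (repelling F a /\ forall p : C, w_minus F x p <-> p = a).

(* The open disc for the modulus; Coquelicot's [ball] on [C] is a square. *)
Definition disc (c : C) (rho : R) (z : C) : Prop := Cmod (z - c)%C < rho.

Definition boundary (N : C -> Prop) (z : C) : Prop :=
  forall eps : R, 0 < eps ->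
    (exists y : C, disc z eps y /\ N y) /\ (exists y : C, disc z eps y /\ ~ N y).

Definition unbounded (S : C -> Prop) : Prop :=
  forall M : R, exists y : C, S y /\ M < Cmod y.

(* Main.v *)
Require Import Defs.
From Stdlib Require Import Lra Lia Classical ClassicalEpsilon.

(** Suppose that [a] is attracting, with basin [N]; the repelling case follows
    by passing to the field [- F].  The set [N] is open and invariant under the
    flow, so its boundary is invariant and disjoint from [N].

    The first half of the argument is that an orbit on the boundary of [N] that
    is not an equilibrium is unbounded in forward time
    ([boundary_forward_unbounded]).  This rests on holomorphy.  For two
    solutions [x(t)], [y(t)] the integral of [dz / F] along the segment from
    [x(t)] to [y(t)] is independent of [t], since [1 / F] has local primitives.
    Hence if [y(0)] is close to [x(0)], then [|y(t) - x(t)|] is at most a small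
    multiple of [|F (x(t))|] for all positive times ([shadowing]).  If [x(0)] is
    on the boundary and its forward orbit is bounded, choose [y(0)] in [N] close
    to [x(0)].  Then [y(t)] tends to [a] and [x(t)] stays close to it, so [x(t)]
    enters the neighbourhood of [a] contained in [N], which is absurd.

    It remains to find, for a zero [b] of [F] on the boundary of [N], a boundary
    point which is not a zero of [F] and whose orbit tends to [b] in backward
    time ([boundary_point_from_zero]).  Its orbit is then unbounded, stays in
    the boundary and has [b] as a limit, and it also provides boundary points
    different from [b] and arbitrarily close to it.  Let [m] be the order of [b].

    - If [m = 1], a holomorphic coordinate [H] with [H' F = mu H], where
      [mu = F' b], shows that [|H|] evolves like [exp (Re mu t)]
      ([linearization]).  If [Re mu <= 0], orbits near [b] stay near [b] and
      cannot tend to [a].  If [Re mu > 0], a punctured disc around [b] consists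
      of orbits which come from [b].  It meets [N].  If it is not contained in
      [N], it contains a boundary point.  If it were contained in [N], the
      backward basin [U] of [b] would be bounded, as the forward orbits of a
      compact circle in [N] are.  By the first half, applied to [- F], the
      boundary of [U] would consist of zeros of [F]; these are isolated, so the
      closure of [U] would be open and closed ([bounded_basin_absurd]).

    - If [m >= 2], the coordinate [W = c / (z - b) ^ (m - 1)], for a suitable
      [c], sends [b] to infinity and turns [F] into a small perturbation of the
      constant field [1].  Points of [N] near [b] must have [W] in a cone around
      the negative real axis, because the other orbits remain near [b]
      ([forward_stay]).  Rotating such a point around [b] until [W] becomes [- W]
      leads out of [N]; the boundary point met on the way has [W] in the closed
      cone and so tends to [b] in backward time ([multiple_zero_boundary]).

    The differentiability of [F] is only assumed pointwise, and the flow is to be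
    constructed.  Goursat's lemma gives primitives on discs
    ([primitive_on_disc]).  A primitive of a periodic function built from [f]
    gives Cauchy's estimate for [f'] ([cauchy_estimate]), which shows that
    derivatives of entire functions are entire ([derivative_holo]) and that
    zeros have finite order ([finite_order]).  Picard iteration for truncated
    fields and Gronwall's inequality give the flow and its continuity. *)

Open Scope R_scope.
Set Bullet Behavior "Strict Subproofs".

(** * Differentiation with explicit error terms *)

Lemma Cmod_sub_sym (x y : C) : Cmod (x - y)%C = Cmod (y - x)%C.
Proof. rewrite <- Cmod_opp; f_equal; ring. Qed.

Lemma Cmod_sub_self (x : C) : Cmod (x - x)%C = 0.
Proof. replace (x - x)%C with (RtoC 0) by ring; apply Cmod_0. Qed.

Lemma Cmod_le_add (x y : C) : Cmod x <= Cmod y + Cmod (x - y)%C.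
Proof. replace x with (y + (x - y))%C at 1 by ring; apply Cmod_triangle. Qed.

Lemma Cmod_sub_triangle (x y z : C) : Cmod (x - z)%C <= Cmod (x - y)%C + Cmod (y - z)%C.
Proof. replace (x - z)%C with ((x - y) + (y - z))%C by ring; apply Cmod_triangle. Qed.

Lemma Cmod_minus_le (x y : C) : Cmod (x - y)%C <= Cmod x + Cmod y.
Proof. unfold Cminus; rewrite <- (Cmod_opp y); apply Cmod_triangle. Qed.

Lemma Cmod_zero_eq (x y : C) : Cmod (x - y)%C <= 0 -> x = y.
Proof.
  intro H. assert (H0 : (x - y)%C = 0).
  { apply Cmod_eq_0, Rle_antisym; [exact H | apply Cmod_ge_0]. }
  replace x with (x - y + y)%C by ring; rewrite H0; ring.
Qed.

Lemma Cmod_sub_pos (x y : C) : x <> y -> 0 < Cmod (x - y)%C.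
Proof.
  intro H. destruct (Rle_lt_dec (Cmod (x - y)%C) 0); [|assumption].
  exfalso; apply H, Cmod_zero_eq; assumption.
Qed.

Lemma Cmod_le_eps (x : C) : (forall eps, 0 < eps -> Cmod x <= eps) -> x = 0.
Proof.
  intro H. apply Cmod_eq_0, Rle_antisym; [|apply Cmod_ge_0].
  apply le_epsilon; intros e He; rewrite Rplus_0_l; auto.
Qed.

Lemma Cmod_RtoC_sub (x y : R) : Cmod (RtoC x - RtoC y)%C = Rabs (x - y).
Proof. rewrite <- RtoC_minus; apply Cmod_R. Qed.

Lemma im_le_Cmod (c : C) : Rabs (Im c) <= Cmod c.
Proof.
  eapply Rle_trans; [|apply Rmax_Cmod]. apply Rmax_r.
Qed.

Lemma Cmod_le_re_im (c : C) : Cmod c <= Rabs (Re c) + Rabs (Im c).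
Proof.
  destruct c as [x y]; simpl.
  replace ((x, y) : C) with (RtoC x + RtoC y * Ci)%C
    by (unfold Ci, RtoC, Cplus, Cmult; simpl; f_equal; ring).
  eapply Rle_trans; [apply Cmod_triangle|].
  rewrite Cmod_mult, Cmod_Ci, !Cmod_R; lra.
Qed.

(** [der i f x l]: the function [f] on [X] has derivative [l] at [x] with
    respect to the coordinate [i].  The coordinates [fun z : C => z] and
    [RtoC] give complex differentiation and the velocity of real-time curves,
    so that one set of rules serves both. *)
Definition der {X : Type} (i f : X -> C) (x : X) (l : C) : Prop :=
  forall eps, 0 < eps -> exists del, 0 < del /\ forall y, Cmod (i y - i x)%C < del ->
    Cmod (f y - f x - l * (i y - i x))%C <= eps * Cmod (i y - i x)%C.

Notation cder := (der (fun z : C => z)).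
Notation rder := (der RtoC).

Definition cont_at {X : Type} (i f : X -> C) (x : X) : Prop :=
  forall eps, 0 < eps -> exists del, 0 < del /\ forall y, Cmod (i y - i x)%C < del ->
    Cmod (f y - f x)%C < eps.

Section Rules.
Context {X : Type} (i : X -> C).

Lemma der_weak (f : X -> C) x l K :
  (forall eps, 0 < eps -> eps <= 1 -> exists del, 0 < del /\ forall y, Cmod (i y - i x)%C < del ->
    Cmod (f y - f x - l * (i y - i x))%C <= K * eps * Cmod (i y - i x)%C) ->
  der i f x l.
Proof.
  intros H eps Heps.
  assert (HK : 0 < Rabs K + 1) by (pose proof (Rabs_pos K); lra).
  destruct (H (Rmin 1 (eps / (Rabs K + 1)))) as [del [Hd Hy]].
  - apply Rmin_pos; [lra | apply Rdiv_lt_0_compat; lra].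
  - apply Rmin_l.
  - exists del; split; [exact Hd|]; intros y Hyd.
    eapply Rle_trans; [apply Hy, Hyd|].
    apply Rmult_le_compat_r; [apply Cmod_ge_0|].
    set (e := Rmin _ _).
    assert (He : 0 <= e) by (apply Rlt_le, Rmin_pos; [lra | apply Rdiv_lt_0_compat; lra]).
    assert (He' : e <= eps / (Rabs K + 1)) by apply Rmin_r.
    apply Rle_trans with ((Rabs K + 1) * (eps / (Rabs K + 1))); [|right; field; lra].
    pose proof (Rle_abs K). nra.
Qed.

Lemma der_cont (f : X -> C) x l : der i f x l -> cont_at i f x.
Proof.
  intros H eps Heps. destruct (H 1 Rlt_0_1) as [d [Hd Hy]].
  assert (HK : 0 < Cmod l + 1) by (pose proof (Cmod_ge_0 l); lra).
  exists (Rmin d (eps / (Cmod l + 1))); split.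
  - apply Rmin_pos; [lra | apply Rdiv_lt_0_compat; lra].
  - intros y Hyd.
    assert (H1 := Hy y (Rlt_le_trans _ _ _ Hyd (Rmin_l _ _))).
    assert (H2 := Rlt_le_trans _ _ _ Hyd (Rmin_r _ _)).
    assert (H3 := Cmod_le_add (f y - f x)%C (l * (i y - i x))%C).
    rewrite Cmod_mult in H3.
    apply (Rmult_lt_compat_l (Cmod l + 1)) in H2; [|exact HK].
    replace ((Cmod l + 1) * (eps / (Cmod l + 1))) with eps in H2 by (field; lra). lra.
Qed.

Lemma der_ext (f g : X -> C) x l l' r :
  0 < r -> (forall y, Cmod (i y - i x)%C < r -> f y = g y) -> l = l' ->
  der i f x l -> der i g x l'.
Proof.
  intros Hr Hfg <- H eps Heps. destruct (H eps Heps) as [d [Hd Hy]].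
  exists (Rmin d r); split; [apply Rmin_pos; lra|].
  intros y Hyd. rewrite <- !Hfg.
  - apply Hy; eapply Rlt_le_trans; [exact Hyd | apply Rmin_l].
  - rewrite Cmod_sub_self; exact Hr.
  - eapply Rlt_le_trans; [exact Hyd | apply Rmin_r].
Qed.

Lemma der_eq (f : X -> C) x l l' : l = l' -> der i f x l -> der i f x l'.
Proof. intros <-; auto. Qed.

Lemma der_const (c : C) x : der i (fun _ => c) x 0.
Proof.
  intros eps Heps; exists 1; split; [lra|]; intros y _.
  replace (c - c - 0 * (i y - i x))%C with (RtoC 0) by ring. rewrite Cmod_0.
  apply Rmult_le_pos; [lra | apply Cmod_ge_0].
Qed.

Lemma der_coord x : der i i x 1.
Proof.
  intros eps Heps; exists 1; split; [lra|]; intros y _.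
  replace (i y - i x - 1 * (i y - i x))%C with (RtoC 0) by ring. rewrite Cmod_0.
  apply Rmult_le_pos; [lra | apply Cmod_ge_0].
Qed.

Lemma der_plus (f g : X -> C) x l m :
  der i f x l -> der i g x m -> der i (fun y => f y + g y)%C x (l + m)%C.
Proof.
  intros Hf Hg. apply der_weak with 2. intros eps Heps _.
  destruct (Hf eps Heps) as [d1 [Hd1 H1]], (Hg eps Heps) as [d2 [Hd2 H2]].
  exists (Rmin d1 d2); split; [apply Rmin_pos; lra|]. intros y Hy.
  specialize (H1 y (Rlt_le_trans _ _ _ Hy (Rmin_l _ _))).
  specialize (H2 y (Rlt_le_trans _ _ _ Hy (Rmin_r _ _))).
  replace (f y + g y - (f x + g x) - (l + m) * (i y - i x))%C with
    ((f y - f x - l * (i y - i x)) + (g y - g x - m * (i y - i x)))%C by ring.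
  eapply Rle_trans; [apply Cmod_triangle|]. lra.
Qed.

Lemma der_mult (f g : X -> C) x l m :
  der i f x l -> der i g x m -> der i (fun y => f y * g y)%C x (l * g x + f x * m)%C.
Proof.
  intros Hf Hg. apply der_weak with (Cmod (g x) + 1 + Cmod l + Cmod (f x)). intros eps Heps Heps1.
  destruct (Hf eps Heps) as [d1 [Hd1 H1]], (Hg eps Heps) as [d2 [Hd2 H2]].
  destruct (der_cont _ _ _ Hg eps Heps) as [d3 [Hd3 H3]].
  exists (Rmin d1 (Rmin d2 d3)); split; [repeat apply Rmin_pos; lra|]. intros y Hy.
  specialize (H1 y (Rlt_le_trans _ _ _ Hy (Rmin_l _ _))).
  assert (Hy' := Rlt_le_trans _ _ _ Hy (Rmin_r _ _)).
  specialize (H2 y (Rlt_le_trans _ _ _ Hy' (Rmin_l _ _))).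
  specialize (H3 y (Rlt_le_trans _ _ _ Hy' (Rmin_r _ _))).
  replace (f y * g y - f x * g x - (l * g x + f x * m) * (i y - i x))%C with
    ((f y - f x - l * (i y - i x)) * g y + l * (i y - i x) * (g y - g x)
      + f x * (g y - g x - m * (i y - i x)))%C by ring.
  eapply Rle_trans; [apply Cmod_triangle|].
  eapply Rle_trans; [apply Rplus_le_compat_r, Cmod_triangle|].
  rewrite !Cmod_mult.
  assert (Hgy : Cmod (g y) <= Cmod (g x) + 1) by (pose proof (Cmod_le_add (g y) (g x)); lra).
  set (D := Cmod (i y - i x)%C) in *.
  assert (HD : 0 <= D) by apply Cmod_ge_0.
  pose proof (Cmod_ge_0 (g y)); pose proof (Cmod_ge_0 l); pose proof (Cmod_ge_0 (f x)).
  assert (A1 : Cmod (f y - f x - l * (i y - i x))%C * Cmod (g y) <= eps * D * (Cmod (g x) + 1)).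
  { apply Rmult_le_compat; auto using Cmod_ge_0. }
  assert (A2 : Cmod l * D * Cmod (g y - g x)%C <= Cmod l * D * eps).
  { apply Rmult_le_compat_l; [apply Rmult_le_pos; auto | lra]. }
  assert (A3 : Cmod (f x) * Cmod (g y - g x - m * (i y - i x))%C <= Cmod (f x) * (eps * D)).
  { apply Rmult_le_compat_l; auto. }
  lra.
Qed.

Lemma der_comp (f : C -> C) (g : X -> C) x l m :
  cder f (g x) l -> der i g x m -> der i (fun y => f (g y)) x (l * m)%C.
Proof.
  intros Hf Hg. apply der_weak with (Cmod m + 1 + Cmod l). intros eps Heps Heps1.
  destruct (Hf eps Heps) as [d1 [Hd1 H1]], (Hg eps Heps) as [d2 [Hd2 H2]].
  destruct (der_cont _ _ _ Hg d1 Hd1) as [d3 [Hd3 H3]].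
  exists (Rmin d2 d3); split; [repeat apply Rmin_pos; lra|]. intros y Hy.
  specialize (H2 y (Rlt_le_trans _ _ _ Hy (Rmin_l _ _))).
  specialize (H3 y (Rlt_le_trans _ _ _ Hy (Rmin_r _ _))).
  specialize (H1 (g y) H3). simpl in H1.
  replace (f (g y) - f (g x) - l * m * (i y - i x))%C with
    ((f (g y) - f (g x) - l * (g y - g x)) + l * (g y - g x - m * (i y - i x)))%C by ring.
  eapply Rle_trans; [apply Cmod_triangle|]. rewrite Cmod_mult.
  assert (H4 := Cmod_le_add (g y - g x)%C (m * (i y - i x))%C). rewrite Cmod_mult in H4.
  set (D := Cmod (i y - i x)%C) in *.
  assert (HD : 0 <= D) by apply Cmod_ge_0.
  pose proof (Cmod_ge_0 m); pose proof (Cmod_ge_0 l).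
  assert (A1 : eps * Cmod (g y - g x)%C <= eps * ((Cmod m + 1) * D)).
  { apply Rmult_le_compat_l; [lra|]. assert (eps * D <= 1 * D) by (apply Rmult_le_compat_r; lra). lra. }
  assert (A2 : Cmod l * Cmod (g y - g x - m * (i y - i x))%C <= Cmod l * (eps * D)).
  { apply Rmult_le_compat_l; auto. }
  lra.
Qed.

End Rules.

Lemma cder_inv (z : C) : z <> 0 -> cder Cinv z (- / (z * z))%C.
Proof.
  intro Hz. assert (Hm := proj1 (Cmod_gt_0 z) Hz).
  apply der_weak with (2 * / (Cmod z * Cmod z * Cmod z)). intros eps Heps Heps1.
  exists (Rmin eps (Cmod z / 2)); split; [apply Rmin_pos; lra|]. intros y Hy.
  assert (Hy1 := Rlt_le_trans _ _ _ Hy (Rmin_l _ _)).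
  assert (Hy2 := Rlt_le_trans _ _ _ Hy (Rmin_r _ _)).
  assert (Hyz : Cmod z / 2 <= Cmod y).
  { pose proof (Cmod_le_add z y). rewrite Cmod_sub_sym in H. lra. }
  assert (Hy0 : y <> 0) by (apply Cmod_gt_0; lra).
  replace (/ y - / z - - / (z * z) * (y - z))%C with ((y - z) * (y - z) * / (z * z * y))%C
    by (field; auto).
  rewrite !Cmod_mult, Cmod_inv by (repeat apply Cmult_neq_0; auto).
  rewrite !Cmod_mult. set (D := Cmod (y - z)%C) in *.
  assert (HD : 0 <= D) by apply Cmod_ge_0.
  assert (Hz2 : 0 < Cmod z * Cmod z) by nra.
  assert (A : / (Cmod z * Cmod z * Cmod y) <= 2 * / (Cmod z * Cmod z * Cmod z)).
  { apply Rle_trans with (/ (Cmod z * Cmod z * (Cmod z / 2))); [|right; field; lra].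
    apply Rinv_le_contravar; nra. }
  assert (B : 0 < / (Cmod z * Cmod z * Cmod y)) by (apply Rinv_0_lt_compat; nra).
  replace (2 * / (Cmod z * Cmod z * Cmod z) * eps * D) with
    (D * eps * (2 * / (Cmod z * Cmod z * Cmod z))) by ring.
  apply Rmult_le_compat; try nra. 
Qed.

Section Rules2.
Context {X : Type} (i : X -> C).

Lemma der_scal (c : C) (f : X -> C) x l :
  der i f x l -> der i (fun y => c * f y)%C x (c * l)%C.
Proof.
  intro H. apply der_eq with (0 * f x + c * l)%C; [ring|].
  apply (der_mult i (fun _ => c)); [apply der_const | exact H].
Qed.

Lemma der_opp (f : X -> C) x l : der i f x l -> der i (fun y => - f y)%C x (- l)%C.
Proof.
  intro H. apply der_ext with (fun y => (-1) * f y)%C ((-1) * l)%C 1; [lra| |ring|].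
  - intros; ring.
  - apply der_scal, H.
Qed.

Lemma der_minus (f g : X -> C) x l m :
  der i f x l -> der i g x m -> der i (fun y => f y - g y)%C x (l - m)%C.
Proof. intros; apply der_plus; [|apply der_opp]; assumption. Qed.

Lemma der_inv (f : X -> C) x l :
  f x <> 0 -> der i f x l -> der i (fun y => / f y)%C x (- l / (f x * f x))%C.
Proof.
  intros Hx H. apply der_eq with (- / (f x * f x) * l)%C.
  - field; auto.
  - apply (der_comp i Cinv); [apply cder_inv, Hx | exact H].
Qed.

Lemma der_affine (c d : C) x : der i (fun y => c + d * i y)%C x d.
Proof.
  apply der_eq with (0 + d * 1)%C; [ring|].
  apply der_plus; [apply der_const | apply der_scal, der_coord].
Qed.

Lemma der_pow (f : X -> C) x l n :
  der i f x l -> der i (fun y => f y ^ S n)%C x (INR (S n) * f x ^ n * l)%C.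
Proof.
  intro H. induction n as [|n IH].
  - apply der_ext with f l 1; [lra| | |exact H]; simpl; intros; ring.
  - apply der_ext with (fun y => f y * f y ^ S n)%C
      (l * f x ^ S n + f x * (INR (S n) * f x ^ n * l))%C 1; [lra| | |].
    + intros; reflexivity.
    + rewrite (S_INR (S n)), RtoC_plus. simpl (f x ^ S n)%C. ring.
    + apply (der_mult i f); assumption.
Qed.

End Rules2.

(** ** Conversion from and to filter derivatives *)

(** The uniform structure of the complex plane is that of a product, with
    squares as balls; it has the same neighbourhoods as the modulus. *)
Lemma locally_Cmod (z : C) (P : C -> Prop) :
  @locally C_UniformSpace z P <-> exists d, 0 < d /\ forall w, Cmod (w - z)%C < d -> P w.
Proof.
  split.
  - intros [d Hd]. exists d; split; [apply cond_pos|]. intros w Hw.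
    apply Hd. apply C_NormedModule_mixin_compat1. exact Hw.
  - intros [d [Hd H]].
    assert (Hs : 0 < sqrt 2) by (apply sqrt_lt_R0; lra).
    assert (Hd' : 0 < d / sqrt 2) by (apply Rdiv_lt_0_compat; lra).
    exists (mkposreal _ Hd'). intros w Hw. apply H.
    apply C_NormedModule_mixin_compat2 in Hw. simpl in Hw.
    replace (sqrt 2 * (d / sqrt 2)) with d in Hw by (field; lra). exact Hw.
Qed.

Lemma cder_is_derive (f : C -> C) (z l : C) :
  @is_derive C_AbsRing C_NormedModule f z l <-> cder f z l.
Proof.
  split.
  - intros [_ H] eps Heps.
    destruct (H z (fun P HP => HP) (mkposreal _ Heps)) as [d Hy].
    exists d; split; [apply cond_pos|]. intros y Hyd. specialize (Hy y Hyd). simpl in Hy.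
    rewrite Cmult_comm. exact Hy.
  - intro H. split.
    + apply (is_linear_scal_l (K := C_AbsRing) (V := C_NormedModule) l).
    + intros x Hx.
      apply (is_filter_lim_locally_unique (V := AbsRing_NormedModule C_AbsRing)) in Hx. subst x.
      intro eps. destruct (H eps (cond_pos eps)) as [d [Hd Hy]].
      exists (mkposreal _ Hd). intros y Hyd. specialize (Hy y Hyd).
      rewrite Cmult_comm in Hy. exact Hy.
Qed.

Lemma rder_is_derive (f : R -> C) (t : R) (l : C) :
  @is_derive R_AbsRing C_R_NormedModule f t l <-> rder f t l.
Proof.
  assert (Hn : forall c : C, Cmod c = @norm R_AbsRing C_R_NormedModule c).
  { intros c. unfold Cmod, norm. simpl. unfold prod_norm, norm. simpl. unfold abs. simpl.
    f_equal. rewrite !Rmult_1_r, <- !Rabs_mult, !Rabs_pos_eq; nra. }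
  assert (Hs : forall (h : R) (c : C), (c * RtoC h)%C = @scal R_AbsRing C_R_NormedModule h c).
  { intros h [x y]. unfold scal. simpl. unfold prod_scal, scal. simpl. unfold mult. simpl.
    unfold Cmult, RtoC. simpl. f_equal; ring. }
  split.
  - intros [_ H] eps Heps.
    assert (Hd := H t (fun P HP => HP) (mkposreal _ Heps)).
    destruct Hd as [d Hy].
    exists d; split; [apply cond_pos|]. intros y Hyd. rewrite Cmod_RtoC_sub in Hyd |- *.
    specialize (Hy y Hyd). rewrite <- RtoC_minus, Hs, Hn. exact Hy.
  - intro H. split.
    + apply (is_linear_scal_l (K := R_AbsRing) (V := C_R_NormedModule) l).
    + intros x Hx.
      apply (is_filter_lim_locally_unique (V := AbsRing_NormedModule R_AbsRing)) in Hx. subst x.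
      intro eps. destruct (H eps (cond_pos eps)) as [d [Hd Hy]].
      exists (mkposreal _ Hd). intros y Hyd. specialize (Hy y). rewrite Cmod_RtoC_sub in Hy.
      specialize (Hy Hyd). rewrite <- RtoC_minus, Hs, Hn in Hy. exact Hy.
Qed.

(** ** The mean value inequality *)

Lemma rder_Re (f : R -> C) t l : rder f t l -> is_derive (fun s => Re (f s)) t (Re l).
Proof.
  intro H. apply is_derive_Reals. intros eps Heps.
  destruct (H (eps / 2)) as [d [Hd Hy]]; [lra|].
  exists (mkposreal _ Hd). intros h Hh Hhd. simpl in Hhd.
  specialize (Hy (t + h)). rewrite Cmod_RtoC_sub in Hy.
  replace (t + h - t) with h in Hy by ring. specialize (Hy Hhd).
  replace ((Re (f (t + h)%R) - Re (f t)) / h - Re l) with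
    (Re (f (t + h)%R - f t - l * (RtoC (t + h) - RtoC t))%C / h).
  2:{ destruct (f (t + h)), (f t), l. simpl. field. exact Hh. }
  unfold Rdiv. rewrite Rabs_mult, Rabs_inv.
  assert (Hah := Rabs_pos_lt h Hh).
  apply Rle_lt_trans with (eps / 2 * Rabs h * / Rabs h).
  - apply Rmult_le_compat_r; [left; apply Rinv_0_lt_compat, Hah|].
    eapply Rle_trans; [apply re_le_Cmod | exact Hy].
  - field_simplify; lra.
Qed.

Lemma rder_Im (f : R -> C) t l : rder f t l -> is_derive (fun s => Im (f s)) t (Im l).
Proof.
  intro H. apply is_derive_ext with (fun s => Re (- Ci * f s)%C).
  - intro s. destruct (f s). simpl. ring.
  - replace (Im l) with (Re (- Ci * l)%C) by (destruct l; simpl; ring).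
    apply rder_Re, der_scal, H.
Qed.

Lemma derive_nondec (g : R -> R) a b : a <= b ->
  (forall t, a <= t <= b -> exists d, is_derive g t d /\ 0 <= d) -> g a <= g b.
Proof.
  intros Hab Hd. destruct (MVT_gen g a b (Derive g)) as [c [Hc Hg]];
    rewrite Rmin_left, Rmax_right in * by exact Hab.
  - intros t Ht. destruct (Hd t) as [d [H1 _]]; [lra|]. apply Derive_correct. exists d; exact H1.
  - intros t Ht. destruct (Hd t) as [d [H1 _]]; [lra|].
    apply continuity_pt_filterlim, (ex_derive_continuous g). exists d; exact H1.
  - destruct (Hd c Hc) as [d [H1 H2]]. apply is_derive_unique in H1. rewrite H1 in Hg. nra.
Qed.

(** Projecting on the direction of the increment reduces the claim to the
    monotonicity of a real function. *)
Lemma mean_value_compare (f : R -> C) (g : R -> R) a b :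
  a <= b -> (forall t, a <= t <= b -> exists v d, rder f t v /\ is_derive g t d /\ Cmod v <= d) ->
  Cmod (f b - f a)%C <= g b - g a.
Proof.
  intros Hab H. set (w := (f b - f a)%C).
  set (h := fun t => Cmod w * g t - Re (Cconj w * f t)%C).
  assert (Hh : h a <= h b).
  { apply derive_nondec; [exact Hab|]. intros t Ht. destruct (H t Ht) as (v & d & Hv & Hd & Hm).
    exists (Cmod w * d - Re (Cconj w * v)%C). split.
    - apply (is_derive_minus (fun t => Cmod w * g t) (fun t => Re (Cconj w * f t)%C)).
      + apply (is_derive_scal g t (Cmod w) d Hd).
      + apply (rder_Re (fun s => Cconj w * f s)%C). apply der_scal, Hv.
    - assert (A := Rle_trans _ _ _ (Rle_abs _) (re_le_Cmod (Cconj w * v)%C)).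
      rewrite Cmod_mult, Cmod_conj in A.
      pose proof (Rmult_le_compat_l (Cmod w) _ _ (Cmod_ge_0 w) Hm). lra. }
  assert (Hw : Re (Cconj w * f b)%C - Re (Cconj w * f a)%C = Cmod w * Cmod w).
  { replace (Cmod w * Cmod w) with (Cmod w ^ 2) by ring.
    rewrite Cmod2_alt. unfold w. destruct (f b), (f a). simpl. ring. }
  unfold h in Hh. destruct (Rle_lt_or_eq_dec 0 (Cmod w) (Cmod_ge_0 w)) as [Hp|Hp].
  - apply Rmult_le_reg_l with (Cmod w); [exact Hp|]. lra.
  - rewrite <- Hp. assert (g a <= g b); [|lra]. apply derive_nondec; [exact Hab|].
    intros t Ht. destruct (H t Ht) as (v & d & _ & Hd & Hm). exists d. split; [exact Hd|].
    eapply Rle_trans; [apply Cmod_ge_0 | exact Hm].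
Qed.

Lemma mean_value (f : R -> C) a b M :
  a <= b -> (forall t, a <= t <= b -> exists v, rder f t v /\ Cmod v <= M) ->
  Cmod (f b - f a)%C <= M * (b - a).
Proof.
  intros Hab H. replace (M * (b - a)) with (M * b - M * a) by ring.
  apply (mean_value_compare f (fun t => M * t)); [exact Hab|]. intros t Ht.
  destruct (H t Ht) as [v [Hv Hm]]. exists v, M. split; [exact Hv|]. split; [|exact Hm].
  auto_derive; [exact I | ring].
Qed.

Lemma rder_zero_const (f : R -> C) a b :
  a <= b -> (forall t, a <= t <= b -> rder f t 0) -> f b = f a.
Proof.
  intros Hab H. apply Cmod_zero_eq. rewrite <- (Rmult_0_l (b - a)).
  apply mean_value; [exact Hab|]. intros t Ht. exists 0. split; [apply H, Ht|].
  rewrite Cmod_0; lra.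
Qed.

Definition seg (p q : C) (s : R) : C := (p + (q - p) * s)%C.

Lemma rder_seg p q s : rder (seg p q) s (q - p)%C.
Proof. apply der_affine. Qed.

(** Discs are convex. *)
Lemma seg_disc p q s c r :
  Cmod (p - c)%C <= r -> Cmod (q - c)%C <= r -> 0 <= s <= 1 -> Cmod (seg p q s - c)%C <= r.
Proof.
  intros Hp Hq Hs. unfold seg.
  replace (p + (q - p) * s - c)%C with ((1 - s)%R * (p - c) + s * (q - c))%C
    by (rewrite RtoC_minus; ring).
  eapply Rle_trans; [apply Cmod_triangle|]. rewrite !Cmod_mult, !Cmod_R, !Rabs_pos_eq by lra.
  nra.
Qed.

Lemma cder_mean_value (f : C -> C) p q M :
  (forall s, 0 <= s <= 1 -> exists l, cder f (seg p q s) l /\ Cmod l <= M) ->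
  Cmod (f q - f p)%C <= M * Cmod (q - p)%C.
Proof.
  intros H.
  assert (H1 : Cmod (f (seg p q 1) - f (seg p q 0))%C <= M * Cmod (q - p)%C * (1 - 0)).
  { apply (mean_value (fun s => f (seg p q s))); [lra|]. intros s Hs.
    destruct (H s Hs) as [l [Hl Hm]]. exists (l * (q - p))%C. split.
    - apply (der_comp RtoC f (seg p q)); [exact Hl | apply rder_seg].
    - rewrite Cmod_mult. apply Rmult_le_compat_r; [apply Cmod_ge_0 | exact Hm]. }
  unfold seg in H1. replace (p + (q - p) * 1)%C with q in H1 by ring.
  replace (p + (q - p) * 0)%C with p in H1 by ring. lra.
Qed.

(** * Primitives of holomorphic functions on a disc *)

(** ** Antiderivatives of continuous curves *)

Lemma is_derive_eps (f : R -> R) t l : is_derive f t l ->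
  forall eps, 0 < eps -> exists d, 0 < d /\ forall s, Rabs (s - t) < d ->
    Rabs (f s - f t - (s - t) * l) <= eps * Rabs (s - t).
Proof.
  intros [_ H] eps Heps. destruct (H t (fun P HP => HP) (mkposreal _ Heps)) as [d Hd].
  exists d; split; [apply cond_pos|]. intros s Hs. exact (Hd s Hs).
Qed.

Lemma rder_pair (u v : R -> R) t u' v' :
  is_derive u t u' -> is_derive v t v' -> rder (fun s => (u s, v s)) t (u', v').
Proof.
  intros Hu Hv. apply der_weak with 2. intros eps Heps _.
  destruct (is_derive_eps _ _ _ Hu eps Heps) as [d1 [Hd1 H1]],
    (is_derive_eps _ _ _ Hv eps Heps) as [d2 [Hd2 H2]].
  exists (Rmin d1 d2); split; [apply Rmin_pos; lra|]. intros s Hs. rewrite Cmod_RtoC_sub in *.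
  specialize (H1 s (Rlt_le_trans _ _ _ Hs (Rmin_l _ _))).
  specialize (H2 s (Rlt_le_trans _ _ _ Hs (Rmin_r _ _))).
  eapply Rle_trans; [apply Cmod_le_re_im|].
  replace (Re _) with (u s - u t - (s - t) * u') by (simpl; ring).
  replace (Im _) with (v s - v t - (s - t) * v') by (simpl; ring). lra.
Qed.

Definition curve_int (g : R -> C) (t : R) : C :=
  (RInt (fun s => Re (g s)) 0 t, RInt (fun s => Im (g s)) 0 t).

Lemma is_derive_RInt0 (f : R -> R) :
  (forall s, continuous f s) -> forall t, is_derive (fun t => RInt f 0 t) t (f t).
Proof.
  intros Hf t. apply is_derive_RInt with 0; [|apply Hf].
  apply filter_forall. intro b. apply RInt_correct, ex_RInt_continuous. intros; apply Hf.
Qed.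

Lemma cont_at_component (k : C -> R) (g : R -> C) s :
  (forall z w, Rabs (k z - k w) <= Cmod (z - w)%C) ->
  cont_at RtoC g s -> continuous (fun s => k (g s)) s.
Proof.
  intros Hk H. apply filterlim_locally. intros eps.
  destruct (H eps (cond_pos eps)) as [d [Hd Hs]]. exists (mkposreal d Hd). intros y Hy.
  eapply Rle_lt_trans; [apply (Hk (g y) (g s))|]. apply Hs. rewrite Cmod_RtoC_sub. exact Hy.
Qed.

Lemma curve_int_der (g : R -> C) :
  (forall s, cont_at RtoC g s) -> forall t, rder (curve_int g) t (g t).
Proof.
  intros Hg t. apply der_eq with (Re (g t), Im (g t)); [destruct (g t); reflexivity|].
  apply rder_pair.
  - apply (is_derive_RInt0 (fun s => Re (g s))). intro s. apply cont_at_component; [|apply Hg].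
    intros [a b] [c d]. exact (re_le_Cmod ((a, b) - (c, d))%C).
  - apply (is_derive_RInt0 (fun s => Im (g s))). intro s. apply cont_at_component; [|apply Hg].
    intros [a b] [c d]. exact (im_le_Cmod ((a, b) - (c, d))%C).
Qed.

Lemma curve_int_0 (g : R -> C) : curve_int g 0 = 0.
Proof. unfold curve_int. rewrite !RInt_point. reflexivity. Qed.

(** ** Integrals along segments *)

Definition clamp (a b s : R) : R := Rmax a (Rmin b s).

Lemma clamp_in a b s : a <= b -> a <= clamp a b s <= b.
Proof. unfold clamp, Rmax, Rmin. intros. destruct Rle_dec, Rle_dec; lra. Qed.

Lemma clamp_id a b s : a <= s <= b -> clamp a b s = s.
Proof. unfold clamp, Rmax, Rmin. intros. destruct Rle_dec, Rle_dec; lra. Qed.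

Lemma clamp_lip a b s t : Rabs (clamp a b s - clamp a b t) <= Rabs (s - t).
Proof.
  unfold clamp, Rmax, Rmin. repeat destruct Rle_dec; unfold Rabs; repeat destruct Rcase_abs; lra.
Qed.

(** Clamping the parameter to [[0, 1]] makes the integrand continuous on the
    whole line, as [curve_int] requires. *)
Definition seg_int (f : C -> C) (p q : C) : C :=
  ((q - p) * curve_int (fun s => f (seg p q (clamp 0 1 s))) 1)%C.

Definition seg_cont (f : C -> C) (p q : C) : Prop :=
  forall s, 0 <= s <= 1 -> cont_at (fun z : C => z) f (seg p q s).

Lemma seg_clamp_cont f p q : seg_cont f p q ->
  forall s, cont_at RtoC (fun s => f (seg p q (clamp 0 1 s))) s.
Proof.
  intros H s eps Heps.
  destruct (H (clamp 0 1 s) (clamp_in 0 1 s Rle_0_1) eps Heps) as [d [Hd Hf]].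
  assert (Hp : 0 < Cmod (q - p)%C + 1) by (pose proof (Cmod_ge_0 (q - p)%C); lra).
  exists (d / (Cmod (q - p)%C + 1)); split; [apply Rdiv_lt_0_compat; lra|].
  intros y Hy. apply Hf. unfold seg.
  replace (p + (q - p) * clamp 0 1 y - (p + (q - p) * clamp 0 1 s))%C with
    ((q - p) * (clamp 0 1 y - clamp 0 1 s))%C by ring.
  rewrite Cmod_mult, Cmod_RtoC_sub. rewrite Cmod_RtoC_sub in Hy.
  pose proof (clamp_lip 0 1 y s).
  apply Rle_lt_trans with ((Cmod (q - p)%C + 1) * Rabs (y - s)).
  - apply Rmult_le_compat; auto using Cmod_ge_0, Rabs_pos. lra.
  - apply (Rmult_lt_compat_l (Cmod (q - p)%C + 1)) in Hy; [|exact Hp].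
    replace ((Cmod (q - p)%C + 1) * (d / (Cmod (q - p)%C + 1))) with d in Hy by (field; lra).
    exact Hy.
Qed.

Lemma seg_int_spec f p q : seg_cont f p q ->
  exists phi, (forall s, 0 <= s <= 1 -> rder phi s (f (seg p q s) * (q - p))%C) /\
    seg_int f p q = (phi 1%R - phi 0%R)%C.
Proof.
  intro H. exists (fun t => (q - p) * curve_int (fun s => f (seg p q (clamp 0 1 s))) t)%C. split.
  - intros s Hs. apply der_eq with ((q - p) * f (seg p q (clamp 0 1 s)))%C.
    + rewrite clamp_id by exact Hs. ring.
    + apply der_scal. apply (curve_int_der _ (seg_clamp_cont f p q H)).
  - rewrite curve_int_0. unfold seg_int. ring.
Qed.

Lemma seg_int_unique f p q phi : seg_cont f p q ->
  (forall s, 0 <= s <= 1 -> rder phi s (f (seg p q s) * (q - p))%C) ->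
  seg_int f p q = (phi 1%R - phi 0%R)%C.
Proof.
  intros H Hphi. destruct (seg_int_spec f p q H) as [psi [Hpsi ->]].
  assert (E : (psi 1%R - phi 1%R)%C = (psi 0%R - phi 0%R)%C).
  { apply (rder_zero_const (fun s => psi s - phi s)%C 0 1); [lra|]. intros t Ht.
    apply der_eq with (f (seg p q t) * (q - p) - f (seg p q t) * (q - p))%C; [ring|].
    apply der_minus; auto. }
  replace (psi 1%R) with (psi 1%R - phi 1%R + phi 1%R)%C by ring. rewrite E. ring.
Qed.

Lemma seg_int_primitive f P p q : seg_cont f p q ->
  (forall s, 0 <= s <= 1 -> cder P (seg p q s) (f (seg p q s))) ->
  seg_int f p q = (P q - P p)%C.
Proof.
  intros H HP. rewrite (seg_int_unique f p q (fun s => P (seg p q s)) H).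
  - unfold seg. f_equal; [|f_equal]; f_equal; ring.
  - intros s Hs. apply (der_comp RtoC P (seg p q)); [apply HP, Hs | apply rder_seg].
Qed.

(** An affine function has a quadratic primitive, and the integral of the error
    is controlled by the mean value inequality. *)
Lemma seg_int_affine_approx f p q z0 c d M : seg_cont f p q ->
  (forall s, 0 <= s <= 1 -> Cmod (f (seg p q s) - (c + d * (seg p q s - z0)))%C <= M) ->
  Cmod (seg_int f p q - (c * (q - p) + d / 2 * ((q - z0) * (q - z0) - (p - z0) * (p - z0))))%C
    <= M * Cmod (q - p)%C.
Proof.
  intros H HM. destruct (seg_int_spec f p q H) as [phi [Hphi ->]].
  set (A := fun z : C => (c * (z - z0) + d / 2 * ((z - z0) * (z - z0)))%C).
  assert (HA : forall s, rder (fun s => A (seg p q s)) s ((c + d * (seg p q s - z0)) * (q - p))%C).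
  { intro s. apply (der_comp RtoC A (seg p q)); [|apply rder_seg].
    assert (H1 : forall z, cder (fun z => z - z0)%C z 1).
    { intro z. apply der_eq with (1 - 0)%C; [ring|]. apply der_minus; [apply der_coord | apply der_const]. }
    apply der_eq with (c * 1 + d / 2 * (1 * (seg p q s - z0) + (seg p q s - z0) * 1))%C; [field|].
    apply (der_plus _ (fun z => c * (z - z0))%C); apply der_scal; [apply H1|].
    apply (der_mult _ (fun z => z - z0)%C (fun z => z - z0)%C); apply H1. }
  replace (phi 1%R - phi 0%R - (c * (q - p) + d / 2 * ((q - z0) * (q - z0) - (p - z0) * (p - z0))))%C
    with ((phi 1%R - A (seg p q 1)) - (phi 0%R - A (seg p q 0)))%C.
  - replace (M * Cmod (q - p)%C) with (M * Cmod (q - p)%C * (1 - 0)) by ring.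
    apply (mean_value (fun s => phi s - A (seg p q s))%C); [lra|]. intros t Ht.
    eexists. split; [apply der_minus; [apply Hphi, Ht | apply HA]|].
    replace (f (seg p q t) * (q - p) - (c + d * (seg p q t - z0)) * (q - p))%C with
      ((f (seg p q t) - (c + d * (seg p q t - z0))) * (q - p))%C by ring.
    rewrite Cmod_mult. apply Rmult_le_compat_r; [apply Cmod_ge_0 | apply HM, Ht].
  - unfold A, seg. field.
Qed.

Lemma seg_rev p q s : seg p q (1 - s) = seg q p s.
Proof. unfold seg. rewrite RtoC_minus. ring. Qed.

Lemma seg_cont_rev f p q : seg_cont f p q -> seg_cont f q p.
Proof. intros H s Hs. rewrite <- seg_rev. apply H. lra. Qed.

Lemma rder_reparam (phi : R -> C) (a b s : R) v :
  rder phi (a + b * s) v -> rder (fun s => phi (a + b * s)%R) s (b * v)%C.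
Proof.
  intro H. destruct (Req_dec b 0) as [->|Hb].
  { apply der_ext with (fun _ => phi a) (RtoC 0) 1; [lra| |ring|apply der_const].
    intros y _. f_equal. ring. }
  assert (Hb' := Rabs_pos_lt b Hb).
  apply der_weak with (Rabs b). intros eps Heps _.
  destruct (H eps Heps) as [d [Hd Hy]]. exists (d / Rabs b); split; [apply Rdiv_lt_0_compat; lra|].
  intros y Hyd. rewrite Cmod_RtoC_sub in *. specialize (Hy (a + b * y)). rewrite Cmod_RtoC_sub in Hy.
  replace (a + b * y - (a + b * s)) with (b * (y - s)) in Hy by ring. rewrite Rabs_mult in Hy.
  replace (b * v * (RtoC y - RtoC s))%C with (v * (RtoC (a + b * y) - RtoC (a + b * s)))%C
    by (rewrite !RtoC_plus, !RtoC_mult; ring).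
  replace (Rabs b * eps * Rabs (y - s)) with (eps * (Rabs b * Rabs (y - s))) by ring.
  apply Hy. apply (Rmult_lt_compat_l (Rabs b)) in Hyd; [|exact Hb'].
  replace (Rabs b * (d / Rabs b)) with d in Hyd by (field; lra). exact Hyd.
Qed.

Lemma seg_int_rev f p q : seg_cont f p q -> seg_int f q p = (- seg_int f p q)%C.
Proof.
  intro H. destruct (seg_int_spec f p q H) as [phi [Hphi ->]].
  rewrite (seg_int_unique f q p (fun s => phi (1 + (-1) * s)%R) (seg_cont_rev _ _ _ H)).
  - replace (1 + -1 * 1) with 0 by ring. replace (1 + -1 * 0) with 1 by ring. ring.
  - intros s Hs. rewrite <- seg_rev. replace (1 - s) with (1 + (-1) * s) by ring.
    apply der_eq with (RtoC (-1) * (f (seg p q (1 + (-1) * s)) * (q - p)))%C; [ring|].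
    apply rder_reparam. apply Hphi. lra.
Qed.

Lemma RtoC_half : RtoC (/ 2) = (/ 2)%C.
Proof. apply RtoC_inv. lra. Qed.

Definition mid (p q : C) : C := ((p + q) / 2)%C.

Lemma seg_mid_l p q s : seg p (mid p q) s = seg p q (0 + / 2 * s).
Proof. unfold seg, mid. rewrite RtoC_plus, RtoC_mult, RtoC_half. field. Qed.

Lemma seg_mid_r p q s : seg (mid p q) q s = seg p q (/ 2 + / 2 * s).
Proof. unfold seg, mid. rewrite RtoC_plus, RtoC_mult, RtoC_half. field. Qed.

Lemma seg_int_mid f p q : seg_cont f p q ->
  seg_int f p q = (seg_int f p (mid p q) + seg_int f (mid p q) q)%C.
Proof.
  intro H. destruct (seg_int_spec f p q H) as [phi [Hphi ->]].
  rewrite (seg_int_unique f p (mid p q) (fun s => phi (0 + / 2 * s)%R)).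
  - rewrite (seg_int_unique f (mid p q) q (fun s => phi (/ 2 + / 2 * s)%R)).
    + replace (0 + / 2 * 1) with (/ 2 + / 2 * 0) by ring.
      replace (/ 2 + / 2 * 1) with 1 by field. replace (0 + / 2 * 0) with 0 by ring. ring.
    + intros s Hs. rewrite seg_mid_r. apply H. lra.
    + intros s Hs. rewrite seg_mid_r.
      apply der_eq with (RtoC (/ 2) * (f (seg p q (/ 2 + / 2 * s)) * (q - p)))%C.
      * unfold mid. rewrite RtoC_half. field.
      * apply rder_reparam. apply Hphi. lra.
  - intros s Hs. rewrite seg_mid_l. apply H. lra.
  - intros s Hs. rewrite seg_mid_l.
    apply der_eq with (RtoC (/ 2) * (f (seg p q (0 + / 2 * s)) * (q - p)))%C.
    * unfold mid. rewrite RtoC_half. field.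
    * apply rder_reparam. apply Hphi. lra.
Qed.

(** ** Geometrically converging sequences *)

Lemma R_geom_lim (x : nat -> R) K :
  (forall n, Rabs (x (S n) - x n) <= K * (/ 2) ^ n) ->
  exists l, forall n, Rabs (x n - l) <= 2 * K * (/ 2) ^ n.
Proof.
  intro H.
  (* The intervals of radius [2 K 2^-n] around [x n] are nested. *)
  assert (Hmon : forall n k, x n - 2 * K * (/ 2) ^ n <= x (n + k)%nat - 2 * K * (/ 2) ^ (n + k) /\
    x (n + k)%nat + 2 * K * (/ 2) ^ (n + k) <= x n + 2 * K * (/ 2) ^ n).
  { intros n k. induction k as [|k IH].
    - rewrite Nat.add_0_r. lra.
    - rewrite Nat.add_succ_r. specialize (H (n + k)%nat). simpl.
      assert (0 < (/ 2) ^ (n + k)) by (apply pow_lt; lra).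
      apply Rabs_le_between in H. nra. }
  assert (HK : forall n, 0 <= K * (/ 2) ^ n).
  { intro n. eapply Rle_trans; [apply Rabs_pos | apply (H n)]. }
  assert (Hc : forall n m, x n - 2 * K * (/ 2) ^ n <= x m + 2 * K * (/ 2) ^ m).
  { intros n m. destruct (Nat.le_ge_cases n m) as [L|L].
    - replace m with (n + (m - n))%nat by lia.
      destruct (Hmon n (m - n)%nat) as [A _]. pose proof (HK (n + (m - n))%nat). lra.
    - replace n with (m + (n - m))%nat by lia.
      destruct (Hmon m (n - m)%nat) as [_ A]. pose proof (HK (m + (n - m))%nat). lra. }
  destruct (completeness (fun y => exists n, y = x n - 2 * K * (/ 2) ^ n)) as [l [Hl1 Hl2]].
  - exists (x 0%nat + 2 * K * (/ 2) ^ 0). intros y [n ->]. apply Hc.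
  - exists (x 0%nat - 2 * K * (/ 2) ^ 0). exists 0%nat. reflexivity.
  - exists l. intro n. apply Rabs_le_between. split.
    + assert (l <= x n + 2 * K * (/ 2) ^ n); [|lra]. apply Hl2. intros y [m ->]. apply Hc.
    + assert (x n - 2 * K * (/ 2) ^ n <= l); [|lra]. apply Hl1. exists n. reflexivity.
Qed.

Lemma C_geom_lim (x : nat -> C) K :
  (forall n, Cmod (x (S n) - x n)%C <= K * (/ 2) ^ n) ->
  exists l, forall n, Cmod (x n - l)%C <= 4 * K * (/ 2) ^ n.
Proof.
  intro H.
  destruct (R_geom_lim (fun n => Re (x n)) K) as [a Ha].
  { intro n. eapply Rle_trans; [|apply H]. destruct (x (S n)), (x n).
    apply (re_le_Cmod ((_, _) - (_, _))%C). }
  destruct (R_geom_lim (fun n => Im (x n)) K) as [b Hb].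
  { intro n. eapply Rle_trans; [|apply H]. destruct (x (S n)), (x n).
    apply (im_le_Cmod ((_, _) - (_, _))%C). }
  exists (a, b). intro n. eapply Rle_trans; [apply Cmod_le_re_im|].
  specialize (Ha n). specialize (Hb n). destruct (x n) as [u v]. simpl in *.
  change (Rabs (u - a) + Rabs (v - b) <= 4 * K * (/ 2) ^ n). lra.
Qed.

Lemma half_pow_small K e : 0 < e -> exists n, K * (/ 2) ^ n < e.
Proof.
  intro He. assert (HK : 0 < Rabs K + 1) by (pose proof (Rabs_pos K); lra).
  destruct (pow_lt_1_zero (/ 2)) with (y := e / (Rabs K + 1)) as [N HN].
  - rewrite Rabs_pos_eq; lra.
  - apply Rdiv_lt_0_compat; lra.
  - exists N. specialize (HN N (Nat.le_refl N)).
    assert (Hp : 0 < (/ 2) ^ N) by (apply pow_lt; lra).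
    rewrite Rabs_pos_eq in HN by lra.
    apply (Rmult_lt_compat_l (Rabs K + 1)) in HN; [|exact HK].
    replace ((Rabs K + 1) * (e / (Rabs K + 1))) with e in HN by (field; lra).
    pose proof (Rle_abs K). nra.
Qed.

Lemma dependent_choice {T : Type} (P : T -> Prop) (Q : T -> T -> Prop) (x0 : T) :
  P x0 -> (forall x, P x -> exists y, P y /\ Q x y) ->
  exists u : nat -> T, u 0%nat = x0 /\ forall n, P (u n) /\ Q (u n) (u (S n)).
Proof.
  intros H0 H.
  set (step := fun s : {x | P x} =>
    let e := constructive_indefinite_description _ (H (proj1_sig s) (proj2_sig s)) in
    exist P (proj1_sig e) (proj1 (proj2_sig e))).
  set (u := fix u n := match n with O => exist P x0 H0 | S m => step (u m) end).
  exists (fun n => proj1_sig (u n)). split; [reflexivity|]. intro n.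
  split; [apply proj2_sig|]. change (u (S n)) with (step (u n)). unfold step. simpl.
  destruct constructive_indefinite_description as [y [Hy1 Hy2]]. exact Hy2.
Qed.

(** ** Goursat's lemma *)

Definition tri_int (f : C -> C) (t : C * C * C) : C :=
  let '(p, q, r) := t in (seg_int f p q + seg_int f q r + seg_int f r p)%C.

Definition tri_in (c : C) (rho : R) (t : C * C * C) : Prop :=
  let '(p, q, r) := t in
  Cmod (p - c)%C <= rho /\ Cmod (q - c)%C <= rho /\ Cmod (r - c)%C <= rho.

Definition tri_diam (t : C * C * C) (D : R) : Prop :=
  let '(p, q, r) := t in
  Cmod (q - p)%C <= D /\ Cmod (r - q)%C <= D /\ Cmod (p - r)%C <= D.

Definition corner (t : C * C * C) : C := let '(p, _, _) := t in p.

Lemma mid_disc p q c rho : Cmod (p - c)%C <= rho -> Cmod (q - c)%C <= rho ->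
  Cmod (mid p q - c)%C <= rho.
Proof.
  intros. replace (mid p q) with (seg p q (/ 2)).
  - apply seg_disc; auto; lra.
  - unfold seg, mid. rewrite RtoC_half. field.
Qed.

Lemma Cmod_half z D : Cmod z <= D -> Cmod (z / 2)%C <= D / 2.
Proof.
  intro H. unfold Cdiv. rewrite Cmod_mult, Cmod_inv, Cmod_R, Rabs_pos_eq.
  - lra.
  - lra.
  - intro E. apply RtoC_inj in E. lra.
Qed.

Section Goursat.
Variables (f : C -> C) (c : C) (rho : R).
Hypothesis Hf : forall z, Cmod (z - c)%C <= rho -> exists l, cder f z l.

Lemma seg_cont_disc p q :
  Cmod (p - c)%C <= rho -> Cmod (q - c)%C <= rho -> seg_cont f p q.
Proof.
  intros Hp Hq s Hs. destruct (Hf (seg p q s)) as [l Hl].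
  - apply seg_disc; auto.
  - apply (der_cont _ _ _ _ Hl).
Qed.

(** Joining the midpoints of the sides cuts a triangle into four, and the four
    integrals add up to the given one. *)
Lemma tri_quarter t D : tri_in c rho t -> tri_diam t D ->
  exists t', tri_in c rho t' /\ tri_diam t' (D / 2) /\ Cmod (corner t' - corner t)%C <= D /\
    Cmod (tri_int f t) / 4 <= Cmod (tri_int f t').
Proof.
  destruct t as [[p q] r]. intros (Hp & Hq & Hr) (D1 & D2 & D3).
  assert (Ha := mid_disc q r c rho Hq Hr). assert (Hb := mid_disc r p c rho Hr Hp).
  assert (Hc := mid_disc p q c rho Hp Hq).
  set (a := mid q r) in *. set (b := mid r p) in *. set (e := mid p q) in *.
  assert (E : tri_int f (p, q, r) =
    (tri_int f (p, e, b) + tri_int f (e, q, a) + tri_int f (b, a, r) + tri_int f (a, b, e))%C).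
  { unfold tri_int.
    rewrite (seg_int_mid f p q), (seg_int_mid f q r), (seg_int_mid f r p) by (apply seg_cont_disc; auto).
    fold a b e.
    rewrite (seg_int_rev f e b), (seg_int_rev f a e), (seg_int_rev f b a) by (apply seg_cont_disc; auto).
    ring. }
  assert (S : Cmod (tri_int f (p, q, r)) <= Cmod (tri_int f (p, e, b)) + Cmod (tri_int f (e, q, a))
    + Cmod (tri_int f (b, a, r)) + Cmod (tri_int f (a, b, e))).
  { rewrite E. eapply Rle_trans; [apply Cmod_triangle|]. apply Rplus_le_compat_r.
    eapply Rle_trans; [apply Cmod_triangle|]. apply Rplus_le_compat_r. apply Cmod_triangle. }
  assert (half : forall x y z, x = (y / 2)%C -> Cmod y <= z -> Cmod x <= z / 2).
  { intros x y z -> Hy. apply Cmod_half, Hy. }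
  assert (opp : forall x y, Cmod (x - y)%C <= D -> Cmod (y - x)%C <= D).
  { intros x y. rewrite Cmod_sub_sym. auto. }
  assert (HD : 0 <= D) by (eapply Rle_trans; [apply Cmod_ge_0 | exact D1]).
  assert (halfD : forall x y, x = (y / 2)%C -> Cmod y <= D -> Cmod x <= D).
  { intros x y Hx Hy. pose proof (half x y D Hx Hy). lra. }
  destruct (Rle_dec (Cmod (tri_int f (p, q, r)) / 4) (Cmod (tri_int f (p, e, b)))) as [L|L1].
  { exists (p, e, b). repeat split; auto; unfold corner, e, b, mid.
    - apply half with (q - p)%C; [field | auto].
    - apply half with (r - q)%C; [field | auto].
    - apply half with (p - r)%C; [field | auto].
    - rewrite Cmod_sub_self. exact HD. }
  destruct (Rle_dec (Cmod (tri_int f (p, q, r)) / 4) (Cmod (tri_int f (e, q, a)))) as [L|L2].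
  { exists (e, q, a). repeat split; auto; unfold corner, e, a, mid.
    - apply half with (q - p)%C; [field | auto].
    - apply half with (r - q)%C; [field | auto].
    - apply half with (p - r)%C; [field | auto].
    - apply halfD with (q - p)%C; [field | auto]. }
  destruct (Rle_dec (Cmod (tri_int f (p, q, r)) / 4) (Cmod (tri_int f (b, a, r)))) as [L|L3].
  { exists (b, a, r). repeat split; auto; unfold corner, b, a, mid.
    - apply half with (q - p)%C; [field | auto].
    - apply half with (r - q)%C; [field | auto].
    - apply half with (p - r)%C; [field | auto].
    - apply halfD with (r - p)%C; [field | auto]. }
  exists (a, b, e). repeat split; auto; unfold corner, e, b, a, mid.
  - apply half with (p - q)%C; [field | auto].
  - apply half with (q - r)%C; [field | auto].
  - apply half with (r - p)%C; [field | auto].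
  - replace ((q + r) / 2 - p)%C with ((q - p) / 2 + (r - p) / 2)%C by field.
    eapply Rle_trans; [apply Cmod_triangle|].
    pose proof (Cmod_half _ _ D1). pose proof (Cmod_half _ _ (opp _ _ D3)). lra.
  - change (Cmod (tri_int f (p, q, r)) / 4 <= Cmod (tri_int f (a, b, e))). lra.
Qed.

(** The affine part of [f] at the common point of the nested triangles has
    integral zero around each of them, so only the error term of the
    derivative contributes, and it is smaller than the area. *)
Lemma goursat t : tri_in c rho t -> tri_int f t = 0.
Proof.
  intro Ht.
  assert (HD : exists D, 0 <= D /\ tri_diam t D).
  { destruct t as [[p q] r].
    exists (Cmod (q - p)%C + Cmod (r - q)%C + Cmod (p - r)%C). simpl.
    pose proof (Cmod_ge_0 (q - p)%C). pose proof (Cmod_ge_0 (r - q)%C).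
    pose proof (Cmod_ge_0 (p - r)%C). lra. }
  destruct HD as [D [HD0 HD]].
  set (P := fun s : (C * C * C) * R => tri_in c rho (fst s) /\ tri_diam (fst s) (snd s)).
  set (Q := fun s s' : (C * C * C) * R => snd s' = snd s / 2 /\
    Cmod (corner (fst s') - corner (fst s))%C <= snd s /\
    Cmod (tri_int f (fst s)) / 4 <= Cmod (tri_int f (fst s'))).
  destruct (dependent_choice P Q (t, D)) as [u [Hu0 Hu]].
  { split; assumption. }
  { intros [s E] [H1 H2]. destruct (tri_quarter s E H1 H2) as (s' & A1 & A2 & A3 & A4).
    exists (s', E / 2). repeat split; simpl; assumption. }
  assert (HuD : forall n, snd (u n) = D * (/ 2) ^ n).
  { induction n as [|n IH]; [rewrite Hu0; simpl; ring|].
    destruct (Hu n) as [_ [-> _]]. rewrite IH. simpl. field. }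
  assert (HuT : forall n, Cmod (tri_int f t) * ((/ 2) ^ n * (/ 2) ^ n) <= Cmod (tri_int f (fst (u n)))).
  { induction n as [|n IH]; [rewrite Hu0; simpl; lra|].
    destruct (Hu n) as [_ (_ & _ & A)]. simpl. lra. }
  destruct (C_geom_lim (fun n => corner (fst (u n))) D) as [z Hz].
  { intro n. destruct (Hu n) as [_ (_ & A & _)]. rewrite <- HuD. exact A. }
  assert (Hpow : forall n, 0 < (/ 2) ^ n) by (intro; apply pow_lt; lra).
  assert (Hzc : Cmod (z - c)%C <= rho).
  { apply le_epsilon. intros e He. destruct (half_pow_small (4 * D) e He) as [n Hn].
    specialize (Hz n). destruct (Hu n) as [[A _] _]. destruct (fst (u n)) as [[p q] r].
    simpl in Hz. destruct A as [A _]. pose proof (Cmod_sub_triangle z p c).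
    rewrite (Cmod_sub_sym z p) in H. lra. }
  destruct (Hf z Hzc) as [l Hl].
  apply Cmod_le_eps. intros e He.
  set (e' := e / (15 * (D * D) + 1)).
  assert (HDD : 0 <= D * D) by nra.
  assert (He' : 0 < e') by (apply Rdiv_lt_0_compat; lra).
  destruct (Hl e' He') as [d [Hd Hy]].
  destruct (half_pow_small (5 * D) d Hd) as [n Hn].
  specialize (Hz n). specialize (HuT n). destruct (Hu n) as [[A B] _]. rewrite HuD in B.
  destruct (fst (u n)) as [[p q] r]. simpl in Hz, A, B, HuT.
  destruct A as (A1 & A2 & A3), B as (B1 & B2 & B3).
  set (h := (/ 2) ^ n) in *. assert (Hh : 0 < h) by apply Hpow.
  assert (HDh : 0 <= D * h) by (apply Rmult_le_pos; lra).
  assert (Q1 : Cmod (p - z)%C <= 5 * (D * h)) by lra.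
  assert (Q2 : Cmod (q - z)%C <= 5 * (D * h)) by (pose proof (Cmod_sub_triangle q p z); lra).
  assert (Q3 : Cmod (r - z)%C <= 5 * (D * h)).
  { pose proof (Cmod_sub_triangle r p z). rewrite (Cmod_sub_sym r p) in H. lra. }
  assert (side : forall v w, Cmod (v - c)%C <= rho -> Cmod (w - c)%C <= rho ->
    Cmod (v - z)%C <= 5 * (D * h) -> Cmod (w - z)%C <= 5 * (D * h) -> Cmod (w - v)%C <= D * h ->
    Cmod (seg_int f v w - (f z * (w - v) + l / 2 * ((w - z) * (w - z) - (v - z) * (v - z))))%C
    <= e' * (5 * (D * h)) * (D * h)).
  { intros v w Hv Hw Hvz Hwz Hvw.
    eapply Rle_trans; [apply seg_int_affine_approx with (M := e' * (5 * (D * h)))|].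
    - apply seg_cont_disc; auto.
    - intros s Hs. assert (Hsz := seg_disc v w s z (5 * (D * h)) Hvz Hwz Hs).
      replace (f (seg v w s) - (f z + l * (seg v w s - z)))%C with
        (f (seg v w s) - f z - l * (seg v w s - z))%C by ring.
      eapply Rle_trans; [apply Hy; lra|]. apply Rmult_le_compat_l; lra.
    - apply Rmult_le_compat_l; [|exact Hvw]. apply Rmult_le_pos; [lra|]. nra. }
  assert (S1 := side p q A1 A2 Q1 Q2 B1). assert (S2 := side q r A2 A3 Q2 Q3 B2).
  assert (S3 := side r p A3 A1 Q3 Q1 B3).
  assert (S : Cmod (seg_int f p q + seg_int f q r + seg_int f r p)%C <= 3 * (e' * (5 * (D * h)) * (D * h))).
  { match type of S1 with Cmod ?x <= _ => match type of S2 with Cmod ?y <= _ =>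
      match type of S3 with Cmod ?w <= _ =>
      replace (seg_int f p q + seg_int f q r + seg_int f r p)%C with (x + y + w)%C by (field; auto) end end end.
    eapply Rle_trans; [apply Cmod_triangle|].
    eapply Rle_trans; [apply Rplus_le_compat_r, Cmod_triangle|]. lra. }
  apply Rmult_le_reg_r with (h * h); [nra|].
  eapply Rle_trans; [exact HuT|]. eapply Rle_trans; [exact S|].
  replace (3 * (e' * (5 * (D * h)) * (D * h))) with (15 * (D * D) * e' * (h * h)) by ring.
  apply Rmult_le_compat_r; [nra|]. unfold e'.
  apply Rmult_le_reg_r with (15 * (D * D) + 1); [lra|]. field_simplify; nra.
Qed.

End Goursat.

(** The integral along the segment from the centre is a primitive, by Goursat's
    lemma for the triangles with a vertex in the centre. *)
Theorem primitive_on_disc f c R0 :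
  (forall z, Cmod (z - c)%C < R0 -> exists l, cder f z l) ->
  exists P, forall z, Cmod (z - c)%C < R0 -> cder P z (f z).
Proof.
  intro Hf. exists (seg_int f c). intros z Hz eps Heps.
  set (rho := (Cmod (z - c)%C + R0) / 2).
  assert (Hrho : forall w, Cmod (w - c)%C <= rho -> exists l, cder f w l).
  { intros w Hw. apply Hf. unfold rho in Hw. lra. }
  destruct (Hf z Hz) as [l Hl]. destruct (der_cont _ _ _ _ Hl eps Heps) as [d [Hd Hy]].
  exists (Rmin d (rho - Cmod (z - c)%C)). split; [apply Rmin_pos; unfold rho; lra|].
  intros w Hw. assert (Hw1 := Rlt_le_trans _ _ _ Hw (Rmin_l _ _)).
  assert (Hw2 := Rlt_le_trans _ _ _ Hw (Rmin_r _ _)).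
  assert (Hc : Cmod (c - c)%C <= rho).
  { rewrite Cmod_sub_self. unfold rho. pose proof (Cmod_ge_0 (z - c)%C). lra. }
  assert (Hz' : Cmod (z - c)%C <= rho) by (unfold rho; lra).
  assert (Hw' : Cmod (w - c)%C <= rho) by (pose proof (Cmod_sub_triangle w z c); lra).
  assert (G := goursat f c rho Hrho (c, z, w) (conj Hc (conj Hz' Hw'))). simpl in G.
  rewrite (seg_int_rev f c w) in G by (apply (seg_cont_disc f c rho Hrho); auto).
  replace (seg_int f c w - seg_int f c z)%C with (seg_int f z w).
  2:{ replace (seg_int f z w) with (seg_int f c z + seg_int f z w + - seg_int f c w
        - seg_int f c z + seg_int f c w)%C by ring. rewrite G. ring. }
  assert (A := seg_int_affine_approx f z w z (f z) 0 eps (seg_cont_disc f c rho Hrho z w Hz' Hw')).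
  replace (seg_int f z w - f z * (w - z))%C with
    (seg_int f z w - (f z * (w - z) + 0 / 2 * ((w - z) * (w - z) - (z - z) * (z - z))))%C by (field; auto).
  apply A. intros s Hs. replace (f z + 0 * (seg z w s - z))%C with (f z) by ring.
  left. apply Hy. apply Rle_lt_trans with (Cmod (w - z)%C); [|exact Hw1].
  apply seg_disc; auto; [rewrite Cmod_sub_self; apply Cmod_ge_0 | lra].
Qed.

(** * The complex exponential *)

Definition Cexp (z : C) : C := (exp (Re z) * cos (Im z), exp (Re z) * sin (Im z)).

Lemma Cexp_plus z w : Cexp (z + w)%C = (Cexp z * Cexp w)%C.
Proof.
  destruct z as [a b], w as [c d]. unfold Cexp, Cmult. simpl.
  rewrite exp_plus, cos_plus, sin_plus. f_equal; ring.
Qed.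

Lemma Cexp_0 : Cexp 0 = 1.
Proof. unfold Cexp. simpl. rewrite exp_0, cos_0, sin_0. unfold RtoC. f_equal; ring. Qed.

Lemma Cexp_opp z : (Cexp z * Cexp (- z))%C = 1.
Proof. rewrite <- Cexp_plus, <- Cexp_0. f_equal. ring. Qed.

Lemma Cmod_Cexp z : Cmod (Cexp z) = exp (Re z).
Proof.
  assert (H := Cmod2_alt (Cexp z)). unfold Cexp at 2 3 in H. simpl Re in H. simpl Im in H.
  assert (S := sin2_cos2 (Im z)). unfold Rsqr in S.
  assert (E : Cmod (Cexp z) ^ 2 = exp (Re z) ^ 2) by (rewrite H; nra).
  assert (0 < exp (Re z)) by apply exp_pos. pose proof (Cmod_ge_0 (Cexp z)). nra.
Qed.

Lemma Cexp_neq_0 z : Cexp z <> 0.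
Proof. apply Cmod_gt_0. rewrite Cmod_Cexp. apply exp_pos. Qed.

Lemma Cexp_inv z : Cexp (- z) = (/ Cexp z)%C.
Proof.
  assert (H := Cexp_opp z). assert (H0 := Cexp_neq_0 z).
  replace (Cexp (- z)) with (Cexp z * Cexp (- z) * / Cexp z)%C by (field; auto).
  rewrite H. ring.
Qed.

Definition twopii : C := (0, 2 * PI).

Lemma Cexp_period z : Cexp (z + twopii)%C = Cexp z.
Proof.
  destruct z as [a b]. unfold Cexp, twopii. simpl.
  rewrite Rplus_0_r, cos_plus, sin_plus, cos_2PI, sin_2PI. f_equal; ring.
Qed.

Lemma Cminus_0_r (z : C) : (z - 0)%C = z.
Proof. ring. Qed.

Lemma cder_Cexp_0 : cder Cexp 0 1.
Proof.
  apply der_weak with 20. intros eps Heps Heps1.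
  destruct (is_derive_eps _ _ _ (is_derive_exp 0) eps Heps) as [d1 [Hd1 H1]].
  destruct (is_derive_eps _ _ _ (is_derive_cos 0) eps Heps) as [d2 [Hd2 H2]].
  destruct (is_derive_eps _ _ _ (is_derive_sin 0) eps Heps) as [d3 [Hd3 H3]].
  exists (Rmin eps (Rmin d1 (Rmin d2 d3))). split; [repeat apply Rmin_pos; lra|].
  intros [x y] Hxy. rewrite Cexp_0. rewrite Cminus_0_r in *.
  assert (Hx := re_le_Cmod (x, y)). assert (Hy := im_le_Cmod (x, y)). simpl in Hx, Hy.
  set (D := Cmod (x, y)) in *.
  assert (G0 := Rlt_le_trans _ _ _ Hxy (Rmin_l _ _)).
  assert (G := Rlt_le_trans _ _ _ Hxy (Rmin_r _ _)).
  assert (G1 := Rlt_le_trans _ _ _ G (Rmin_l _ _)).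
  assert (G' := Rlt_le_trans _ _ _ G (Rmin_r _ _)).
  assert (G2 := Rlt_le_trans _ _ _ G' (Rmin_l _ _)).
  assert (G3 := Rlt_le_trans _ _ _ G' (Rmin_r _ _)).
  specialize (H1 x). specialize (H2 y). specialize (H3 y).
  rewrite Rminus_0_r in *. rewrite exp_0, cos_0, sin_0 in *.
  specialize (H1 ltac:(lra)). specialize (H2 ltac:(lra)). specialize (H3 ltac:(lra)).
  replace (exp x - 1 - x * 1) with (exp x - 1 - x) in H1 by ring.
  replace (cos y - 1 - y * - 0) with (cos y - 1) in H2 by ring.
  replace (sin y - 0 - y * 1) with (sin y - y) in H3 by ring.
  pose proof (Rabs_pos x). pose proof (Rabs_pos y).
  assert (Hc : Rabs (cos y) <= 1) by (apply Rabs_le; pose proof (COS_bound y); lra).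
  assert (E1 : Rabs (exp x - 1) <= 2 * D).
  { replace (exp x - 1) with ((exp x - 1 - x) + x) by ring.
    eapply Rle_trans; [apply Rabs_triang|]. nra. }
  assert (E2 : Rabs (sin y) <= 2 * D).
  { replace (sin y) with ((sin y - y) + y) by ring.
    eapply Rle_trans; [apply Rabs_triang|]. nra. }
  eapply Rle_trans; [apply Cmod_le_re_im|]. unfold Cexp. simpl.
  replace (exp x * cos y + - (1) + - (1 * x - 0 * y)) with
    ((exp x - 1 - x) * cos y + (1 + x) * (cos y - 1)) by ring.
  replace (exp x * sin y + - 0 + - (1 * y + 0 * x)) with
    ((exp x - 1) * sin y + (sin y - y)) by ring.
  assert (A1 : Rabs ((exp x - 1 - x) * cos y + (1 + x) * (cos y - 1)) <= eps * D * 1 + 2 * (eps * D)).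
  { eapply Rle_trans; [apply Rabs_triang|]. rewrite !Rabs_mult. apply Rplus_le_compat.
    - apply Rmult_le_compat; auto using Rabs_pos. nra.
    - apply Rmult_le_compat; auto using Rabs_pos; [|nra].
      eapply Rle_trans; [apply Rabs_triang|]. rewrite Rabs_R1. lra. }
  assert (A2 : Rabs ((exp x - 1) * sin y + (sin y - y)) <= 2 * D * (2 * eps) + eps * D).
  { eapply Rle_trans; [apply Rabs_triang|]. rewrite Rabs_mult. apply Rplus_le_compat; [|nra].
    apply Rmult_le_compat; auto using Rabs_pos. lra. }
  assert (0 <= D) by lra. nra.
Qed.

Lemma cder_Cexp z : cder Cexp z (Cexp z).
Proof.
  apply der_ext with (fun w => Cexp z * Cexp (w - z))%C (Cexp z * (1 * 1))%C 1; [lra| |ring|].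
  - intros y _. rewrite <- Cexp_plus. f_equal. ring.
  - apply (der_scal _ (Cexp z) (fun w => Cexp (w - z)%C)).
    apply (der_comp _ Cexp (fun w => w - z)%C).
    + replace (z - z)%C with (RtoC 0) by ring. apply cder_Cexp_0.
    + apply der_eq with (1 - 0)%C; [ring|]. apply der_minus; [apply der_coord | apply der_const].
Qed.

(** * Entire functions *)

Definition holo (f : C -> C) : Prop := forall z, exists l, cder f z l.

Lemma cder_shift f z c l : cder f (z + c)%C l -> cder (fun w => f (w + c)%C) z l.
Proof.
  intro H. apply der_eq with (l * (1 + 0))%C; [ring|].
  apply (der_comp _ f (fun w => w + c)%C); [exact H|].
  apply (der_plus _ (fun w => w)); [apply der_coord | apply der_const].
Qed.

(** A primitive [P] of [k w = f (z + exp w) exp (-w)] has the increment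
    [P (w + 2 pi i) - P w] independent of [w], because [k] is periodic.  Far to
    the left the increment is [2 pi i f'(z)]; on the line [Re w = ln r] it is
    bounded by the values of [f] on the circle of radius [r]. *)
Theorem cauchy_estimate f z l r M :
  holo f -> cder f z l -> 0 < r -> (forall w, Cmod (w - z)%C = r -> Cmod (f w) <= M) ->
  Cmod l <= M / r.
Proof.
  intros Hf Hl Hr HM.
  set (k := fun w => (f (z + Cexp w) * Cexp (- w))%C).
  assert (Hopp : forall w, cder (fun w => - w)%C w (- (1))%C) by (intro; apply der_opp, der_coord).
  assert (Hexpopp : forall w, cder (fun w => Cexp (- w)%C) w (Cexp (- w) * - (1))%C).
  { intro w. apply (der_comp _ Cexp (fun w => - w)%C); [apply cder_Cexp | apply Hopp]. }
  assert (Hk : forall w, exists d, cder k w d).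
  { intro w. destruct (Hf (z + Cexp w)%C) as [d Hd]. eexists.
    apply (der_mult _ (fun w => f (z + Cexp w)%C) (fun w => Cexp (- w)%C)); [|apply Hexpopp].
    apply (der_comp _ f (fun w => z + Cexp w)%C); [exact Hd|].
    apply der_plus; [apply der_const | apply cder_Cexp]. }
  assert (Hper : forall w, k (w + twopii)%C = k w).
  { intro w. unfold k. rewrite !Cexp_inv, Cexp_period. reflexivity. }
  assert (Hpi := PI_RGT_0).
  assert (Htp : Cmod twopii = 2 * PI).
  { unfold twopii, Cmod. simpl. replace (0 * (0 * 1) + 2 * PI * (2 * PI * 1)) with ((2 * PI) * (2 * PI)) by ring.
    apply sqrt_square. lra. }
  apply le_epsilon. intros eps Heps.
  destruct (Hl eps Heps) as [d [Hd Hy]].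
  set (x0 := ln r). set (x1 := ln d - 1).
  set (R0 := Rabs x0 + Rabs x1 + 2 * PI + 1).
  destruct (primitive_on_disc k 0 R0 (fun w _ => Hk w)) as [P HP].
  assert (Hin : forall t, 0 <= t <= 1 -> forall s, 0 <= s <= 1 ->
    Cmod (seg x0 x1 t + s * twopii - 0)%C < R0).
  { intros t Ht s Hs. replace (seg x0 x1 t + s * twopii - 0)%C with (seg x0 x1 t + s * twopii)%C by ring.
    eapply Rle_lt_trans; [apply Cmod_triangle|]. rewrite Cmod_mult, Htp, Cmod_R, (Rabs_pos_eq s) by lra.
    assert (Cmod (seg x0 x1 t - 0)%C <= Rabs x0 + Rabs x1).
    { apply seg_disc; [| |exact Ht];
        [replace (RtoC x0 - 0)%C with (RtoC x0) by ring | replace (RtoC x1 - 0)%C with (RtoC x1) by ring];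
        rewrite Cmod_R; pose proof (Rabs_pos x0); pose proof (Rabs_pos x1); lra. }
    replace (seg x0 x1 t - 0)%C with (seg x0 x1 t) in H by ring. unfold R0. nra. }
  assert (Hin0 : forall t, 0 <= t <= 1 -> Cmod (seg x0 x1 t - 0)%C < R0).
  { intros t Ht. specialize (Hin t Ht 0 ltac:(lra)).
    replace (seg x0 x1 t + 0 * twopii - 0)%C with (seg x0 x1 t - 0)%C in Hin by ring. exact Hin. }
  assert (Hin1 : forall t, 0 <= t <= 1 -> Cmod (seg x0 x1 t + twopii - 0)%C < R0).
  { intros t Ht. specialize (Hin t Ht 1 ltac:(lra)).
    replace (seg x0 x1 t + 1 * twopii - 0)%C with (seg x0 x1 t + twopii - 0)%C in Hin by ring. exact Hin. }
  assert (S0 : seg x0 x1 0 = x0) by (unfold seg; ring).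
  assert (S1 : seg x0 x1 1 = x1) by (unfold seg; ring).
  assert (Hinc : (P (x1 + twopii) - P x1)%C = (P (x0 + twopii) - P x0)%C).
  { apply Cmod_zero_eq. rewrite <- (Rmult_0_l (Cmod (RtoC x1 - RtoC x0)%C)).
    apply (cder_mean_value (fun w => P (w + twopii) - P w)%C). intros s Hs.
    exists (k (seg x0 x1 s + twopii) - k (seg x0 x1 s))%C. split.
    - apply (der_minus _ (fun w => P (w + twopii)%C) P).
      + apply cder_shift, HP, Hin1, Hs.
      + apply HP, Hin0, Hs.
    - rewrite Hper, Cmod_sub_self. lra. }
  assert (Hvert : forall x s, Re (seg (RtoC x) (x + twopii) s) = x).
  { intros x s. unfold seg, twopii. simpl. ring. }
  assert (Hsv : forall x s, seg (RtoC x) (x + twopii) s = (x + s * twopii)%C).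
  { intros x s. unfold seg. ring. }
  assert (B0 : Cmod (P (x0 + twopii) - P x0)%C <= M / r * (2 * PI)).
  { rewrite <- Htp. replace twopii with (x0 + twopii - x0)%C at 2 by ring.
    apply cder_mean_value. intros s Hs. exists (k (seg x0 (x0 + twopii) s)). split.
    - apply HP. rewrite Hsv. specialize (Hin 0 ltac:(lra) s Hs). rewrite S0 in Hin. exact Hin.
    - unfold k. rewrite Cexp_inv, Cmod_mult, Cmod_inv by apply Cexp_neq_0.
      assert (E : Cmod (Cexp (seg x0 (x0 + twopii) s)) = r).
      { rewrite Cmod_Cexp, Hvert. apply exp_ln, Hr. }
      rewrite E. apply Rmult_le_compat_r; [left; apply Rinv_0_lt_compat, Hr|].
      apply HM. rewrite <- E. f_equal. ring. }
  assert (B1 : Cmod (P (x1 + twopii) - P x1 - l * twopii)%C <= eps * (2 * PI)).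
  { set (G := fun w => (P w - (- f z * Cexp (- w) + l * w))%C).
    replace (P (x1 + twopii) - P x1 - l * twopii)%C with (G (x1 + twopii) - G x1)%C.
    2:{ unfold G. rewrite !Cexp_inv, Cexp_period. ring. }
    rewrite <- Htp. replace twopii with (x1 + twopii - x1)%C at 2 by ring.
    apply cder_mean_value. intros s Hs. set (w := seg x1 (x1 + twopii) s).
    exists (k w - (- f z * (Cexp (- w) * - (1)) + l * 1))%C. split.
    - apply (der_minus _ P); [apply HP|].
      + unfold w. rewrite Hsv. specialize (Hin 1 ltac:(lra) s Hs). rewrite S1 in Hin. exact Hin.
      + apply (der_plus _ (fun w => - f z * Cexp (- w))%C (fun w => l * w)%C).
        * apply (der_scal _ (- f z)%C (fun w => Cexp (- w)%C)), Hexpopp.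
        * apply der_scal, der_coord.
    - replace (k w - (- f z * (Cexp (- w) * - (1)) + l * 1))%C with
        ((f (z + Cexp w) - f z - l * (z + Cexp w - z)) * / Cexp w)%C.
      2:{ unfold k. rewrite Cexp_inv. field. apply Cexp_neq_0. }
      assert (E : Cmod (Cexp w) < d).
      { rewrite Cmod_Cexp. unfold w. rewrite Hvert. unfold x1.
        rewrite <- (exp_ln d Hd) at 2. apply exp_increasing. lra. }
      assert (Ez : (z + Cexp w - z)%C = Cexp w) by ring.
      specialize (Hy (z + Cexp w)%C). rewrite Ez in Hy. specialize (Hy E).
      assert (0 < Cmod (Cexp w)) by (rewrite Cmod_Cexp; apply exp_pos).
      rewrite Ez, Cmod_mult, Cmod_inv by apply Cexp_neq_0.
      apply Rmult_le_reg_r with (Cmod (Cexp w)); [lra|].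
      rewrite Rmult_assoc, Rinv_l by lra. lra. }
  assert (B2 : Cmod (l * twopii)%C <= (M / r + eps) * (2 * PI)).
  { rewrite Hinc in B1. rewrite <- Cmod_opp.
    replace (- (l * twopii))%C with
      ((P (x0 + twopii) - P x0 - l * twopii) - (P (x0 + twopii) - P x0))%C by ring.
    eapply Rle_trans; [apply Cmod_minus_le|]. lra. }
  rewrite Cmod_mult, Htp in B2. apply Rmult_le_reg_r with (2 * PI); lra.
Qed.

(** The value [f z] is the derivative at [z] of [(w - z) f w]. *)
Lemma max_on_circle f z r M :
  holo f -> 0 < r -> (forall w, Cmod (w - z)%C = r -> Cmod (f w) <= M) -> Cmod (f z) <= M.
Proof.
  intros Hf Hr HM.
  assert (Hid : forall w, cder (fun w => w - z)%C w (1 - 0)%C).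
  { intro w. apply der_minus; [apply der_coord | apply der_const]. }
  destruct (Hf z) as [l Hl].
  replace M with (r * M / r) by (field; lra).
  apply (cauchy_estimate (fun w => (w - z) * f w)%C z); [| |exact Hr|].
  - intro w. destruct (Hf w) as [m Hm]. eexists. apply (der_mult _ (fun w => w - z)%C f); [apply Hid | exact Hm].
  - apply der_eq with ((1 - 0) * f z + (z - z) * l)%C; [ring|].
    apply (der_mult _ (fun w => w - z)%C f); [apply Hid | exact Hl].
  - intros w Hw. rewrite Cmod_mult, Hw. apply Rmult_le_compat_l; [lra | auto].
Qed.

(** ** Compactness of squares *)

(** [Q K w] stands for any bound at [w] with a constant [K]; it is used for the
    values of a function and for the size of forward orbits. *)
Lemma locally_bounded_bounded (Q : R -> C -> Prop) (R0 : R) :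
  (forall K K' w, K <= K' -> Q K w -> Q K' w) ->
  (forall z, exists d K, 0 < d /\ forall w, Cmod (w - z)%C < d -> Q K w) ->
  exists K, forall w, Cmod w <= R0 -> Q K w.
Proof.
  intros Hmon Hloc.
  assert (Hch : forall z, exists e : posreal, forall w, Cmod (w - z)%C < 2 * e -> Q (/ e) w).
  { intro z. destruct (Hloc z) as [d [K [Hd H]]].
    assert (He : 0 < Rmin (d / 2) (/ (Rabs K + 1))).
    { apply Rmin_pos; [lra|]. apply Rinv_0_lt_compat. pose proof (Rabs_pos K). lra. }
    exists (mkposreal _ He). simpl. intros w Hw. apply Hmon with K.
    - apply Rle_trans with (Rabs K + 1); [pose proof (Rle_abs K); lra|].
      rewrite <- (Rinv_inv (Rabs K + 1)) at 1. apply Rinv_le_contravar; [exact He | apply Rmin_r].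
    - apply H. pose proof (Rmin_l (d / 2) (/ (Rabs K + 1))). lra. }
  set (e := fun z => proj1_sig (constructive_indefinite_description _ (Hch z))).
  destruct (compactness_value 2 (- R0, (- R0, tt)) (R0, (R0, tt))
    (fun t => e (fst t, fst (snd t)))) as [d Hd].
  exists (/ d). intros w Hw. apply NNPP. intro Hn.
  pose proof (re_le_Cmod w) as H1. pose proof (im_le_Cmod w) as H2.
  apply Rabs_le_between in H1. apply Rabs_le_between in H2.
  apply (Hd (Re w, (Im w, tt))).
  { simpl. repeat split; lra. }
  intros [[t1 [t2 []]] [_ [Hc Hdt]]]. simpl in Hc, Hdt. destruct Hc as [C1 [C2 _]].
  apply Hn. apply Hmon with (/ e (t1, t2)).
  - apply Rinv_le_contravar; [apply cond_pos | exact Hdt].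
  - unfold e in *. destruct constructive_indefinite_description as [e0 He0]. simpl in *.
    apply He0. eapply Rle_lt_trans; [apply Cmod_le_re_im|]. destruct w as [w1 w2]. simpl in *.
    unfold Rminus in C1, C2. lra.
Qed.

Lemma holo_bounded f R0 : holo f -> exists M, 0 <= M /\ forall z, Cmod z <= R0 -> Cmod (f z) <= M.
Proof.
  intro Hf. destruct (locally_bounded_bounded (fun K w => Cmod (f w) <= K) R0) as [K HK].
  - intros; lra.
  - intro z. destruct (Hf z) as [l Hl]. destruct (der_cont _ _ _ _ Hl 1 Rlt_0_1) as [d [Hd Hw]].
    exists d, (Cmod (f z) + 1). split; [exact Hd|]. intros w Hwd.
    specialize (Hw w Hwd). pose proof (Cmod_le_add (f w) (f z)). lra.
  - exists (Rmax 0 K). split; [apply Rmax_l|]. intros z Hz. eapply Rle_trans; [apply HK, Hz | apply Rmax_r].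
Qed.

(** ** Derivatives of entire functions *)

Lemma holo_derivative f : holo f -> exists f', forall z, cder f z (f' z).
Proof.
  intro Hf. exists (fun z => proj1_sig (constructive_indefinite_description _ (Hf z))).
  intro z. apply proj2_sig.
Qed.

Lemma Cmod_circle w z r R0 : Cmod (w - z)%C = r -> Cmod z <= R0 -> Cmod w <= R0 + r.
Proof. intros. pose proof (Cmod_le_add w z). lra. Qed.

Lemma seg_Cmod p q s R0 : Cmod p <= R0 -> Cmod q <= R0 -> 0 <= s <= 1 -> Cmod (seg p q s) <= R0.
Proof.
  intros Hp Hq Hs. replace (seg p q s) with (seg p q s - 0)%C by ring.
  apply seg_disc; auto; [replace (p - 0)%C with p by ring | replace (q - 0)%C with q by ring]; auto.
Qed.

Lemma holo_lipschitz f R0 : holo f -> exists L, 0 <= L /\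
  forall z w, Cmod z <= R0 -> Cmod w <= R0 -> Cmod (f w - f z)%C <= L * Cmod (w - z)%C.
Proof.
  intro Hf. destruct (holo_bounded f (R0 + 1) Hf) as [M [HM H]].
  exists M. split; [exact HM|]. intros z w Hz Hw. apply cder_mean_value. intros s Hs.
  destruct (Hf (seg z w s)) as [l Hl]. exists l. split; [exact Hl|].
  replace M with (M / 1) by field. apply (cauchy_estimate f (seg z w s)); auto; [lra|].
  intros u Hu. apply H. apply (Cmod_circle _ _ _ _ Hu). apply seg_Cmod; auto.
Qed.

Section Derivative.
Variables (f f' : C -> C).
Hypothesis Hf : forall z, cder f z (f' z).

Lemma holo_of_derivative : holo f.
Proof. intro z. exists (f' z). apply Hf. Qed.

(** Cauchy's estimate for the increment [f (u + h) - f u]. *)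
Lemma derivative_lipschitz R0 : exists L, 0 <= L /\
  forall z w, Cmod z <= R0 -> Cmod w <= R0 -> Cmod (f' w - f' z)%C <= L * Cmod (w - z)%C.
Proof.
  destruct (holo_lipschitz f (R0 + 1) holo_of_derivative) as [L [HL H]].
  exists L. split; [exact HL|]. intros z w Hz Hw.
  replace (L * Cmod (w - z)%C) with (L * Cmod (w - z)%C / 1) by field.
  apply (cauchy_estimate (fun u => f (u + (w - z)) - f u)%C z); [| |lra|].
  - intro u. exists (f' (u + (w - z)) - f' u)%C. apply der_minus; [apply cder_shift, Hf | apply Hf].
  - apply der_minus; [|apply Hf]. apply cder_shift. replace (z + (w - z))%C with w by ring. apply Hf.
  - intros u Hu. replace (w - z)%C with (u + (w - z) - u)%C at 2 by ring.
    apply H; [apply (Cmod_circle _ _ _ _ Hu Hz)|].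
    apply (Cmod_circle _ w); [|exact Hw]. rewrite <- Hu. f_equal. ring.
Qed.

Lemma taylor1 R0 : exists L, 0 <= L /\ forall z w, Cmod z <= R0 -> Cmod w <= R0 ->
  Cmod (f w - f z - f' z * (w - z))%C <= L * (Cmod (w - z)%C * Cmod (w - z)%C).
Proof.
  destruct (derivative_lipschitz R0) as [L [HL H]].
  exists L. split; [exact HL|]. intros z w Hz Hw.
  replace (f w - f z - f' z * (w - z))%C with ((f w - f' z * w) - (f z - f' z * z))%C by ring.
  rewrite <- Rmult_assoc. apply (cder_mean_value (fun u => f u - f' z * u)%C). intros s Hs.
  exists (f' (seg z w s) - f' z * 1)%C. split.
  - apply der_minus; [apply Hf | apply der_scal, der_coord].
  - replace (f' z * 1)%C with (f' z) by ring.
    eapply Rle_trans; [apply H; [exact Hz | apply seg_Cmod; auto]|].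
    apply Rmult_le_compat_l; [exact HL|].
    apply seg_disc; [rewrite Cmod_sub_self; apply Cmod_ge_0 | lra | exact Hs].
Qed.

(** The difference quotients of [f'] are Cauchy: the difference of two of them
    is the derivative of the difference of two difference quotients of [f],
    which is small on a whole circle. *)
Theorem derivative_holo : holo f'.
Proof.
  intro z. destruct (taylor1 (Cmod z + 2)) as [L [HL HT]].
  set (q := fun h => ((f' (z + h) - f' z) / h)%C).
  assert (Hq : forall h k : C, h <> 0 -> k <> 0 -> Cmod h <= 1 -> Cmod k <= 1 ->
    Cmod (q h - q k)%C <= L * (Cmod h + Cmod k)).
  { intros h k Hh0 Hk0 Hh Hk.
    set (D := fun h u => (/ h * (f (u + h) - f u))%C).
    assert (HD : forall h u, cder (D h) u (/ h * (f' (u + h) - f' u))%C).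
    { intros h' u. apply (der_scal _ (/ h')%C (fun u => f (u + h') - f u)%C).
      apply der_minus; [apply cder_shift, Hf | apply Hf]. }
    replace (L * (Cmod h + Cmod k)) with (L * (Cmod h + Cmod k) / 1) by field.
    apply (cauchy_estimate (fun u => D h u - D k u)%C z); [| |lra|].
    - intro u. eexists. apply der_minus; apply HD.
    - apply der_eq with (/ h * (f' (z + h) - f' z) - / k * (f' (z + k) - f' z))%C.
      + unfold q. field. split; assumption.
      + apply der_minus; apply HD.
    - intros u Hu.
      assert (est : forall h : C, h <> 0 -> Cmod h <= 1 -> Cmod (D h u - f' u)%C <= L * Cmod h).
      { intros h' H0 H1. assert (Hm := proj1 (Cmod_gt_0 h') H0).
        replace (D h' u - f' u)%C with (/ h' * (f (u + h') - f u - f' u * (u + h' - u)))%C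
          by (unfold D; field; auto).
        rewrite Cmod_mult, Cmod_inv by exact H0.
        assert (Hu' : Cmod u <= Cmod z + 1) by (apply (Cmod_circle _ _ _ _ Hu); lra).
        specialize (HT u (u + h')%C). replace (u + h' - u)%C with h' in * by ring.
        apply Rmult_le_reg_l with (Cmod h'); [exact Hm|].
        rewrite <- Rmult_assoc, Rinv_r, Rmult_1_l by lra.
        eapply Rle_trans; [apply HT; [lra|]|lra].
        eapply Rle_trans; [apply Cmod_triangle|]. lra. }
      replace (D h u - D k u)%C with ((D h u - f' u) - (D k u - f' u))%C by ring.
      eapply Rle_trans; [apply Cmod_minus_le|].
      pose proof (est h Hh0 Hh). pose proof (est k Hk0 Hk). lra. }
  assert (Hpow : forall n, 0 < (/ 2) ^ n <= 1).
  { intro n. split; [apply pow_lt; lra|]. induction n; simpl; [lra|].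
    assert (0 < (/ 2) ^ n) by (apply pow_lt; lra). lra. }
  assert (Hh0 : forall n, RtoC ((/ 2) ^ n) <> 0).
  { intros n E. apply RtoC_inj in E. specialize (Hpow n). lra. }
  assert (Hhm : forall n, Cmod (RtoC ((/ 2) ^ n)) = (/ 2) ^ n).
  { intro n. rewrite Cmod_R, Rabs_pos_eq; [reflexivity|]. left. apply Hpow. }
  destruct (C_geom_lim (fun n => q (RtoC ((/ 2) ^ n))) (2 * L)) as [l Hl].
  { intro n. pose proof (Hpow n). pose proof (Hpow (S n)).
    eapply Rle_trans; [apply Hq; auto; rewrite Hhm; lra|]. rewrite !Hhm. simpl. nra. }
  exists l.
  assert (Hest : forall h : C, h <> 0 -> Cmod h <= 1 -> Cmod (q h - l)%C <= L * Cmod h).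
  { intros h H0 H1. apply le_epsilon. intros e He.
    destruct (half_pow_small (9 * L) e He) as [n Hn]. specialize (Hl n).
    assert (A := Hq h (RtoC ((/ 2) ^ n)) H0 (Hh0 n) H1). rewrite Hhm in A.
    specialize (A (proj2 (Hpow n))).
    pose proof (Cmod_sub_triangle (q h) (q (RtoC ((/ 2) ^ n))) l). lra. }
  apply der_weak with L. intros eps Heps Heps1. exists eps. split; [exact Heps|]. intros y Hy.
  destruct (classic (y = z)) as [->|Hne].
  { replace (f' z - f' z - l * (z - z))%C with (RtoC 0) by ring. rewrite Cmod_sub_self, Cmod_0. lra. }
  assert (Hh : (y - z)%C <> 0) by (apply Cmod_gt_0, Cmod_sub_pos, Hne).
  specialize (Hest (y - z)%C Hh ltac:(lra)).
  replace (f' y - f' z - l * (y - z))%C with ((q (y - z) - l) * (y - z))%C.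
  2:{ unfold q. replace (z + (y - z))%C with y by ring. field. exact Hh. }
  rewrite Cmod_mult. pose proof (Cmod_ge_0 (y - z)%C). apply Rmult_le_compat_r; [lra|].
  eapply Rle_trans; [exact Hest|]. apply Rmult_le_compat_l; lra.
Qed.

End Derivative.

(** ** Zeros of entire functions *)

Lemma cder_unique f z l m : cder f z l -> cder f z m -> l = m.
Proof.
  intros Hl Hm. assert (H : (l - m)%C = 0).
  - apply Cmod_le_eps. intros e He.
    destruct (Hl (e / 2)) as [d1 [Hd1 H1]]; [lra|]. destruct (Hm (e / 2)) as [d2 [Hd2 H2]]; [lra|].
    set (h := Rmin d1 d2 / 2).
    assert (Hmin : 0 < Rmin d1 d2) by (apply Rmin_pos; lra).
    assert (Hh : Cmod (z + RtoC h - z)%C = h).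
    { replace (z + RtoC h - z)%C with (RtoC h) by ring. rewrite Cmod_R, Rabs_pos_eq; unfold h; lra. }
    pose proof (Rmin_l d1 d2). pose proof (Rmin_r d1 d2).
    specialize (H1 (z + RtoC h)%C). specialize (H2 (z + RtoC h)%C). rewrite Hh in H1, H2.
    specialize (H1 ltac:(unfold h; lra)). specialize (H2 ltac:(unfold h; lra)).
    apply Rmult_le_reg_r with h; [unfold h; lra|]. rewrite <- Hh at 1. rewrite <- Cmod_mult.
    replace ((l - m) * (z + h - z))%C with
      ((f (z + h) - f z - m * (z + h - z)) - (f (z + h) - f z - l * (z + h - z)))%C by ring.
    eapply Rle_trans; [apply Cmod_minus_le|]. lra.
  - replace l with (l - m + m)%C by ring. rewrite H. ring.
Qed.

Lemma sub_neq_0 (z b : C) : z <> b -> (z - b)%C <> 0.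
Proof. intro H. apply Cmod_gt_0, Cmod_sub_pos, H. Qed.

(** The quotient [f z / (z - b)] has a derivative at [b] because [f] has a second
    derivative there, hence a Taylor expansion of order two. *)
Lemma holo_factor f b : holo f -> f b = 0 ->
  exists g, holo g /\ (forall z, f z = ((z - b) * g z)%C) /\ cder f b (g b).
Proof.
  intros Hf Hb. destruct (holo_derivative f Hf) as [f' Hf'].
  destruct (derivative_holo f f' Hf' b) as [c Hc].
  set (g := fun z => if excluded_middle_informative (z = b) then f' b else (f z / (z - b))%C).
  assert (gb : g b = f' b) by (unfold g; destruct excluded_middle_informative; congruence).
  assert (gz : forall z, z <> b -> g z = (f z * / (z - b))%C).
  { intros z Hz. unfold g. destruct excluded_middle_informative; [contradiction | reflexivity]. }
  assert (Hid : forall w, cder (fun w => w - b)%C w (1 - 0)%C).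
  { intro w. apply der_minus; [apply der_coord | apply der_const]. }
  assert (Hfg : forall z, f z = ((z - b) * g z)%C).
  { intro z. destruct (classic (z = b)) as [->|Hz].
    - rewrite Hb. ring.
    - rewrite gz by exact Hz. field. apply sub_neq_0, Hz. }
  exists g. split; [|split; [exact Hfg | rewrite gb; apply Hf']].
  intro z. destruct (classic (z = b)) as [->|Hz].
  - exists (c / 2)%C. apply der_weak with 1. intros eps Heps _.
    destruct (Hc eps Heps) as [d [Hd Hy]]. exists d. split; [exact Hd|]. intros w Hw.
    destruct (classic (w = b)) as [->|Hwb].
    { replace (g b - g b - c / 2 * (b - b))%C with (RtoC 0) by (field; auto). rewrite Cmod_sub_self, Cmod_0. lra. }
    assert (Hm := Cmod_sub_pos w b Hwb). rewrite gb.
    set (h := fun u => (f u - f' b * u - c / 2 * ((u - b) * (u - b)))%C).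
    assert (A : Cmod (h w - h b)%C <= eps * Cmod (w - b)%C * Cmod (w - b)%C).
    { apply cder_mean_value. intros s Hs. set (u := seg b w s).
      assert (Hu : Cmod (u - b)%C <= Cmod (w - b)%C).
      { apply seg_disc; [rewrite Cmod_sub_self; lra | lra | exact Hs]. }
      exists (f' u - f' b * 1 - c / 2 * ((1 - 0) * (u - b) + (u - b) * (1 - 0)))%C. split.
      - apply (der_minus _ (fun u => f u - f' b * u)%C).
        + apply der_minus; [apply Hf' | apply der_scal, der_coord].
        + apply (der_scal _ (c / 2)%C (fun u => (u - b) * (u - b))%C).
          apply (der_mult _ (fun u => u - b)%C (fun u => u - b)%C); apply Hid.
      - replace (f' u - f' b * 1 - c / 2 * ((1 - 0) * (u - b) + (u - b) * (1 - 0)))%C with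
          (f' u - f' b - c * (u - b))%C by (field; auto).
        eapply Rle_trans; [apply Hy; lra|]. apply Rmult_le_compat_l; lra. }
    rewrite gz by exact Hwb.
    replace (f w * / (w - b) - f' b - c / 2 * (w - b))%C with ((h w - h b) * / (w - b))%C.
    2:{ unfold h. rewrite Hb. field. apply sub_neq_0, Hwb. }
    rewrite Cmod_mult, Cmod_inv by (apply sub_neq_0, Hwb).
    apply Rmult_le_reg_r with (Cmod (w - b)%C); [exact Hm|].
    rewrite Rmult_assoc, Rinv_l by lra. lra.
  - destruct (Hf z) as [l Hl]. eexists.
    eapply (der_ext _ (fun w => f w * / (w - b))%C g z).
    + apply (Cmod_sub_pos z b), Hz.
    + intros y Hy. symmetry. apply gz. intros ->. rewrite Cmod_sub_sym in Hy. lra.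
    + reflexivity.
    + apply der_mult; [exact Hl|]. apply (der_inv _ (fun w => w - b)%C); [apply sub_neq_0, Hz | apply Hid].
Qed.

(** If [f] is divisible by every power [(z - b) ^ n], then the quotients are small
    on a large circle around [z], whose points are more than twice as far from [b]
    as [z] is; as [n] grows this forces [f z = 0]. *)
Theorem finite_order f b : holo f -> (exists z, f z <> 0) ->
  exists m g, holo g /\ g b <> 0 /\ forall z, f z = ((z - b) ^ m * g z)%C.
Proof.
  intros Hf [z Hz]. apply NNPP. intro Hno. apply Hz.
  assert (Hall : forall n, exists g, holo g /\ forall z, f z = ((z - b) ^ n * g z)%C).
  { induction n as [|n [g [Hg E]]].
    - exists f. split; [exact Hf|]. intro w. simpl. ring.
    - destruct (classic (g b = 0)) as [G0|G0].
      + destruct (holo_factor g b Hg G0) as [k [Hk [E' _]]]. exists k. split; [exact Hk|].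
        intro w. rewrite E, E'. simpl. ring.
      + exfalso. apply Hno. exists n, g. auto. }
  set (a := Cmod (z - b)%C). assert (Ha : 0 <= a) by apply Cmod_ge_0.
  destruct (holo_bounded f (Cmod z + (3 * a + 1)) Hf) as [M [HM HB]].
  set (rho := 2 * a + 1).
  assert (Hest : forall n, Cmod (f z) <= M * (/ 2) ^ n).
  { intro n. destruct (Hall n) as [g [Hg E]].
    assert (Hrho : 0 < rho ^ n) by (apply pow_lt; unfold rho; lra).
    assert (G : Cmod (g z) <= M / rho ^ n).
    { apply (max_on_circle g z (3 * a + 1)); [exact Hg | lra |]. intros w Hw.
      assert (Hwb : rho <= Cmod (w - b)%C).
      { pose proof (Cmod_sub_triangle w b z). rewrite (Cmod_sub_sym b z) in H. fold a in H. unfold rho. lra. }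
      assert (Hfw : Cmod (f w) <= M).
      { apply HB. apply (Cmod_circle _ _ _ _ Hw). lra. }
      rewrite E, Cmod_mult, Cmod_pow in Hfw.
      assert (Hp : rho ^ n <= Cmod (w - b)%C ^ n) by (apply pow_incr; unfold rho in *; lra).
      apply Rmult_le_reg_r with (rho ^ n); [exact Hrho|].
      unfold Rdiv. rewrite Rmult_assoc, Rinv_l, Rmult_1_r by lra.
      pose proof (Cmod_ge_0 (g w)). nra. }
    rewrite E, Cmod_mult, Cmod_pow. fold a.
    assert (Hq : a ^ n <= (/ 2) ^ n * rho ^ n).
    { rewrite <- Rpow_mult_distr. apply pow_incr. unfold rho. lra. }
    apply Rle_trans with ((/ 2) ^ n * rho ^ n * (M / rho ^ n)).
    - apply Rmult_le_compat; auto using Cmod_ge_0. apply pow_le, Ha.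
    - right. field. lra. }
  apply Cmod_le_eps. intros e He. destruct (half_pow_small M e He) as [n Hn].
  specialize (Hest n). lra.
Qed.

(** * Ordinary differential equations in the plane *)

Lemma der_cont_Cmod (phi : R -> C) (t : R) v : rder phi t v ->
  forall eps, 0 < eps -> exists d, 0 < d /\ forall s, Rabs (s - t) < d -> Cmod (phi s - phi t)%C < eps.
Proof.
  intros H eps Heps. destruct (der_cont _ _ _ _ H eps Heps) as [d [Hd Hs]].
  exists d. split; [exact Hd|]. intros s Hsd. apply Hs. rewrite Cmod_RtoC_sub. exact Hsd.
Qed.

Lemma rder_sqr_Cmod (phi : R -> C) t v : rder phi t v ->
  is_derive (fun s => Cmod (phi s) ^ 2) t (2 * Re (Cconj (phi t) * v)%C).
Proof.
  intro H. apply is_derive_ext with (fun s => Re (phi s) * Re (phi s) + Im (phi s) * Im (phi s)).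
  - intro s. rewrite Cmod2_alt. simpl. ring.
  - replace (2 * Re (Cconj (phi t) * v)%C) with
      ((Re v * Re (phi t) + Re (phi t) * Re v) + (Im v * Im (phi t) + Im (phi t) * Im v))
      by (destruct (phi t), v; simpl; ring).
    assert (H1 := rder_Re _ _ _ H). assert (H2 := rder_Im _ _ _ H).
    apply (is_derive_plus (fun s => Re (phi s) * Re (phi s)) (fun s => Im (phi s) * Im (phi s))).
    + apply (is_derive_mult (fun s => Re (phi s)) (fun s => Re (phi s)) t _ _ H1 H1), Rmult_comm.
    + apply (is_derive_mult (fun s => Im (phi s)) (fun s => Im (phi s)) t _ _ H2 H2), Rmult_comm.
Qed.

Lemma curve_bounded (phi : R -> C) a b : a <= b ->
  (forall t, a <= t <= b -> exists v, rder phi t v) ->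
  exists K, 0 <= K /\ forall t, a <= t <= b -> Cmod (phi t) <= K.
Proof.
  intros Hab H.
  destruct (continuity_ab_maj (fun s => Cmod (phi s) ^ 2) a b Hab) as [m [Hm _]].
  - intros t Ht. destruct (H t Ht) as [v Hv].
    apply continuity_pt_filterlim, (ex_derive_continuous (fun s => Cmod (phi s) ^ 2)).
    eexists. apply rder_sqr_Cmod, Hv.
  - exists (Cmod (phi m)). split; [apply Cmod_ge_0|]. intros t Ht. specialize (Hm t Ht).
    simpl in Hm. pose proof (Cmod_ge_0 (phi m)). pose proof (Cmod_ge_0 (phi t)). nra.
Qed.

(** ** Gronwall's inequality *)

(** The function [|phi - psi|^2 exp (- 2 L t)] does not increase. *)
Lemma gronwall_forward (G : C -> C) L phi psi a b : a <= b ->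
  (forall t, a <= t <= b -> rder phi t (G (phi t)) /\ rder psi t (G (psi t)) /\
    Cmod (G (phi t) - G (psi t))%C <= L * Cmod (phi t - psi t)%C) ->
  Cmod (phi b - psi b)%C <= Cmod (phi a - psi a)%C * exp (L * (b - a)).
Proof.
  intros Hab H.
  set (D := fun t => Cmod (phi t - psi t)%C).
  assert (HD : forall t, 0 <= D t) by (intro; apply Cmod_ge_0).
  set (h := fun t => - (D t ^ 2 * exp (- 2 * L * t))).
  assert (Hh : h a <= h b).
  { apply derive_nondec; [exact Hab|]. intros t Ht. destruct (H t Ht) as (H1 & H2 & H3).
    set (w := (phi t - psi t)%C) in *. set (v := (G (phi t) - G (psi t))%C) in *.
    assert (A := rder_sqr_Cmod (fun s => phi s - psi s)%C t v (der_minus _ _ _ _ _ _ H1 H2)).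
    exists (- (2 * Re (Cconj w * v)%C * exp (- 2 * L * t) + D t ^ 2 * (- 2 * L * exp (- 2 * L * t)))).
    split.
    - apply (is_derive_opp (fun t => D t ^ 2 * exp (- 2 * L * t))).
      apply (is_derive_mult (fun t => D t ^ 2) (fun t => exp (- 2 * L * t)) t _ _ A); [|apply Rmult_comm].
      auto_derive; [exact I | ring].
    - assert (B := Rle_trans _ _ _ (Rle_abs _) (re_le_Cmod (Cconj w * v)%C)).
      rewrite Cmod_mult, Cmod_conj in B. change (D t) with (Cmod w).
      assert (0 < exp (-2 * L * t)) by apply exp_pos. pose proof (Cmod_ge_0 w).
      assert (Re (Cconj w * v)%C <= L * (Cmod w * Cmod w)) by nra. nra. }
  unfold h in Hh. change (D b <= D a * exp (L * (b - a))).
  assert (E : D b ^ 2 <= (D a * exp (L * (b - a))) ^ 2).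
  { assert (0 < exp (2 * L * b)) by apply exp_pos.
    assert (X1 : exp (- 2 * L * b) * exp (2 * L * b) = 1).
    { rewrite <- exp_plus, <- exp_0. f_equal. ring. }
    assert (X2 : exp (- 2 * L * a) * exp (2 * L * b) = exp (L * (b - a)) ^ 2).
    { simpl. rewrite Rmult_1_r, <- !exp_plus. f_equal. ring. }
    rewrite Rpow_mult_distr, <- X2.
    replace (D b ^ 2) with (D b ^ 2 * (exp (- 2 * L * b) * exp (2 * L * b))) by (rewrite X1; ring). nra. }
  assert (0 < exp (L * (b - a))) by apply exp_pos.
  pose proof (HD a). pose proof (HD b).
  assert (0 <= D a * exp (L * (b - a))) by nra. nra.
Qed.

Lemma rder_opp_time (phi : R -> C) t v : rder phi (- t) v -> rder (fun s => phi (- s)) t (- v)%C.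
Proof.
  intro H. apply der_ext with (fun s => phi (0 + (-1) * s)%R) (RtoC (-1) * v)%C 1; [lra| |ring|].
  - intros y _. f_equal. ring.
  - apply rder_reparam. replace (0 + -1 * t) with (- t) by ring. exact H.
Qed.

Lemma gronwall (G : C -> C) L phi psi s t :
  (forall u, Rmin s t <= u <= Rmax s t -> rder phi u (G (phi u)) /\ rder psi u (G (psi u)) /\
    Cmod (G (phi u) - G (psi u))%C <= L * Cmod (phi u - psi u)%C) ->
  Cmod (phi t - psi t)%C <= Cmod (phi s - psi s)%C * exp (L * Rabs (t - s)).
Proof.
  intro H. destruct (Rle_dec s t) as [Hst|Hst].
  - rewrite Rmin_left, Rmax_right in H by lra. rewrite Rabs_pos_eq by lra.
    apply (gronwall_forward G); assumption.
  - rewrite Rmin_right, Rmax_left in H by lra. rewrite Rabs_minus_sym, Rabs_pos_eq by lra.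
    assert (A := gronwall_forward (fun z => - G z)%C L (fun u => phi (- u)) (fun u => psi (- u)) (- s) (- t)).
    cbv beta in A. rewrite !Ropp_involutive in A. replace (- t - - s) with (s - t) in A by ring.
    apply A; [lra|]. intros u Hu. destruct (H (- u)) as (H1 & H2 & H3); [lra|].
    split; [apply rder_opp_time, H1|]. split; [apply rder_opp_time, H2|].
    replace (- G (phi (- u)%R) - - G (psi (- u)%R))%C with (- (G (phi (- u)%R) - G (psi (- u)%R)))%C by ring.
    rewrite Cmod_opp. exact H3.
Qed.

(** ** Global solutions for bounded Lipschitz fields *)

(** The estimate which makes the weight [exp (c |t|)] useful: integration divides
    the bound by [c]. *)
Lemma growth_bound (phi : R -> C) K c : 0 < c ->
  (forall s, exists v, rder phi s v /\ Cmod v <= K * exp (c * Rabs s)) ->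
  forall t, Cmod (phi t - phi 0%R)%C <= K / c * exp (c * Rabs t).
Proof.
  intros Hc.
  assert (Hpos : forall phi : R -> C, (forall s, exists v, rder phi s v /\ Cmod v <= K * exp (c * Rabs s)) ->
    forall t, 0 <= t -> Cmod (phi t - phi 0%R)%C <= K / c * exp (c * t)).
  { intros f Hf t Ht.
    assert (HK : 0 <= K).
    { destruct (Hf 0) as [v [_ Hv]]. rewrite Rabs_R0, Rmult_0_r, exp_0, Rmult_1_r in Hv.
      eapply Rle_trans; [apply Cmod_ge_0 | exact Hv]. }
    eapply Rle_trans; [apply (mean_value_compare f (fun s => K / c * exp (c * s)) 0 t Ht)|].
    - intros s Hs. destruct (Hf s) as [v [Hv Hm]]. exists v, (K * exp (c * s)). split; [exact Hv|].
      rewrite Rabs_pos_eq in Hm by lra. split; [|exact Hm].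
      auto_derive; [exact I | field; lra].
    - cbv beta. rewrite Rmult_0_r, exp_0.
      assert (0 <= K / c) by (apply Rmult_le_pos; [exact HK | left; apply Rinv_0_lt_compat, Hc]). lra. }
  intros H t. destruct (Rle_dec 0 t) as [Ht|Ht].
  - rewrite (Rabs_pos_eq t) by exact Ht. apply Hpos; assumption.
  - rewrite (Rabs_left t) by lra.
    assert (A := Hpos (fun s => phi (- s))). cbv beta in A.
    specialize (A ltac:(intro s; destruct (H (- s)) as [v [Hv Hm]]; exists (- v)%C; split;
      [apply rder_opp_time, Hv | rewrite Cmod_opp; rewrite Rabs_Ropp in Hm; exact Hm]) (- t) ltac:(lra)).
    rewrite Ropp_involutive, Ropp_0 in A. exact A.
Qed.

Section Picard.
Variables (G : C -> C) (L M : R) (x : C).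
Hypothesis HL : 0 < L.
Hypothesis HLip : forall z w, Cmod (G w - G z)%C <= L * Cmod (w - z)%C.
Hypothesis HM : forall z, Cmod (G z) <= M.

Lemma lip_curve_cont (X : R -> C) (K : R) :
  (forall s t, Cmod (X s - X t)%C <= K * Rabs (s - t)) -> forall t, cont_at RtoC (fun s => G (X s)) t.
Proof.
  intros HX t eps Heps.
  assert (HK : 0 < L * (Rabs K + 1)) by (pose proof (Rabs_pos K); nra).
  exists (eps / (L * (Rabs K + 1))). split; [apply Rdiv_lt_0_compat; lra|].
  intros s Hs. rewrite Cmod_RtoC_sub in Hs.
  eapply Rle_lt_trans; [apply HLip|].
  apply Rle_lt_trans with (L * (Rabs K + 1) * Rabs (s - t)).
  - rewrite Rmult_assoc. apply Rmult_le_compat_l; [lra|].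
    eapply Rle_trans; [apply HX|]. apply Rmult_le_compat_r; [apply Rabs_pos|].
    pose proof (Rle_abs K). lra.
  - apply (Rmult_lt_compat_l (L * (Rabs K + 1))) in Hs; [|exact HK].
    replace (L * (Rabs K + 1) * (eps / (L * (Rabs K + 1)))) with eps in Hs; [exact Hs|].
    field. pose proof (Rabs_pos K). split; lra.
Qed.

Lemma bounded_der_lip (X : R -> C) (K : R) : (forall t, exists v, rder X t v /\ Cmod v <= K) ->
  forall s t, Cmod (X s - X t)%C <= K * Rabs (s - t).
Proof.
  intros H s t. destruct (Rle_dec t s).
  - rewrite Rabs_pos_eq by lra. apply mean_value; auto.
  - rewrite Cmod_sub_sym, Rabs_minus_sym, Rabs_pos_eq by lra. apply mean_value; [lra | auto].
Qed.

Fixpoint picard (n : nat) : R -> C :=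
  match n with
  | O => fun _ => x
  | S m => fun t => (x + curve_int (fun s => G (picard m s)) t)%C
  end.

Lemma picard_der n : forall t, rder (picard (S n)) t (G (picard n t)).
Proof.
  assert (Hstep : forall X, (forall s t, Cmod (X s - X t)%C <= M * Rabs (s - t)) ->
    forall t, rder (fun t => x + curve_int (fun s => G (X s)) t)%C t (G (X t))).
  { intros X HX t. apply der_eq with (0 + G (X t))%C; [ring|]. apply der_plus; [apply der_const|].
    apply curve_int_der, (lip_curve_cont X M HX). }
  induction n as [|n IH].
  - apply (Hstep (fun _ => x)). intros s t. rewrite Cmod_sub_self.
    apply Rmult_le_pos; [|apply Rabs_pos]. eapply Rle_trans; [apply Cmod_ge_0 | apply (HM x)].
  - apply (Hstep (picard (S n))). apply bounded_der_lip. intro t. eexists. split; [apply IH | apply HM].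
Qed.

Lemma picard_0 n : picard n 0 = x.
Proof. destruct n; simpl; [reflexivity|]. rewrite curve_int_0. ring. Qed.

(** The weight [exp (2 L |t|)] makes the Picard iteration contract by [1/2] on
    the whole line at once. *)
Lemma picard_contract n : forall t,
  Cmod (picard (S n) t - picard n t)%C <= M / L * exp (2 * L * Rabs t) * (/ 2) ^ n.
Proof.
  assert (HM0 : 0 <= M) by (eapply Rle_trans; [apply Cmod_ge_0 | apply (HM x)]).
  assert (HML : 0 <= M / L) by (apply Rmult_le_pos; [exact HM0 | left; apply Rinv_0_lt_compat, HL]).
  assert (Hexp : forall s, 1 <= exp (2 * L * Rabs s)).
  { intro s. rewrite <- exp_0. pose proof (Rabs_pos s).
    assert (0 <= 2 * L * Rabs s) by nra.
    destruct (Req_dec (2 * L * Rabs s) 0) as [->|]; [lra|]. left. apply exp_increasing. lra. }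
  induction n as [|n IH]; intro t.
  - assert (A := growth_bound (picard 1) M (2 * L) ltac:(lra)).
    specialize (A ltac:(intro s; eexists; split; [apply (picard_der 0)|];
      eapply Rle_trans; [apply HM|]; specialize (Hexp s); nra) t).
    rewrite picard_0 in A. change (picard 0 t) with x. simpl pow. eapply Rle_trans; [exact A|].
    replace (M / (2 * L)) with (M / L / 2) by (field; lra).
    pose proof (exp_pos (2 * L * Rabs t)). nra.
  - assert (A := growth_bound (fun s => picard (S (S n)) s - picard (S n) s)%C (M * (/ 2) ^ n) (2 * L) ltac:(lra)).
    cbv beta in A. rewrite !picard_0 in A.
    replace (picard (S (S n)) t - picard (S n) t)%C with (picard (S (S n)) t - picard (S n) t - (x - x))%C by ring.
    eapply Rle_trans; [apply A|].
    + intro s. eexists. split; [apply der_minus; apply picard_der|].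
      eapply Rle_trans; [apply HLip|]. eapply Rle_trans; [apply Rmult_le_compat_l; [lra | apply IH]|].
      right. field. lra.
    + right. simpl. field. lra.
Qed.

Lemma picard_limit : exists phi : R -> C, phi 0 = x /\ forall t, rder phi t (G (phi t)).
Proof.
  assert (HM0 : 0 <= M) by (eapply Rle_trans; [apply Cmod_ge_0 | apply (HM x)]).
  set (K := fun t => M / L * exp (2 * L * Rabs t)).
  assert (Hlim : forall t, exists l, forall n, Cmod (picard n t - l)%C <= 4 * K t * (/ 2) ^ n).
  { intro t. apply C_geom_lim. intro n. apply picard_contract. }
  set (X := fun t => proj1_sig (constructive_indefinite_description _ (Hlim t))).
  assert (HX : forall t n, Cmod (picard n t - X t)%C <= 4 * K t * (/ 2) ^ n).
  { intro t. apply (proj2_sig (constructive_indefinite_description _ (Hlim t))). }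
  assert (HXlip : forall s t, Cmod (X s - X t)%C <= M * Rabs (s - t)).
  { intros s t. apply le_epsilon. intros e He.
    destruct (half_pow_small (2 * K s + 2 * K t) e He) as [n Hn].
    pose proof (HX s (S n)) as H1. pose proof (HX t (S n)) as H2. simpl pow in H1, H2.
    pose proof (bounded_der_lip (picard (S n)) M) as H3.
    specialize (H3 ltac:(intro u; eexists; split; [apply picard_der | apply HM]) s t).
    pose proof (Cmod_sub_triangle (X s) (picard (S n) s) (X t)) as H4.
    pose proof (Cmod_sub_triangle (picard (S n) s) (picard (S n) t) (X t)) as H5.
    rewrite Cmod_sub_sym in H1. nra. }
  set (Y := fun t => (x + curve_int (fun s => G (X s)) t)%C).
  assert (HY : forall t, rder Y t (G (X t))).
  { intro t. apply der_eq with (0 + G (X t))%C; [ring|]. apply der_plus; [apply der_const|].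
    apply curve_int_der, (lip_curve_cont X M HXlip). }
  assert (HY0 : Y 0 = x) by (unfold Y; rewrite curve_int_0; ring).
  assert (HXY : forall t, X t = Y t).
  { intro t. apply Cmod_zero_eq, le_epsilon. intros e He. rewrite Rplus_0_l.
    destruct (half_pow_small (4 * K t) e He) as [n Hn].
    assert (A := growth_bound (fun s => picard (S n) s - Y s)%C (4 * M * (/ 2) ^ n) (2 * L) ltac:(lra)).
    cbv beta in A. rewrite picard_0, HY0 in A.
    specialize (A ltac:(intro s; eexists; split; [apply der_minus; [apply picard_der | apply HY]|];
      eapply Rle_trans; [apply HLip|];
      eapply Rle_trans; [apply Rmult_le_compat_l; [lra | apply HX]|];
      right; unfold K; field; lra) t).
    replace (picard (S n) t - Y t - (x - x))%C with (picard (S n) t - Y t)%C in A by ring.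
    replace (4 * M * (/ 2) ^ n / (2 * L) * exp (2 * L * Rabs t)) with (2 * K t * (/ 2) ^ n) in A
      by (unfold K; field; lra).
    pose proof (HX t (S n)) as B. simpl pow in B. rewrite Cmod_sub_sym in B.
    pose proof (Cmod_sub_triangle (X t) (picard (S n) t) (Y t)). lra. }
  exists Y. split; [exact HY0|]. intro t. rewrite <- HXY. apply HY.
Qed.

End Picard.

(** ** Truncation to a square *)

Definition clampC (K : R) (z : C) : C := (clamp (- K) K (Re z), clamp (- K) K (Im z)).

Lemma Cmod_le_components (z w : C) : Rabs (Re z) <= Rabs (Re w) -> Rabs (Im z) <= Rabs (Im w) ->
  Cmod z <= Cmod w.
Proof.
  intros H1 H2. assert (A := Cmod2_alt z). assert (B := Cmod2_alt w).
  pose proof (Cmod_ge_0 z). pose proof (Cmod_ge_0 w).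
  rewrite <- (pow2_abs (Re z)), <- (pow2_abs (Im z)) in A.
  rewrite <- (pow2_abs (Re w)), <- (pow2_abs (Im w)) in B.
  assert (Rabs (Re z) ^ 2 <= Rabs (Re w) ^ 2) by (apply pow_incr; split; [apply Rabs_pos | exact H1]).
  assert (Rabs (Im z) ^ 2 <= Rabs (Im w) ^ 2) by (apply pow_incr; split; [apply Rabs_pos | exact H2]).
  nra.
Qed.

Lemma clampC_lip K z w : Cmod (clampC K w - clampC K z)%C <= Cmod (w - z)%C.
Proof. destruct z, w. apply Cmod_le_components; apply clamp_lip. Qed.

Lemma clampC_bound K z : 0 <= K -> Cmod (clampC K z) <= 2 * K.
Proof.
  intro HK. eapply Rle_trans; [apply Cmod_le_re_im|]. unfold clampC. simpl.
  pose proof (clamp_in (- K) K (Re z) ltac:(lra)). pose proof (clamp_in (- K) K (Im z) ltac:(lra)).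
  assert (Rabs (clamp (- K) K (Re z)) <= K) by (apply Rabs_le; lra).
  assert (Rabs (clamp (- K) K (Im z)) <= K) by (apply Rabs_le; lra). lra.
Qed.

Lemma clampC_id K z : Cmod z <= K -> clampC K z = z.
Proof.
  intro H. pose proof (re_le_Cmod z). pose proof (im_le_Cmod z). destruct z as [a b].
  unfold clampC. simpl in *. rewrite !clamp_id; [reflexivity| |]; apply Rabs_le_between; lra.
Qed.

Section Flow.
Variable F : C -> C.
Hypothesis HF : holo F.

(** Composing [F] with the projection onto a square makes it bounded and Lipschitz
    without changing it near the origin. *)
Lemma truncation K : 0 <= K -> exists G L, 0 < L /\
  (forall z w, Cmod (G w - G z)%C <= L * Cmod (w - z)%C) /\
  (forall z, Cmod z <= K -> G z = F z) /\
  (forall x, exists phi : R -> C, phi 0 = x /\ forall t, rder phi t (G (phi t))).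
Proof.
  intro HK. destruct (holo_lipschitz F (2 * K) HF) as [L [HL HLip]].
  destruct (holo_bounded F (2 * K) HF) as [M [HM HB]].
  assert (HGl : forall z w, Cmod (F (clampC K w) - F (clampC K z))%C <= (L + 1) * Cmod (w - z)%C).
  { intros z w. eapply Rle_trans; [apply HLip; apply clampC_bound, HK|].
    pose proof (clampC_lip K z w). pose proof (Cmod_ge_0 (clampC K w - clampC K z)%C). nra. }
  exists (fun z => F (clampC K z)), (L + 1).
  split; [lra|]. split; [exact HGl|]. split.
  - intros z Hz. rewrite clampC_id; auto.
  - intro x. apply (picard_limit (fun z => F (clampC K z)) (L + 1) M); [lra | exact HGl|].
    intro z. apply HB, clampC_bound, HK.
Qed.

(** ** Reachability along the flow *)

Definition solves (phi : R -> C) (a b : R) : Prop := forall t, a <= t <= b -> rder phi t (F (phi t)).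

(** The flow as a relation, for positive and negative [t].  It obeys the group law
    and needs no maximal intervals of existence. *)
Definition reach (x : C) (t : R) (v : C) : Prop :=
  exists phi : R -> C, phi 0 = x /\ phi t = v /\ solves phi (Rmin 0 t) (Rmax 0 t).

Lemma solves_sub phi a b a' b' : a <= a' -> b' <= b -> solves phi a b -> solves phi a' b'.
Proof. intros Ha Hb H t Ht. apply H. lra. Qed.

Lemma Rmin_le_Rmax s t : Rmin s t <= Rmax s t.
Proof. unfold Rmin, Rmax. destruct Rle_dec; lra. Qed.

Lemma between_r s t : Rmin s t <= t <= Rmax s t.
Proof. split; [apply Rmin_r | apply Rmax_r]. Qed.

Lemma between_sub s t u : Rmin s t <= u <= Rmax s t -> Rmin s t <= Rmin s u /\ Rmax s u <= Rmax s t.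
Proof. unfold Rmin, Rmax. repeat destruct Rle_dec; lra. Qed.

Lemma solves_agree phi psi s t : solves phi (Rmin s t) (Rmax s t) -> solves psi (Rmin s t) (Rmax s t) ->
  phi s = psi s -> phi t = psi t.
Proof.
  intros H1 H2 E. assert (Hm : Rmin s t <= Rmax s t) by apply Rmin_le_Rmax.
  destruct (curve_bounded phi _ _ Hm) as [K1 [_ B1]]; [intros u Hu; eexists; apply H1, Hu|].
  destruct (curve_bounded psi _ _ Hm) as [K2 [_ B2]]; [intros u Hu; eexists; apply H2, Hu|].
  destruct (holo_lipschitz F (Rmax K1 K2) HF) as [L [HL HLip]].
  apply Cmod_zero_eq. eapply Rle_trans; [apply (gronwall F L phi psi s t)|].
  - intros u Hu. split; [apply H1, Hu|]. split; [apply H2, Hu|].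
    apply HLip; eapply Rle_trans; [apply B2, Hu | apply Rmax_r | apply B1, Hu | apply Rmax_l].
  - rewrite E, Cmod_sub_self. lra.
Qed.

Lemma reach_unique x t v w : reach x t v -> reach x t w -> v = w.
Proof.
  intros (phi & H0 & <- & H) (psi & H0' & <- & H'). apply (solves_agree phi psi 0 t H H').
  congruence.
Qed.

Lemma reach_0 x : reach x 0 x.
Proof.
  destruct (truncation (Cmod x) (Cmod_ge_0 x)) as (G & L & _ & _ & HG & Hex).
  destruct (Hex x) as [phi [H0 H]]. exists phi. split; [exact H0|]. split; [exact H0|].
  intros t Ht. rewrite Rmin_left, Rmax_left in Ht by lra. replace t with 0 by lra.
  rewrite <- (HG (phi 0)); [apply H|]. rewrite H0. lra.
Qed.

(** Solutions of truncated fields exist for all times; this lemma transfers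
    their estimates to solutions of [F]. *)
Lemma trunc_agree G L K phi psi s t :
  (forall z w, Cmod (G w - G z)%C <= L * Cmod (w - z)%C) ->
  (forall z, Cmod z <= K -> G z = F z) ->
  (forall u, rder phi u (G (phi u))) ->
  solves psi (Rmin s t) (Rmax s t) ->
  (forall u, Rmin s t <= u <= Rmax s t -> Cmod (psi u) <= K) -> phi s = psi s ->
  forall u, Rmin s t <= u <= Rmax s t -> phi u = psi u.
Proof.
  intros HL HG Hphi Hpsi HK E u Hu. destruct (between_sub s t u Hu) as [B1 B2].
  apply Cmod_zero_eq. eapply Rle_trans; [apply (gronwall G L phi psi s u)|].
  - intros r Hr. split; [apply Hphi|]. split; [|apply HL].
    rewrite HG by (apply HK; lra). apply Hpsi. lra.
  - rewrite E, Cmod_sub_self. lra.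
Qed.

(** One solution of a truncated field serves for both pieces, so that nothing
    has to be glued. *)
Lemma reach_trans x s v t w : reach x s v -> reach v t w -> reach x (s + t) w.
Proof.
  intros (phi & P0 & P1 & P) (psi & Q0 & Q1 & Q).
  assert (Hm : forall t, Rmin 0 t <= Rmax 0 t) by (intro; apply Rmin_le_Rmax).
  destruct (curve_bounded phi _ _ (Hm s)) as [K1 [K1p B1]]; [intros u Hu; eexists; apply P, Hu|].
  destruct (curve_bounded psi _ _ (Hm t)) as [K2 [_ B2]]; [intros u Hu; eexists; apply Q, Hu|].
  set (K := Rmax K1 K2). assert (HK : 0 <= K) by (eapply Rle_trans; [exact K1p | apply Rmax_l]).
  destruct (truncation K HK) as (G & L & _ & HL & HG & Hex). destruct (Hex x) as [chi [C0 C]].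
  assert (B1' : forall u, Rmin 0 s <= u <= Rmax 0 s -> Cmod (phi u) <= K).
  { intros u Hu. eapply Rle_trans; [apply B1, Hu | apply Rmax_l]. }
  assert (B2' : forall u, Rmin 0 t <= u <= Rmax 0 t -> Cmod (psi u) <= K).
  { intros u Hu. eapply Rle_trans; [apply B2, Hu | apply Rmax_r]. }
  assert (A1 := trunc_agree G L K chi phi 0 s HL HG C P B1' (eq_trans C0 (eq_sym P0))).
  assert (Cs : forall u, rder (fun u => chi (s + 1 * u)%R) u (G (chi (s + 1 * u)%R))).
  { intro u. apply der_eq with (1 * G (chi (s + 1 * u)%R))%C; [ring|].
    apply (rder_reparam chi s 1), C. }
  assert (A2 := trunc_agree G L K (fun u => chi (s + 1 * u)) psi 0 t HL HG Cs Q B2').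
  cbv beta in A2. specialize (A2 ltac:(rewrite Rmult_0_r, Rplus_0_r, Q0, <- P1; apply A1, between_r)).
  exists chi. split; [exact C0|]. split.
  - rewrite <- Q1, <- (A2 t (between_r 0 t)). f_equal. ring.
  - intros u Hu. rewrite <- (HG (chi u)); [apply C|].
    assert (D : Rmin 0 s <= u <= Rmax 0 s \/ Rmin 0 t <= u - s <= Rmax 0 t).
    { revert Hu. unfold Rmin, Rmax. repeat destruct Rle_dec; lra. }
    destruct D as [D|D].
    + rewrite A1 by exact D. apply B1', D.
    + replace u with (s + 1 * (u - s)) by ring. rewrite A2 by exact D. apply B2', D.
Qed.

Lemma reach_sym x t v : reach x t v -> reach v (- t) x.
Proof.
  intros (phi & P0 & P1 & P). exists (fun u => phi (t + 1 * u)). split; [|split].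
  - rewrite <- P1. f_equal. ring.
  - rewrite <- P0. f_equal. ring.
  - intros u Hu. apply der_eq with (1 * F (phi (t + 1 * u)%R))%C; [ring|].
    apply rder_reparam. apply P. revert Hu. unfold Rmin, Rmax. repeat destruct Rle_dec; lra.
Qed.

Lemma reach_part x t v s : reach x t v -> Rmin 0 t <= s <= Rmax 0 t ->
  exists w, reach x s w /\ reach w (t - s) v.
Proof.
  intros Hr Hs. destruct Hr as (phi & P0 & P1 & P).
  assert (H : reach x s (phi s)).
  { exists phi. split; [exact P0|]. split; [reflexivity|].
    destruct (between_sub 0 t s Hs). apply solves_sub with (Rmin 0 t) (Rmax 0 t); assumption. }
  exists (phi s). split; [exact H|]. replace (t - s) with (- s + t) by ring.
  apply reach_trans with x; [apply reach_sym, H|]. exists phi. auto.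
Qed.

(** Gronwall's inequality for a field truncated slightly outside the given piece
    of orbit: neighbouring solutions stay where the truncation has no effect. *)
Lemma reach_continuous x t v : reach x t v -> exists K, forall eps, 0 < eps ->
  exists del, 0 < del /\ forall y, Cmod (y - x)%C < del ->
    (exists w, reach y t w /\ Cmod (w - v)%C < eps) /\
    (forall s u, Rmin 0 t <= s <= Rmax 0 t -> reach y s u -> Cmod u <= K).
Proof.
  intros (phi & P0 & P1 & P).
  assert (Hm : Rmin 0 t <= Rmax 0 t) by apply Rmin_le_Rmax.
  destruct (curve_bounded phi _ _ Hm) as [K [HK B]]; [intros u Hu; eexists; apply P, Hu|].
  destruct (truncation (K + 1) ltac:(lra)) as (G & L & HL0 & HL & HG & Hex).
  destruct (Hex x) as [chi [C0 Cd]].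
  assert (A := trunc_agree G L (K + 1) chi phi 0 t HL HG Cd P).
  specialize (A ltac:(intros u Hu; specialize (B u Hu); lra) (eq_trans C0 (eq_sym P0))).
  exists (K + 1). intros eps Heps.
  assert (He : 0 < exp (L * Rabs t)) by apply exp_pos.
  assert (Hmin : 0 < Rmin eps 1) by (apply Rmin_pos; lra).
  exists (Rmin eps 1 / exp (L * Rabs t)). split; [apply Rdiv_lt_0_compat; lra|].
  intros y Hy. destruct (Hex y) as [psi [Q0 Qd]].
  assert (Hclose : forall s, Rmin 0 t <= s <= Rmax 0 t -> Cmod (psi s - chi s)%C < Rmin eps 1).
  { intros s Hs. eapply Rle_lt_trans; [apply (gronwall G L psi chi 0 s); intros u _; auto|].
    rewrite Q0, C0, Rminus_0_r.
    assert (Hst : exp (L * Rabs s) <= exp (L * Rabs t)).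
    { assert (Rabs s <= Rabs t).
      { revert Hs. unfold Rmin, Rmax, Rabs. repeat destruct Rle_dec; repeat destruct Rcase_abs; lra. }
      destruct (Req_dec (Rabs s) (Rabs t)) as [->|]; [lra|]. left. apply exp_increasing. nra. }
    apply Rle_lt_trans with (Cmod (y - x)%C * exp (L * Rabs t)).
    - apply Rmult_le_compat_l; [apply Cmod_ge_0 | exact Hst].
    - apply (Rmult_lt_compat_r (exp (L * Rabs t))) in Hy; [|exact He].
      replace (Rmin eps 1 / exp (L * Rabs t) * exp (L * Rabs t)) with (Rmin eps 1) in Hy by (field; lra).
      exact Hy. }
  assert (Hb : forall s, Rmin 0 t <= s <= Rmax 0 t -> Cmod (psi s) <= K + 1).
  { intros s Hs. specialize (Hclose s Hs). rewrite (A s Hs) in Hclose. specialize (B s Hs).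
    pose proof (Cmod_le_add (psi s) (phi s)). pose proof (Rmin_r eps 1). lra. }
  assert (Hr : forall s, Rmin 0 t <= s <= Rmax 0 t -> reach y s (psi s)).
  { intros s Hs. exists psi. split; [exact Q0|]. split; [reflexivity|].
    intros u Hu. destruct (between_sub 0 t s Hs). rewrite <- HG; [apply Qd | apply Hb; lra]. }
  split.
  - exists (psi t). split; [apply Hr, between_r|]. rewrite <- P1, <- (A t (between_r 0 t)).
    eapply Rlt_le_trans; [apply Hclose, between_r | apply Rmin_l].
  - intros s u Hs Hu. rewrite (reach_unique y s u (psi s) Hu (Hr s Hs)). apply Hb, Hs.
Qed.

End Flow.

(** ** A-priori bounds *)

(** The times up to which [u <= A] holds form an interval that is closed by
    continuity and open because the bound is then strict. *)
Lemma bootstrap (u : R -> R) (A : R) :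
  (forall t, 0 <= t -> forall e, 0 < e -> exists d, 0 < d /\ forall s, Rabs (s - t) < d -> Rabs (u s - u t) < e) ->
  u 0 <= A ->
  (forall t, 0 <= t -> (forall s, 0 <= s <= t -> u s <= A) -> u t < A) ->
  forall t, 0 <= t -> u t < A.
Proof.
  intros Hc H0 H t Ht. apply H; [exact Ht|]. apply NNPP. intro Hn.
  apply not_all_ex_not in Hn. destruct Hn as [s0 Hs0]. apply imply_to_and in Hs0. destruct Hs0 as [Hs0 Hus0].
  set (E := fun r => 0 <= r /\ forall s, 0 <= s <= r -> u s <= A).
  destruct (completeness E) as [m [Hm1 Hm2]].
  - exists s0. intros r [Hr1 Hr2]. destruct (Rle_dec r s0); [assumption|].
    exfalso. apply Hus0, Hr2. lra.
  - exists 0. split; [lra|]. intros s Hs. replace s with 0 by lra. exact H0.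
  - assert (Hm0 : 0 <= m).
    { apply Hm1. split; [lra|]. intros s Hs. replace s with 0 by lra. exact H0. }
    assert (Hlt : forall s, 0 <= s < m -> u s <= A).
    { intros s Hs. apply NNPP. intro Hus. assert (m <= s); [|lra]. apply Hm2. intros r [Hr1 Hr2].
      destruct (Rle_dec r s); [assumption|]. exfalso. apply Hus, Hr2. lra. }
    assert (Hum : u m <= A).
    { destruct (Req_dec m 0) as [->|Hm0']; [exact H0|].
      destruct (Rle_dec (u m) A) as [|Hgt]; [assumption|]. exfalso.
      destruct (Hc m Hm0 (u m - A)) as [d [Hd Hs]]; [lra|].
      set (s := Rmax 0 (m - d / 2)).
      assert (Hs1 : 0 <= s < m /\ m - d / 2 <= s).
      { unfold s, Rmax. destruct Rle_dec; lra. }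
      specialize (Hs s). rewrite Rabs_minus_sym, Rabs_pos_eq in Hs by lra.
      specialize (Hs ltac:(lra)). apply Rabs_def2 in Hs. specialize (Hlt s ltac:(lra)). lra. }
    assert (Hle : forall s, 0 <= s <= m -> u s <= A).
    { intros s Hs. destruct (Req_dec s m) as [->|]; [exact Hum | apply Hlt; lra]. }
    assert (Hst := H m Hm0 Hle).
    destruct (Hc m Hm0 (A - u m)) as [d [Hd Hs]]; [lra|].
    assert (m + d / 2 <= m); [|lra]. apply Hm1. split; [lra|]. intros s Hs'.
    destruct (Rle_dec s m); [apply Hle; lra|].
    specialize (Hs s). rewrite Rabs_pos_eq in Hs by lra. specialize (Hs ltac:(lra)).
    apply Rabs_def2 in Hs. lra.
Qed.

Lemma Rabs_Cmod_sub (z w c : C) : Rabs (Cmod (z - c)%C - Cmod (w - c)%C) <= Cmod (z - w)%C.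
Proof.
  apply Rabs_le. pose proof (Cmod_sub_triangle z w c). pose proof (Cmod_sub_triangle w z c).
  rewrite (Cmod_sub_sym w z) in H0. lra.
Qed.

Section Flow.
Variable F : C -> C.
Hypothesis HF : holo F.

Notation solves := (solves F).
Notation reach := (reach F).

Lemma solves_reach phi x t : phi 0 = x -> 0 <= t -> solves phi 0 t -> reach x t (phi t).
Proof.
  intros H0 Ht H. exists phi. split; [exact H0|]. split; [reflexivity|].
  rewrite Rmin_left, Rmax_right by exact Ht. exact H.
Qed.

(** The solution of the field truncated outside the disc exists for all times, and
    by [bootstrap] it never reaches the circle, where the truncation would matter. *)
Lemma apriori x b A : Cmod (x - b)%C <= A ->
  (forall phi t, phi 0 = x -> 0 <= t -> solves phi 0 t ->
    (forall s, 0 <= s <= t -> Cmod (phi s - b)%C <= A) -> Cmod (phi t - b)%C < A) ->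
  exists phi, phi 0 = x /\ forall t, 0 <= t -> rder phi t (F (phi t)) /\ Cmod (phi t - b)%C < A.
Proof.
  intros Hx H.
  assert (HA : 0 <= A) by (eapply Rle_trans; [apply Cmod_ge_0 | exact Hx]).
  destruct (truncation F HF (Cmod b + A)) as (G & L & _ & _ & HG & Hex).
  { pose proof (Cmod_ge_0 b). lra. }
  destruct (Hex x) as [phi [P0 P]].
  assert (Hloc : forall s, Cmod (phi s - b)%C <= A -> rder phi s (F (phi s))).
  { intros s Hs. rewrite <- HG; [apply P|]. pose proof (Cmod_le_add (phi s) b). lra. }
  assert (Hst : forall t, 0 <= t -> Cmod (phi t - b)%C < A).
  { apply (bootstrap (fun t => Cmod (phi t - b)%C) A).
    - intros t Ht e He. destruct (der_cont_Cmod phi t _ (P t) e He) as [d [Hd Hs]].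
      exists d. split; [exact Hd|]. intros s Hsd.
      eapply Rle_lt_trans; [apply Rabs_Cmod_sub | apply Hs, Hsd].
    - rewrite P0. exact Hx.
    - intros t Ht Hs. apply H; auto. intros s Hst. apply Hloc, Hs, Hst. }
  exists phi. split; [exact P0|]. intros t Ht. split; [|apply Hst, Ht].
  apply Hloc. left. apply Hst, Ht.
Qed.

Lemma forward_bounded_complete x K :
  (forall t v, 0 <= t -> reach x t v -> Cmod v <= K) -> forall t, 0 <= t -> exists v, reach x t v.
Proof.
  intros H t Ht.
  destruct (apriori x 0 (K + 1)) as [phi [P0 P]].
  - rewrite Cminus_0_r. specialize (H 0 x ltac:(lra) (reach_0 F HF x)). lra.
  - intros phi s P0 Hs P _. rewrite Cminus_0_r.
    specialize (H s (phi s) Hs (solves_reach phi x s P0 Hs P)). lra.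
  - exists (phi t). apply solves_reach; [exact P0 | exact Ht|]. intros s Hs. apply P. lra.
Qed.

(** ** Maximal solutions *)

Lemma reach_extend x t v : reach x t v -> exists eps, 0 < eps /\
  exists phi : R -> C, phi t = v /\ forall s, Rabs (s - t) < eps -> reach x s (phi s) /\ rder phi s (F (phi s)).
Proof.
  intros (phi & P0 & P1 & P).
  destruct (curve_bounded phi _ _ (Rmin_le_Rmax 0 t)) as [K [HK B]]; [intros u Hu; eexists; apply P, Hu|].
  destruct (truncation F HF (K + 1)) as (G & L & _ & HL & HG & Hex); [lra|].
  destruct (Hex x) as [chi [C0 Cd]].
  assert (A := trunc_agree F G L (K + 1) chi phi 0 t HL HG Cd P).
  specialize (A ltac:(intros u Hu; specialize (B u Hu); lra) (eq_trans C0 (eq_sym P0))).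
  destruct (der_cont_Cmod chi t _ (Cd t) 1 Rlt_0_1) as [d [Hd Hc]].
  assert (Hb : forall s, Rmin 0 t <= s <= Rmax 0 t \/ Rabs (s - t) < d -> Cmod (chi s) <= K + 1).
  { intros s [Hs|Hs].
    - rewrite A by exact Hs. specialize (B s Hs). lra.
    - specialize (Hc s Hs). pose proof (Cmod_le_add (chi s) (chi t)).
      rewrite (A t (between_r 0 t)) in *. specialize (B t (between_r 0 t)). lra. }
  exists d. split; [exact Hd|]. exists chi. split; [rewrite A by apply between_r; exact P1|].
  intros s Hs. split.
  - exists chi. split; [exact C0|]. split; [reflexivity|]. intros u Hu. rewrite <- HG; [apply Cd|].
    apply Hb. revert Hu Hs. unfold Rmin, Rmax, Rabs. repeat destruct Rle_dec; repeat destruct Rcase_abs; lra.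
  - rewrite <- HG; [apply Cd|]. apply Hb. right. exact Hs.
Qed.

Definition dom (x : C) (t : R) : Prop := exists v, reach x t v.

Definition flow_map (x : C) (t : R) : C :=
  match excluded_middle_informative (dom x t) with
  | left H => proj1_sig (constructive_indefinite_description _ H)
  | right _ => 0
  end.

Lemma flow_map_reach x t : dom x t -> reach x t (flow_map x t).
Proof.
  intro H. unfold flow_map. destruct excluded_middle_informative as [H'|]; [|contradiction].
  apply proj2_sig.
Qed.

Lemma flow_map_eq x t v : reach x t v -> flow_map x t = v.
Proof.
  intro H. apply (reach_unique F HF x t); [|exact H]. apply flow_map_reach. exists v. exact H.
Qed.

Lemma dom_interval x (t : R) : dom x t <-> Rbar_lt (Glb_Rbar (dom x)) t /\ Rbar_lt t (Lub_Rbar (dom x)).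
Proof.
  destruct (Glb_Rbar_correct (dom x)) as [G1 G2]. destruct (Lub_Rbar_correct (dom x)) as [L1 L2].
  split.
  - intros [v Hv]. destruct (reach_extend x t v Hv) as [e [He [phi [_ H]]]].
    split.
    + apply Rbar_le_lt_trans with (Finite (t - e / 2)); [|simpl; lra].
      apply G1. exists (phi (t - e / 2)). apply H.
      replace (t - e / 2 - t) with (- (e / 2)) by ring. rewrite Rabs_Ropp, Rabs_pos_eq; lra.
    + apply Rbar_lt_le_trans with (Finite (t + e / 2)); [simpl; lra|].
      apply L1. exists (phi (t + e / 2)). apply H.
      replace (t + e / 2 - t) with (e / 2) by ring. rewrite Rabs_pos_eq; lra.
  - intros [H1 H2].
    assert (Hs : exists s, dom x s /\ Rmin 0 s <= t <= Rmax 0 s).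
    { apply NNPP. intro Hn. destruct (Rle_dec 0 t) as [Ht|Ht].
      - apply (Rbar_lt_not_le _ _ H2). apply L2. intros s Hs. simpl.
        destruct (Rle_dec s t); [assumption|]. exfalso. apply Hn. exists s. split; [exact Hs|].
        rewrite Rmin_left, Rmax_right; lra.
      - apply (Rbar_lt_not_le _ _ H1). apply G2. intros s Hs. simpl.
        destruct (Rle_dec t s); [assumption|]. exfalso. apply Hn. exists s. split; [exact Hs|].
        rewrite Rmin_right, Rmax_left; lra. }
    destruct Hs as (s & [v Hv] & Hst). destruct (reach_part F HF x s v t Hv Hst) as [w [Hw _]].
    exists w. exact Hw.
Qed.

Lemma solution_reach x alpha beta phi (t : R) : solution F x alpha beta phi ->
  Rbar_lt alpha t -> Rbar_lt t beta -> reach x t (phi t).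
Proof.
  intros (Ha & Hb & P0 & P) Hat Htb. exists phi. split; [exact P0|]. split; [reflexivity|].
  intros u Hu. apply rder_is_derive, P.
  - apply Rbar_lt_le_trans with (Finite (Rmin 0 t)); [|apply (proj1 Hu)].
    unfold Rmin. destruct Rle_dec; assumption.
  - apply Rbar_le_lt_trans with (Finite (Rmax 0 t)); [apply (proj2 Hu)|].
    unfold Rmax. destruct Rle_dec; assumption.
Qed.

(** The maximal interval runs between the infimum and the supremum of the times
    that can be reached. *)
Lemma flow_exists x : flow F x (Glb_Rbar (dom x)) (Lub_Rbar (dom x)) (flow_map x).
Proof.
  split.
  - assert (H0 : dom x 0) by (exists x; apply reach_0, HF).
    destruct (proj1 (dom_interval x 0) H0) as [Ha Hb].
    split; [exact Ha|]. split; [exact Hb|]. split; [apply flow_map_eq, reach_0, HF|].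
    intros t Hat Htb. apply rder_is_derive.
    destruct (proj2 (dom_interval x t) (conj Hat Htb)) as [v Hv].
    destruct (reach_extend x t v Hv) as [e [He [phi [P1 P]]]].
    apply (der_ext RtoC phi (flow_map x) t (F (phi t)) _ e He).
    + intros s Hs. rewrite Cmod_RtoC_sub in Hs. symmetry. apply flow_map_eq, P, Hs.
    + rewrite P1, (flow_map_eq x t v Hv). reflexivity.
    + apply P. rewrite Rminus_diag, Rabs_R0. exact He.
  - intros a' b' psi Hs.
    assert (Hd : forall t : R, Rbar_lt a' t -> Rbar_lt t b' -> dom x t).
    { intros t H1 H2. exists (psi t). apply (solution_reach x a' b'); assumption. }
    destruct Hs as (Ha & Hb & _).
    split; apply Rbar_not_lt_le; intro Hlt.
    + assert (Hm : exists m : R, Rbar_lt a' m /\ Rbar_lt m 0 /\ Rbar_le m (Glb_Rbar (dom x))).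
      { destruct a' as [a'| |], (Glb_Rbar (dom x)) as [g| |]; simpl in *; try contradiction.
        - exists ((a' + Rmin 0 g) / 2). unfold Rmin. destruct Rle_dec; lra.
        - exists (a' / 2). lra.
        - exists (Rmin 0 g - 1). unfold Rmin. destruct Rle_dec; lra.
        - exists (-1). lra. }
      destruct Hm as (m & M1 & M2 & M3).
      destruct (proj1 (dom_interval x m)) as [A _].
      * apply Hd; [exact M1|]. apply Rbar_lt_trans with 0; assumption.
      * apply (Rbar_lt_not_le _ _ A). exact M3.
    + assert (Hm : exists m : R, Rbar_lt m b' /\ Rbar_lt 0 m /\ Rbar_le (Lub_Rbar (dom x)) m).
      { destruct b' as [b'| |], (Lub_Rbar (dom x)) as [g| |]; simpl in *; try contradiction.
        - exists ((b' + Rmax 0 g) / 2). unfold Rmax. destruct Rle_dec; lra.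
        - exists (b' / 2). lra.
        - exists (Rmax 0 g + 1). unfold Rmax. destruct Rle_dec; lra.
        - exists 1. lra. }
      destruct Hm as (m & M1 & M2 & M3).
      destruct (proj1 (dom_interval x m)) as [_ A].
      * apply Hd; [|exact M1]. apply Rbar_lt_trans with 0; assumption.
      * apply (Rbar_lt_not_le _ _ A). exact M3.
Qed.

Lemma flow_reach x alpha beta phi (t : R) v : flow F x alpha beta phi ->
  (Rbar_lt alpha t /\ Rbar_lt t beta /\ phi t = v) <-> reach x t v.
Proof.
  intros [Hs Hmax]. split.
  - intros (H1 & H2 & <-). apply (solution_reach x alpha beta); assumption.
  - intro H. destruct (proj1 (dom_interval x t) (ex_intro _ v H)) as [H1 H2].
    destruct (Hmax _ _ _ (proj1 (flow_exists x))) as [M1 M2].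
    assert (A1 : Rbar_lt alpha t) by (eapply Rbar_le_lt_trans; eassumption).
    assert (A2 : Rbar_lt t beta) by (eapply Rbar_lt_le_trans; eassumption).
    split; [exact A1|]. split; [exact A2|].
    apply (reach_unique F HF x t); [|exact H]. apply (solution_reach x alpha beta); assumption.
Qed.

Lemma orbit_reach x y : orbit F x y <-> exists t, reach x t y.
Proof.
  split.
  - intros (alpha & beta & phi & Hf & t & Ht). exists t. apply (flow_reach x alpha beta phi); assumption.
  - intros [t Ht]. do 3 eexists. split; [apply flow_exists|]. exists t.
    apply (flow_reach _ _ _ _ _ _ (flow_exists x)), Ht.
Qed.

(** ** Convergence in forward time *)

Definition conv (x a : C) : Prop :=
  forall eps, 0 < eps -> exists T, forall t, T <= t -> exists v, reach x t v /\ Cmod (v - a)%C < eps.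

Lemma conv_shift x t v a : reach x t v -> conv v a -> conv x a.
Proof.
  intros H Hc eps Heps. destruct (Hc eps Heps) as [T HT]. exists (t + T). intros s Hs.
  destruct (HT (s - t)) as [w [Hw Hd]]; [lra|]. exists w. split; [|exact Hd].
  replace s with (t + (s - t)) by ring. apply reach_trans with v; assumption.
Qed.

Lemma conv_dom x a t : conv x a -> 0 <= t -> dom x t.
Proof.
  intros H Ht. destruct (H 1 Rlt_0_1) as [T HT]. destruct (HT (Rmax T t)) as [v [Hv _]]; [apply Rmax_l|].
  destruct (reach_part F HF x (Rmax T t) v t Hv) as [w [Hw _]]; [|exists w; exact Hw].
  pose proof (Rmax_r T t). rewrite Rmin_left, Rmax_right; lra.
Qed.

Lemma conv_beta x a alpha beta phi : flow F x alpha beta phi -> conv x a -> beta = p_infty.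
Proof.
  intros Hf Hc. assert (H : forall t : R, 0 <= t -> Rbar_lt t beta).
  { intros t Ht. destruct (conv_dom x a t Hc Ht) as [v Hv].
    apply (flow_reach x alpha beta phi t v Hf), Hv. }
  destruct beta as [b| |]; [|reflexivity|].
  - specialize (H (Rmax 0 b) (Rmax_l _ _)). simpl in H. pose proof (Rmax_r 0 b). lra.
  - specialize (H 0 ltac:(lra)). contradiction.
Qed.

Lemma conv_flow_lim x a alpha beta phi : flow F x alpha beta phi -> conv x a ->
  forall eps, 0 < eps -> exists T, forall t, T <= t -> Cmod (phi t - a)%C < eps.
Proof.
  intros Hf Hc eps Heps. destruct (Hc eps Heps) as [T HT]. exists T. intros t Ht.
  destruct (HT t Ht) as [v [Hv Hd]]. apply (flow_reach x alpha beta phi t v Hf) in Hv.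
  destruct Hv as (_ & _ & ->). exact Hd.
Qed.

Lemma tends_forward_conv x a : tends_forward F x a <-> conv x a.
Proof.
  split.
  - intros (alpha & beta & phi & Hf & Hlim).
    assert (Hd : forall eps, 0 < eps ->
      within (fun t : R => Rbar_lt t beta) (Rbar_locally beta) (fun t => Cmod (phi t - a)%C < eps)).
    { intros eps Heps. apply (Hlim (fun z => Cmod (z - a)%C < eps)). apply locally_Cmod. exists eps. auto. }
    assert (Hr : forall t : R, 0 <= t -> Rbar_lt t beta -> reach x t (phi t)).
    { intros t Ht Htb. apply (flow_reach x alpha beta phi t _ Hf). split; [|auto].
      apply Rbar_lt_le_trans with 0; [apply (proj1 (proj1 Hf)) | exact Ht]. }
    destruct beta as [b| |].
    + (* A finite endpoint is impossible: the solution would be bounded up to it. *)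
      exfalso. destruct (Hd 1 Rlt_0_1) as [d Hb].
      assert (H0b : 0 < b) by apply (proj1 (proj2 (proj1 Hf))).
      set (m := Rmax 0 (b - d / 2)). pose proof (cond_pos d).
      assert (Hm : 0 <= m < b) by (unfold m, Rmax; destruct Rle_dec; lra).
      destruct (curve_bounded phi 0 m (proj1 Hm)) as [K [HK B]].
      { intros t Ht. exists (F (phi t)). apply rder_is_derive. apply (proj1 Hf).
        - apply Rbar_lt_le_trans with 0; [apply (proj1 (proj1 Hf)) | simpl; lra].
        - simpl; lra. }
      destruct (forward_bounded_complete x (K + Cmod a + 1)) with (t := b) as [v Hv]; [|lra|].
      * intros t v Ht Hv. apply (flow_reach x alpha b phi t v Hf) in Hv. destruct Hv as (_ & Htb & <-).
        destruct (Rle_dec t m) as [Htm|Htm].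
        -- specialize (B t ltac:(lra)). pose proof (Cmod_ge_0 a). lra.
        -- assert (Cmod (phi t - a)%C < 1).
           { apply Hb; [|exact Htb]. change (Rabs (t - b) < d). simpl in Htb.
             assert (b - d / 2 <= m) by apply Rmax_r. rewrite Rabs_left; lra. }
           pose proof (Cmod_le_add (phi t) a). lra.
      * apply (flow_reach x alpha b phi b v Hf) in Hv. simpl in Hv. lra.
    + intros eps Heps. destruct (Hd eps Heps) as [M HM]. exists (Rmax 0 (M + 1)). intros t Ht.
      pose proof (Rmax_l 0 (M + 1)). pose proof (Rmax_r 0 (M + 1)).
      exists (phi t). split; [apply Hr; [lra | exact I]|]. apply HM; [lra | exact I].
    + destruct Hf as [(_ & [] & _) _].
  - intro Hc. do 3 eexists. split; [apply flow_exists|].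
    rewrite (conv_beta x a _ _ _ (flow_exists x) Hc).
    intros P HP. apply locally_Cmod in HP. destruct HP as [d [Hd HP]].
    destruct (conv_flow_lim x a _ _ _ (flow_exists x) Hc d Hd) as [T HT].
    exists T. intros t Ht _. apply HP, HT. lra.
Qed.

Lemma seq_lim_unique (w : nat -> C) p a :
  filterlim w eventually (@locally C_UniformSpace p) ->
  (forall eps, 0 < eps -> exists N, forall n, (N <= n)%nat -> Cmod (w n - a)%C < eps) -> p = a.
Proof.
  intros Hp Ha. apply Cmod_zero_eq, le_epsilon. intros e He. rewrite Rplus_0_l.
  destruct (Ha (e / 2)) as [N1 H1]; [lra|].
  destruct (Hp (fun z => Cmod (z - p)%C < e / 2)) as [N2 H2].
  { apply locally_Cmod. exists (e / 2). split; [lra | auto]. }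
  specialize (H1 (max N1 N2) ltac:(lia)). specialize (H2 (max N1 N2) ltac:(lia)).
  pose proof (Cmod_sub_triangle p (w (max N1 N2)) a). rewrite (Cmod_sub_sym p (w _)) in H. lra.
Qed.

Lemma conv_w_plus x a p : conv x a -> (w_plus F x p <-> p = a).
Proof.
  intro Hc. split.
  - intros (alpha & beta & phi & Hf & u & Hu & Hub & Hlim).
    rewrite (conv_beta x a alpha beta phi Hf Hc) in Hub.
    apply (seq_lim_unique _ _ _ Hlim). intros eps Heps.
    destruct (conv_flow_lim x a alpha beta phi Hf Hc eps Heps) as [T HT].
    destruct (Hub (fun t => T < t)) as [N HN]; [exists T; auto|].
    exists N. intros n Hn. apply HT. left. apply HN, Hn.
  - intros ->. do 3 eexists. split; [apply flow_exists|]. exists INR.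
    rewrite (conv_beta x a _ _ _ (flow_exists x) Hc). split; [|split].
    + intro n. split; [|exact I].
      apply Rbar_lt_le_trans with 0; [apply (proj1 (proj1 (flow_exists x))) | apply pos_INR].
    + apply is_lim_seq_INR.
    + intros P HP. apply locally_Cmod in HP. destruct HP as [d [Hd HP]].
      destruct (conv_flow_lim x a _ _ _ (flow_exists x) Hc d Hd) as [T HT].
      destruct (INR_unbounded T) as [N HN].
      exists N. intros n Hn. apply HP, HT. apply le_INR in Hn. lra.
Qed.

Lemma w_plus_approx x p eps : w_plus F x p -> 0 < eps -> exists t v, reach x t v /\ Cmod (v - p)%C < eps.
Proof.
  intros (alpha & beta & phi & Hf & u & Hu & _ & Hlim) Heps.
  destruct (Hlim (fun z => Cmod (z - p)%C < eps)) as [N HN].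
  { apply locally_Cmod. exists eps. auto. }
  exists (u N), (phi (u N)). split; [|apply HN; lia].
  apply (flow_reach x alpha beta phi _ _ Hf). destruct (Hu N). auto.
Qed.

Lemma attracting_conv a : attracting F a <->
  exists r, 0 < r /\ forall x, Cmod (x - a)%C < r -> conv x a.
Proof.
  unfold attracting. rewrite locally_Cmod. split; intros [r [Hr H]]; exists r; split; auto;
    intros x Hx; apply tends_forward_conv, H, Hx.
Qed.

(** A single limit point [a] suffices: close to it every orbit tends to [a].  In
    particular an orbit with [a] as its only limit point is bounded in forward time. *)
Lemma attracting_basin a x : attracting F a -> ((forall p, w_plus F x p <-> p = a) <-> conv x a).
Proof.
  intro Ha. split.
  - intro H. apply attracting_conv in Ha. destruct Ha as [r [Hr Ha]].
    destruct (w_plus_approx x a r (proj2 (H a) eq_refl) Hr) as (t & v & Hv & Hd).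
    apply conv_shift with t v; [exact Hv | apply Ha, Hd].
  - intros Hc p. apply conv_w_plus, Hc.
Qed.

End Flow.

(** ** Time reversal *)

Section Reversal.
Variables F G : C -> C.
Hypothesis HFG : forall z, G z = (- F z)%C.

Lemma neg_sym : forall z, F z = (- G z)%C.
Proof. intro z. rewrite HFG. ring. Qed.

Lemma neg_holo : holo F -> holo G.
Proof.
  intros HF z. destruct (HF z) as [l Hl]. exists (- l)%C.
  apply (der_ext _ (fun w => - F w)%C G z (- l)%C _ 1); [lra| |reflexivity | apply der_opp, Hl].
  intros w _. symmetry. apply HFG.
Qed.

Lemma solution_neg x alpha beta phi : solution F x alpha beta phi ->
  solution G x (Rbar_opp beta) (Rbar_opp alpha) (fun t => phi (- t)).
Proof.
  intros (Ha & Hb & P0 & P). split; [|split; [|split]].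
  - apply Rbar_opp_lt. rewrite Rbar_opp_involutive. simpl. rewrite Ropp_0. exact Hb.
  - apply Rbar_opp_lt. rewrite Rbar_opp_involutive. simpl. rewrite Ropp_0. exact Ha.
  - rewrite Ropp_0. exact P0.
  - intros t Ht1 Ht2. apply rder_is_derive. rewrite HFG. apply rder_opp_time.
    apply rder_is_derive, P; apply Rbar_opp_lt; simpl; rewrite ?Ropp_involutive; assumption.
Qed.

End Reversal.

Lemma flow_neg F G x alpha beta phi : (forall z, G z = (- F z)%C) -> flow F x alpha beta phi ->
  flow G x (Rbar_opp beta) (Rbar_opp alpha) (fun t => phi (- t)).
Proof.
  intros HFG [Hs Hmax]. split; [apply (solution_neg F G HFG), Hs|].
  intros a' b' psi Hpsi. destruct (Hmax _ _ _ (solution_neg G F (neg_sym F G HFG) _ _ _ _ Hpsi)) as [M1 M2].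
  split; apply Rbar_opp_le; rewrite Rbar_opp_involutive; assumption.
Qed.

Lemma w_minus_neg F G x p : (forall z, G z = (- F z)%C) -> w_minus F x p -> w_plus G x p.
Proof.
  intros HFG (alpha & beta & phi & Hf & u & Hu & Hua & Hlim).
  exists (Rbar_opp beta), (Rbar_opp alpha), (fun t => phi (- t)).
  split; [apply (flow_neg F G), Hf; exact HFG|]. exists (fun n => - u n). split; [|split].
  - intro n. destruct (Hu n). split; apply Rbar_opp_lt; rewrite Rbar_opp_involutive; simpl;
      rewrite Ropp_involutive; assumption.
  - apply is_lim_seq_opp in Hua. exact Hua.
  - apply filterlim_ext with (2 := Hlim). intro n. rewrite Ropp_involutive. reflexivity.
Qed.

Lemma w_plus_neg F G x p : (forall z, G z = (- F z)%C) -> w_plus F x p -> w_minus G x p.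
Proof.
  intros HFG (alpha & beta & phi & Hf & u & Hu & Hua & Hlim).
  exists (Rbar_opp beta), (Rbar_opp alpha), (fun t => phi (- t)).
  split; [apply (flow_neg F G), Hf; exact HFG|]. exists (fun n => - u n). split; [|split].
  - intro n. destruct (Hu n). split; apply Rbar_opp_lt; rewrite Rbar_opp_involutive; simpl;
      rewrite Ropp_involutive; assumption.
  - apply is_lim_seq_opp in Hua. exact Hua.
  - apply filterlim_ext with (2 := Hlim). intro n. rewrite Ropp_involutive. reflexivity.
Qed.

Lemma reach_neg F G x t v : (forall z, G z = (- F z)%C) -> reach F x t v -> reach G x (- t) v.
Proof.
  intros HFG (phi & P0 & P1 & P). exists (fun s => phi (- s)). split; [|split].
  - rewrite Ropp_0. exact P0.
  - rewrite Ropp_involutive. exact P1.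
  - intros u Hu. rewrite HFG. apply rder_opp_time, P.
    revert Hu. unfold Rmin, Rmax. repeat destruct Rle_dec; lra.
Qed.

Lemma filterlim_opp_within_r (b : Rbar) :
  filterlim Ropp (within (fun t : R => Rbar_lt (Rbar_opp b) t) (Rbar_locally (Rbar_opp b)))
    (within (fun t : R => Rbar_lt t b) (Rbar_locally b)).
Proof.
  intros P HP. assert (A := filterlim_Rbar_opp (Rbar_opp b)). rewrite Rbar_opp_involutive in A.
  specialize (A _ HP). unfold filtermap, within in *. revert A. apply filter_imp. intros t H Ht. apply H.
  apply Rbar_opp_lt; simpl; rewrite ?Ropp_involutive; exact Ht.
Qed.

Lemma filterlim_opp_within_l (b : Rbar) :
  filterlim Ropp (within (fun t : R => Rbar_lt t (Rbar_opp b)) (Rbar_locally (Rbar_opp b)))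
    (within (fun t : R => Rbar_lt b t) (Rbar_locally b)).
Proof.
  intros P HP. assert (A := filterlim_Rbar_opp (Rbar_opp b)). rewrite Rbar_opp_involutive in A.
  specialize (A _ HP). unfold filtermap, within in *. revert A. apply filter_imp. intros t H Ht. apply H.
  apply Rbar_opp_lt; simpl; rewrite ?Ropp_involutive; exact Ht.
Qed.

Lemma tends_backward_neg F G x a : (forall z, G z = (- F z)%C) -> tends_backward F x a -> tends_forward G x a.
Proof.
  intros HFG (alpha & beta & phi & Hf & Hlim).
  exists (Rbar_opp beta), (Rbar_opp alpha), (fun t => phi (- t)).
  split; [apply (flow_neg F G), Hf; exact HFG|].
  apply filterlim_comp with (2 := Hlim) (f := Ropp). apply filterlim_opp_within_l.
Qed.

Lemma tends_forward_neg F G x a : (forall z, G z = (- F z)%C) -> tends_forward F x a -> tends_backward G x a.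
Proof.
  intros HFG (alpha & beta & phi & Hf & Hlim).
  exists (Rbar_opp beta), (Rbar_opp alpha), (fun t => phi (- t)).
  split; [apply (flow_neg F G), Hf; exact HFG|].
  apply filterlim_comp with (2 := Hlim) (f := Ropp). apply filterlim_opp_within_r.
Qed.

(** * Boundaries of invariant sets *)

(** The path meets the boundary at the supremum of the times up to which it stays
    in [N]. *)
Lemma boundary_on_path (N : C -> Prop) (g : R -> C) :
  (forall s, 0 <= s <= 1 -> cont_at RtoC g s) -> N (g 0) -> ~ N (g 1) ->
  exists s, 0 <= s <= 1 /\ boundary N (g s).
Proof.
  intros Hg H0 H1.
  set (E := fun s => 0 <= s <= 1 /\ forall u, 0 <= u <= s -> N (g u)).
  assert (E0 : E 0).
  { split; [lra|]. intros u Hu. replace u with 0 by lra. exact H0. }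
  destruct (completeness E) as [m [Hm1 Hm2]].
  - exists 1. intros s [Hs _]. lra.
  - exists 0. exact E0.
  - assert (Hm : 0 <= m <= 1).
    { split; [apply Hm1, E0|]. apply Hm2. intros s [Hs _]. lra. }
    assert (Hlt : forall u, 0 <= u < m -> N (g u)).
    { intros u Hu. apply NNPP. intro Hn. assert (m <= u); [|lra]. apply Hm2. intros s [Hs1 Hs2].
      destruct (Rle_dec s u); [assumption|]. exfalso. apply Hn, Hs2. lra. }
    exists m. split; [exact Hm|]. intros eps Heps.
    destruct (Hg m Hm eps Heps) as [d [Hd Hc]].
    assert (Hc' : forall s, Rabs (s - m) < d -> disc (g m) eps (g s)).
    { intros s Hs. apply Hc. rewrite Cmod_RtoC_sub. exact Hs. }
    split.
    + destruct (Req_dec m 0) as [E'|E'].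
      { exists (g 0). split; [|exact H0]. apply Hc'. rewrite E', Rminus_diag, Rabs_R0. exact Hd. }
      set (s := Rmax 0 (m - d / 2)).
      assert (Hs : 0 <= s < m /\ m - d / 2 <= s) by (unfold s, Rmax; destruct Rle_dec; lra).
      exists (g s). split; [|apply Hlt; lra]. apply Hc'. rewrite Rabs_left; lra.
    + apply NNPP. intro Hn.
      assert (Hall : forall s, Rabs (s - m) < d -> N (g s)).
      { intros s Hs. apply NNPP. intro. apply Hn. exists (g s). auto. }
      assert (Hle : forall s, 0 <= s < m + d -> N (g s)).
      { intros s Hs. destruct (Rlt_dec s m); [apply Hlt; lra|]. apply Hall. rewrite Rabs_pos_eq; lra. }
      destruct (Rlt_dec 1 (m + d)); [apply H1, Hle; lra|].
      assert (m + d / 2 <= m); [|lra]. apply Hm1. split; [lra|]. intros u Hu. apply Hle. lra.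
Qed.

Definition is_open (N : C -> Prop) : Prop :=
  forall x, N x -> exists d, 0 < d /\ forall y, Cmod (y - x)%C < d -> N y.

Lemma boundary_not_open N z : is_open N -> boundary N z -> ~ N z.
Proof.
  intros HN Hb Hz. destruct (HN z Hz) as [d [Hd Hy]].
  destruct (Hb d Hd) as [_ [y [Hyd Hn]]]. apply Hn, Hy, Hyd.
Qed.

Lemma boundary_ext N N' z : (forall x, N x <-> N' x) -> boundary N z -> boundary N' z.
Proof.
  intros H Hb eps Heps. destruct (Hb eps Heps) as [[y [H1 H2]] [w [H3 H4]]].
  split; [exists y | exists w]; split; auto; [apply H, H2 | intro Hw; apply H4, H, Hw].
Qed.

Section Basin.
Variable F : C -> C.
Hypothesis HF : holo F.

Notation reach := (reach F).

Definition invariant (N : C -> Prop) : Prop := forall x t v, reach x t v -> N x -> N v.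

Lemma boundary_invariant N : invariant N -> invariant (boundary N).
Proof.
  intros HN x t v Hr Hb eps Heps.
  destruct (reach_continuous F HF x t v Hr) as [K HK]. destruct (HK eps Heps) as [d [Hd H]].
  destruct (Hb d Hd) as [[y [Hy1 Hy2]] [z [Hz1 Hz2]]]. split.
  - destruct (H y Hy1) as [[w [Hw1 Hw2]] _]. exists w. split; [exact Hw2|]. apply (HN y t w Hw1 Hy2).
  - destruct (H z Hz1) as [[w [Hw1 Hw2]] _]. exists w. split; [exact Hw2|]. intro Hn. apply Hz2.
    apply (HN w (- t) z); [apply reach_sym, Hw1 | exact Hn].
Qed.

Lemma conv_invariant a : invariant (fun x => conv F x a).
Proof. intros x t v Hr Hx. apply (conv_shift F HF v (- t) x); [apply reach_sym, Hr | exact Hx]. Qed.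

Lemma conv_open a : attracting F a -> is_open (fun x => conv F x a).
Proof.
  intros Ha x Hx. apply (attracting_conv F HF) in Ha. destruct Ha as [r [Hr Ha]].
  destruct (Hx (r / 2)) as [T HT]; [lra|]. destruct (HT T (Rle_refl T)) as [v [Hv Hd]].
  destruct (reach_continuous F HF x T v Hv) as [K HK]. destruct (HK (r / 2)) as [d [Hd0 H]]; [lra|].
  exists d. split; [exact Hd0|]. intros y Hy. destruct (H y Hy) as [[w [Hw1 Hw2]] _].
  apply (conv_shift F HF y T w); [exact Hw1|]. apply Ha.
  pose proof (Cmod_sub_triangle w v a). lra.
Qed.

Lemma reach_equilibrium z t : F z = 0 -> reach z t z.
Proof.
  intro Hz. exists (fun _ => z). split; [reflexivity|]. split; [reflexivity|].
  intros s _. rewrite Hz. apply der_const.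
Qed.

Lemma reach_nonequilibrium x t v : reach x t v -> F x <> 0 -> F v <> 0.
Proof.
  intros Hr Hx Hv. apply Hx. apply reach_sym in Hr.
  rewrite (reach_unique F HF v (- t) x v Hr (reach_equilibrium v (- t) Hv)). exact Hv.
Qed.

Lemma flow_map_der x t : dom F x t -> rder (flow_map F x) t (F (flow_map F x t)).
Proof.
  intro H. apply rder_is_derive. apply (dom_interval F HF) in H. destruct H as [H1 H2].
  apply (proj1 (flow_exists F HF x)); assumption.
Qed.

(** * Shadowing *)

(** The time needed to travel from [x(t)] to [y(t)], that is the integral of
    [dz / F] along the segment joining them, does not depend on [t].  As long
    as the points are close relatively to [|F (x(t))|] this integral is
    comparable to [(y - x) / F x], so that they remain relatively close. *)
Lemma shadowing K : 0 <= K -> exists L, 0 < L /\ forall x y : R -> C,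
  (forall t, 0 <= t -> rder x t (F (x t)) /\ Cmod (x t) <= K /\ F (x t) <> 0) ->
  (forall t, 0 <= t -> rder y t (F (y t))) ->
  Cmod (y 0%R - x 0%R)%C <= Cmod (F (x 0)) / (16 * L) ->
  forall t, 0 <= t -> Cmod (y t - x t)%C * Cmod (F (x 0)) <= 2 * Cmod (y 0%R - x 0%R)%C * Cmod (F (x t)).
Proof.
  intro HK. destruct (holo_lipschitz F (K + 1) HF) as [L0 [HL0 HLip0]].
  destruct (holo_bounded F K HF) as [M [HM HB]].
  set (L := L0 + M + 1). assert (HL : 0 < L) by (unfold L; lra).
  assert (HLip : forall z w, Cmod z <= K + 1 -> Cmod w <= K + 1 ->
    Cmod (F w - F z)%C <= L * Cmod (w - z)%C).
  { intros z w Hz Hw. specialize (HLip0 z w Hz Hw). pose proof (Cmod_ge_0 (w - z)%C).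
    unfold L. nra. }
  exists L. split; [exact HL|]. intros x y Hx Hy Hinit.
  set (q := fun t => ((y t - x t) * / F (x t))%C).
  set (Ga := fun t => seg_int (fun z => / F z)%C (x t) (y t)).
  (* Within [|F c| / (2 L)] of [c] the Lipschitz bound keeps [|F|] above [|F c| / 2]. *)
  assert (Hdisc : forall c z, Cmod c <= K -> F c <> 0 -> Cmod (z - c)%C < Cmod (F c) / (2 * L) ->
    Cmod (F z - F c)%C <= L * Cmod (z - c)%C /\ F z <> 0).
  { intros c z Hc Hc0 Hz.
    assert (Hr : Cmod (F c) / (2 * L) <= 1).
    { specialize (HB c Hc). apply Rmult_le_reg_r with (2 * L); [lra|].
      unfold Rdiv. rewrite Rmult_assoc, Rinv_l by lra. unfold L. lra. }
    assert (A : Cmod (F z - F c)%C <= L * Cmod (z - c)%C).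
    { apply HLip; [lra|]. pose proof (Cmod_le_add z c). lra. }
    split; [exact A|]. apply Cmod_gt_0. apply Cmod_gt_0 in Hc0.
    apply (Rmult_lt_compat_l L) in Hz; [|exact HL].
    replace (L * (Cmod (F c) / (2 * L))) with (Cmod (F c) / 2) in Hz by (field; lra).
    pose proof (Cmod_le_add (F c) (F z)). rewrite (Cmod_sub_sym (F c)) in H. lra. }
  assert (Hdinv : forall z, F z <> 0 -> exists l, cder (fun z => / F z)%C z l).
  { intros z Hz. destruct (HF z) as [l Hl]. eexists. apply (der_inv _ F z l Hz Hl). }
  assert (Hq : forall t, 0 <= t -> Cmod (y t - x t)%C = Cmod (q t) * Cmod (F (x t))).
  { intros t Ht. rewrite <- Cmod_mult. f_equal. unfold q. field. apply Hx, Ht. }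
  assert (Hnear : forall t, 0 <= t -> Cmod (q t) <= / (4 * L) ->
    Cmod (y t - x t)%C <= Cmod (F (x t)) / (4 * L)).
  { intros t Ht Hqt. rewrite Hq by exact Ht. pose proof (Cmod_ge_0 (F (x t))). unfold Rdiv. nra. }
  assert (Hpos : forall t, 0 <= t -> 0 < Cmod (F (x t))).
  { intros t Ht. apply Cmod_gt_0, Hx, Ht. }
  assert (Hin : forall t s, 0 <= t -> Cmod (q t) <= / (4 * L) -> 0 <= s <= 1 ->
    Cmod (seg (x t) (y t) s - x t)%C <= Cmod (F (x t)) / (4 * L)).
  { intros t s Ht Hqt Hs. apply seg_disc; [rewrite Cmod_sub_self | apply Hnear | ]; auto.
    specialize (Hpos t Ht). apply Rmult_le_pos; [lra|]. left. apply Rinv_0_lt_compat. lra. }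
  assert (H42 : forall t, 0 <= t -> Cmod (F (x t)) / (4 * L) < Cmod (F (x t)) / (2 * L)).
  { intros t Ht. specialize (Hpos t Ht). apply Rmult_lt_compat_l; [exact Hpos|].
    apply Rinv_lt_contravar; nra. }
  (* On the segment [1 / F] differs from [1 / F (x t)] by at most a third of the latter. *)
  assert (C1 : forall t, 0 <= t -> Cmod (q t) <= / (4 * L) -> Cmod (Ga t - q t)%C <= Cmod (q t) / 3).
  { intros t Ht Hqt. destruct (Hx t Ht) as (_ & HxK & Hx0). specialize (Hpos t Ht).
    replace (Ga t - q t)%C with (seg_int (fun z => / F z)%C (x t) (y t) -
      (/ F (x t) * (y t - x t) + 0 / 2 * ((y t - x t) * (y t - x t) - (x t - x t) * (x t - x t))))%C.
    2:{ unfold Ga, q. field. exact Hx0. }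
    eapply Rle_trans; [apply seg_int_affine_approx with (M := / (3 * Cmod (F (x t))))|].
    - intros s Hs. destruct (Hdinv (seg (x t) (y t) s)) as [l Hl]; [|apply (der_cont _ _ _ _ Hl)].
      apply (Hdisc (x t)); auto. eapply Rle_lt_trans; [apply Hin; auto | apply H42, Ht].
    - intros s Hs. set (z := seg (x t) (y t) s).
      assert (Hz := Hin t s Ht Hqt Hs). fold z in Hz.
      destruct (Hdisc (x t) z HxK Hx0) as [D1 D2]; [specialize (H42 t Ht); lra|].
      assert (D3 : Cmod (F z - F (x t))%C <= Cmod (F (x t)) / 4).
      { eapply Rle_trans; [exact D1|]. apply (Rmult_le_compat_l L) in Hz; [|lra].
        eapply Rle_trans; [exact Hz|]. right. field. lra. }
      assert (D4 : 3 / 4 * Cmod (F (x t)) <= Cmod (F z)).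
      { pose proof (Cmod_le_add (F (x t)) (F z)). rewrite (Cmod_sub_sym (F (x t))) in H. lra. }
      replace (/ F z - (/ F (x t) + 0 * (z - x t)))%C with (- (F z - F (x t)) * / (F z * F (x t)))%C
        by (field; auto).
      rewrite Cmod_mult, Cmod_opp, Cmod_inv, Cmod_mult by (apply Cmult_neq_0; auto).
      apply Rmult_le_reg_r with (Cmod (F z) * Cmod (F (x t))); [nra|].
      rewrite Rmult_assoc, Rinv_l by nra.
      replace (/ (3 * Cmod (F (x t))) * (Cmod (F z) * Cmod (F (x t)))) with (Cmod (F z) / 3) by (field; lra).
      lra.
    - rewrite Hq by exact Ht. right. field. lra. }
  (* Near each time the integral is a difference of values of one primitive of [1 / F]. *)
  assert (C2 : forall t, 0 <= t -> Cmod (q t) <= / (4 * L) -> rder Ga t 0).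
  { intros t Ht Hqt. destruct (Hx t Ht) as (Hxd & HxK & Hx0). assert (Hyd := Hy t Ht).
    set (rho := Cmod (F (x t)) / (2 * L)).
    destruct (primitive_on_disc (fun z => / F z)%C (x t) rho) as [P HP].
    { intros z Hz. apply Hdinv. apply (Hdisc (x t)); auto. }
    assert (Hyin : Cmod (y t - x t)%C < rho).
    { eapply Rle_lt_trans; [apply Hnear; auto | apply H42, Ht]. }
    assert (Hrho : 0 < rho) by (pose proof (Cmod_ge_0 (y t - x t)%C); lra).
    destruct (der_cont_Cmod x t _ Hxd rho Hrho) as [d1 [Hd1 N1]].
    destruct (der_cont_Cmod y t _ Hyd (rho - Cmod (y t - x t)%C)) as [d2 [Hd2 N2]]; [lra|].
    assert (Hy0 : F (y t) <> 0) by (apply (Hdisc (x t)); auto).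
    apply (der_ext _ (fun s => P (y s) - P (x s))%C Ga t
      (/ F (y t) * F (y t) - / F (x t) * F (x t))%C _ (Rmin d1 d2)).
    - apply Rmin_pos; assumption.
    - intros s Hs. rewrite Cmod_RtoC_sub in Hs.
      specialize (N1 s (Rlt_le_trans _ _ _ Hs (Rmin_l _ _))).
      specialize (N2 s (Rlt_le_trans _ _ _ Hs (Rmin_r _ _))).
      assert (N3 : Cmod (y s - x t)%C < rho) by (pose proof (Cmod_sub_triangle (y s) (y t) (x t)); lra).
      assert (N4 : forall u, 0 <= u <= 1 -> Cmod (seg (x s) (y s) u - x t)%C < rho).
      { intros u Hu. apply Rle_lt_trans with (Rmax (Cmod (x s - x t)%C) (Cmod (y s - x t)%C)).
        - apply seg_disc; [apply Rmax_l | apply Rmax_r | exact Hu].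
        - apply Rmax_lub_lt; assumption. }
      symmetry. apply seg_int_primitive.
      + intros u Hu. destruct (Hdinv (seg (x s) (y s) u)) as [l Hl].
        * apply (Hdisc (x t)); [exact HxK | exact Hx0 | apply N4, Hu].
        * apply (der_cont _ _ _ _ Hl).
      + intros u Hu. apply HP, N4, Hu.
    - field. split; [exact Hx0 | exact Hy0].
    - apply der_minus.
      + apply (der_comp _ P y); [apply HP, Hyin | exact Hyd].
      + apply (der_comp _ P x); [apply HP; rewrite Cmod_sub_self; exact Hrho | exact Hxd]. }
  assert (Hq0 : Cmod (q 0) <= / (16 * L)).
  { specialize (Hpos 0 (Rle_refl 0)). apply Rmult_le_reg_r with (Cmod (F (x 0))); [exact Hpos|].
    rewrite <- Hq by lra. eapply Rle_trans; [exact Hinit|]. right. field. lra. }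
  assert (H164 : / (16 * L) <= / (4 * L)) by (apply Rinv_le_contravar; lra).
  assert (C3 : forall t, 0 <= t -> (forall s, 0 <= s <= t -> Cmod (q s) <= / (4 * L)) ->
    Cmod (q t) <= 2 * Cmod (q 0)).
  { intros t Ht Hs.
    assert (E : Ga t = Ga 0).
    { apply rder_zero_const; [exact Ht|]. intros s Hst. apply C2; [lra | apply Hs, Hst]. }
    assert (A := C1 t Ht (Hs t ltac:(lra))). assert (B := C1 0 (Rle_refl 0) (Hs 0 ltac:(lra))).
    rewrite E in A. rewrite Cmod_sub_sym in A.
    pose proof (Cmod_le_add (q t) (Ga 0)). pose proof (Cmod_le_add (Ga 0) (q 0)). lra. }
  assert (Hder : forall t, 0 <= t -> exists v, rder q t v).
  { intros t Ht. destruct (Hx t Ht) as (Hxd & _ & Hx0). destruct (HF (x t)) as [l Hl].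
    eexists. apply (der_mult _ (fun t => y t - x t)%C (fun t => / F (x t))%C).
    - apply der_minus; [apply Hy, Ht | exact Hxd].
    - apply (der_inv _ (fun t => F (x t)) t); [exact Hx0|]. apply (der_comp _ F x); eassumption. }
  assert (Hall : forall t, 0 <= t -> Cmod (q t) < / (4 * L)).
  { apply (bootstrap (fun t => Cmod (q t))).
    - intros t Ht e He. destruct (Hder t Ht) as [v Hv].
      destruct (der_cont_Cmod q t v Hv e He) as [d [Hd Hs]]. exists d. split; [exact Hd|].
      intros s Hsd. eapply Rle_lt_trans; [|apply Hs, Hsd].
      apply Rabs_le. pose proof (Cmod_le_add (q s) (q t)). pose proof (Cmod_le_add (q t) (q s)).
      rewrite (Cmod_sub_sym (q t)) in H0. lra.
    - lra.
    - intros t Ht Hs. specialize (C3 t Ht Hs).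
      assert (/ (16 * L) * 2 < / (4 * L)); [|lra].
      replace (/ (16 * L)) with (/ (4 * L) * / 4) by (field; lra).
      assert (0 < / (4 * L)) by (apply Rinv_0_lt_compat; lra). lra. }
  intros t Ht.
  assert (Hf := C3 t Ht ltac:(intros s Hs; left; apply Hall; lra)).
  rewrite (Hq t Ht), (Hq 0 (Rle_refl 0)).
  pose proof (Hpos t Ht). pose proof (Hpos 0 (Rle_refl 0)).
  replace (2 * (Cmod (q 0) * Cmod (F (x 0))) * Cmod (F (x t))) with
    (2 * Cmod (q 0) * (Cmod (F (x t)) * Cmod (F (x 0)))) by ring.
  rewrite Rmult_assoc. apply Rmult_le_compat_r; [nra | exact Hf].
Qed.

(** A point of the basin close to a boundary point [x] would drag along the
    whole bounded forward orbit of [x] into a neighbourhood of [a]. *)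
Theorem boundary_forward_unbounded a x K : attracting F a -> boundary (fun z => conv F z a) x ->
  F x <> 0 -> exists t v, 0 <= t /\ reach x t v /\ K < Cmod v.
Proof.
  intros Ha Hb Hx0. apply NNPP. intro Hn.
  assert (HKx : forall t v, 0 <= t -> reach x t v -> Cmod v <= K).
  { intros t v Ht Hv. apply Rnot_lt_le. intro. apply Hn. exists t, v. auto. }
  assert (HK : 0 <= K).
  { eapply Rle_trans; [apply Cmod_ge_0 | apply (HKx 0 x (Rle_refl 0)), reach_0, HF]. }
  assert (Hdom := forward_bounded_complete F HF x K HKx).
  assert (Hxt : forall t, 0 <= t -> reach x t (flow_map F x t)).
  { intros t Ht. apply flow_map_reach, Hdom, Ht. }
  destruct (shadowing K HK) as [L [HL Hsh]].
  destruct (holo_bounded F K HF) as [M [HM HB]].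
  pose proof (proj1 (attracting_conv F HF a) Ha) as [r [Hr Har]].
  apply (boundary_not_open _ x (conv_open a Ha) Hb).
  assert (Hx1 := proj1 (Cmod_gt_0 (F x)) Hx0).
  set (d := Rmin (Cmod (F x) / (16 * L)) (r * Cmod (F x) / (4 * (M + 1)))).
  assert (Hd : 0 < d) by (apply Rmin_pos; apply Rdiv_lt_0_compat; nra).
  destruct (Hb d Hd) as [[y [Hyx Hy]] _]. unfold disc in Hyx.
  assert (Hyt : forall t, 0 <= t -> dom F y t) by (intros t Ht; apply (conv_dom F HF y a); auto).
  assert (Hx00 : flow_map F x 0 = x) by (apply flow_map_eq, reach_0; exact HF).
  assert (Hy00 : flow_map F y 0 = y) by (apply flow_map_eq, reach_0; exact HF).
  assert (S : forall t, 0 <= t -> Cmod (flow_map F y t - flow_map F x t)%C < r / 2).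
  { intros t Ht.
    assert (A : Cmod (flow_map F y t - flow_map F x t)%C * Cmod (F x) <=
      2 * Cmod (y - x)%C * Cmod (F (flow_map F x t))).
    { assert (A := Hsh (flow_map F x) (flow_map F y)). rewrite Hx00, Hy00 in A. apply A; [| | |exact Ht].
      - intros s Hs. split; [apply flow_map_der, Hdom, Hs|]. split; [apply (HKx s); auto|].
        apply (reach_nonequilibrium x s); auto.
      - intros s Hs. apply flow_map_der, Hyt, Hs.
      - eapply Rle_trans; [left; exact Hyx | apply Rmin_l]. }
    assert (B : Cmod (F (flow_map F x t)) <= M) by (apply HB, (HKx t); auto).
    assert (E : Cmod (y - x)%C * (4 * (M + 1)) <= r * Cmod (F x)).
    { apply Rmult_le_reg_r with (/ (4 * (M + 1))); [apply Rinv_0_lt_compat; lra|].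
      rewrite Rmult_assoc, Rinv_r, Rmult_1_r by lra. left.
      eapply Rlt_le_trans; [exact Hyx | apply Rmin_r]. }
    pose proof (Cmod_ge_0 (y - x)%C).
    destruct (Rle_lt_or_eq_dec 0 _ (Cmod_ge_0 (y - x)%C)) as [Hp|Hp].
    - apply Rmult_lt_reg_r with (Cmod (F x)); [exact Hx1|]. nra.
    - rewrite <- Hp in A. pose proof (Cmod_ge_0 (flow_map F y t - flow_map F x t)%C). nra. }
  destruct (Hy (r / 2)) as [T HT]; [lra|]. destruct (HT (Rmax 0 T)) as [v [Hv Hva]]; [apply Rmax_r|].
  specialize (S (Rmax 0 T) (Rmax_l 0 T)). rewrite (flow_map_eq F HF y _ v Hv) in S.
  apply (conv_shift F HF x (Rmax 0 T) (flow_map F x (Rmax 0 T))); [apply Hxt, Rmax_l|].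
  apply Har. pose proof (Cmod_sub_triangle (flow_map F x (Rmax 0 T)) v a) as A.
  rewrite (Cmod_sub_sym _ v) in A. lra.
Qed.

End Basin.

(** * Simple zeros *)

Lemma cder_sub_const (b z : C) : cder (fun z => z - b)%C z 1.
Proof. apply der_eq with (1 - 0)%C; [ring|]. apply der_minus; [apply der_coord | apply der_const]. Qed.

Lemma holo_neq_0_near g b : holo g -> g b <> 0 ->
  exists d, 0 < d /\ forall z, Cmod (z - b)%C < d -> g z <> 0.
Proof.
  intros Hg Hb. destruct (Hg b) as [l Hl]. apply Cmod_gt_0 in Hb.
  destruct (der_cont _ _ _ _ Hl (Cmod (g b)) Hb) as [d [Hd H]]. exists d. split; [exact Hd|].
  intros z Hz E. specialize (H z Hz). rewrite E, Cmod_sub_sym, Cminus_0_r in H. lra.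
Qed.

Lemma isolated_zero F b : holo F -> (exists z, F z <> 0) ->
  exists d, 0 < d /\ forall z, z <> b -> Cmod (z - b)%C < d -> F z <> 0.
Proof.
  intros HF Hne. destruct (finite_order F b HF Hne) as (m & g & Hg & Hgb & E).
  destruct (holo_neq_0_near g b Hg Hgb) as [d [Hd H]]. exists d. split; [exact Hd|].
  intros z Hz Hzd. rewrite E. apply Cmult_neq_0; [|apply H, Hzd].
  apply Cpow_nz, sub_neq_0, Hz.
Qed.

(** A linearizing coordinate.  Writing [F = (z - b) G] and
    [G = mu + (z - b) G2], the function [mu / F - 1 / (z - b) = - G2 / G] is
    holomorphic near [b]; with [Q] a primitive of it, [H = (z - b) exp Q]
    satisfies [H' F = mu H]. *)
Lemma linearization F b mu : holo F -> F b = 0 -> cder F b mu -> mu <> 0 ->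
  exists d H, 0 < d /\
    (forall z, Cmod (z - b)%C < d -> exists l, cder H z l /\ (l * F z = mu * H z)%C) /\
    (forall z, Cmod (z - b)%C < d ->
      Cmod (z - b)%C <= 2 * Cmod (H z) /\ Cmod (H z) <= 2 * Cmod (z - b)%C).
Proof.
  intros HF Hb Hmu Hmu0. destruct (holo_factor F b HF Hb) as (G & HG & EG & DG).
  assert (HGb : G b = mu) by apply (cder_unique F b _ _ DG Hmu).
  assert (HG' : holo (fun z => G z - mu)%C).
  { intro z. destruct (HG z) as [l Hl]. eexists. apply (der_minus _ G); [exact Hl | apply der_const]. }
  destruct (holo_factor _ b HG') as (G2 & HG2 & EG2 & _); [rewrite HGb; ring|]. cbv beta in EG2.
  destruct (holo_neq_0_near G b HG) as [d0 [Hd0 HG0]]; [rewrite HGb; exact Hmu0|].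
  destruct (primitive_on_disc (fun z => - G2 z * / G z)%C b d0) as [P HP].
  { intros z Hz. destruct (HG z) as [l Hl], (HG2 z) as [l2 Hl2]. eexists.
    apply (der_mult _ (fun z => - G2 z)%C (fun z => / G z)%C); [apply der_opp, Hl2|].
    apply (der_inv _ G z l (HG0 z Hz) Hl). }
  assert (Hbb : Cmod (b - b)%C < d0) by (rewrite Cmod_sub_self; exact Hd0).
  assert (Hln : 0 < ln 2) by (rewrite <- ln_1; apply ln_increasing; lra).
  destruct (der_cont _ _ _ _ (HP b Hbb) (ln 2) Hln) as [d1 [Hd1 HP1]].
  set (Q := fun z => (P z - P b)%C).
  exists (Rmin d0 d1), (fun z => (z - b) * Cexp (Q z))%C.
  split; [apply Rmin_pos; assumption|]. split.
  - intros z Hz. assert (Hz0 := Rlt_le_trans _ _ _ Hz (Rmin_l _ _)). eexists. split.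
    + apply (der_mult _ (fun z => z - b)%C (fun z => Cexp (Q z))); [apply cder_sub_const|].
      apply (der_comp _ Cexp Q); [apply cder_Cexp|].
      apply (der_minus _ P); [apply HP, Hz0 | apply der_const].
    + rewrite EG. specialize (EG2 z).
      replace mu with (G z - (z - b) * G2 z)%C by (rewrite <- EG2; ring).
      field. apply HG0, Hz0.
  - intros z Hz. assert (Hz1 := HP1 z (Rlt_le_trans _ _ _ Hz (Rmin_r _ _))).
    rewrite Cmod_mult, Cmod_Cexp.
    assert (A := Rle_lt_trans _ _ _ (re_le_Cmod (Q z)) Hz1). apply Rabs_def2 in A. destruct A as [A1 A2].
    assert (B1 : exp (Re (Q z)) < 2) by (rewrite <- (exp_ln 2) by lra; apply exp_increasing, A1).
    assert (B2 : / 2 < exp (Re (Q z))).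
    { rewrite <- (exp_ln 2) by lra. rewrite <- exp_Ropp. apply exp_increasing, A2. }
    pose proof (Cmod_ge_0 (z - b)%C). split; nra.
Qed.

(** In the linearizing coordinate the solution is multiplied by [exp (mu t)]. *)
Lemma stable_zero F b mu : holo F -> F b = 0 -> cder F b mu -> mu <> 0 -> Re mu <= 0 ->
  forall eps, 0 < eps -> exists d, 0 < d /\ forall x, Cmod (x - b)%C < d ->
    forall t, 0 <= t -> exists v, reach F x t v /\ Cmod (v - b)%C < eps /\
      Cmod (v - b)%C <= 4 * Cmod (x - b)%C * exp (Re mu * t).
Proof.
  intros HF Hb Hmu Hmu0 Hre eps Heps.
  destruct (linearization F b mu HF Hb Hmu Hmu0) as (d0 & H & Hd0 & HD & HB).
  set (A := Rmin eps d0 / 2). assert (Hmin : 0 < Rmin eps d0) by (apply Rmin_pos; assumption).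
  assert (HAe : A < eps) by (pose proof (Rmin_l eps d0); unfold A; lra).
  assert (HAd : A < d0) by (pose proof (Rmin_r eps d0); unfold A; lra).
  assert (HA : 0 < A) by (unfold A; lra).
  exists (A / 8). split; [lra|]. intros x Hx.
  assert (Hexp1 : forall t, 0 <= t -> exp (Re mu * t) <= 1).
  { intros t Ht. rewrite <- exp_0. destruct (Req_dec (Re mu * t) 0) as [->|]; [lra|].
    left. apply exp_increasing. nra. }
  assert (Hest : forall phi t, phi 0 = x -> 0 <= t -> solves F phi 0 t ->
    (forall s, 0 <= s <= t -> Cmod (phi s - b)%C <= A) ->
    Cmod (phi t - b)%C <= 4 * Cmod (x - b)%C * exp (Re mu * t)).
  { intros phi t P0 Ht P Hs.
    set (k := fun s : R => (H (phi s) * Cexp (0 + - mu * s))%C).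
    assert (Hk : k t = k 0).
    { apply rder_zero_const; [exact Ht|]. intros s Hst.
      destruct (HD (phi s)) as [l [Hl E]]; [specialize (Hs s Hst); lra|].
      apply der_eq with (l * F (phi s) * Cexp (0 + - mu * s) + H (phi s) * (Cexp (0 + - mu * s) * - mu))%C.
      - rewrite E. ring.
      - apply (der_mult RtoC (fun s => H (phi s)) (fun s : R => Cexp (0 + - mu * s))).
        + apply (der_comp _ H phi); [exact Hl | apply P, Hst].
        + apply (der_comp _ Cexp (fun s : R => (0 + - mu * s)%C)); [apply cder_Cexp | apply der_affine]. }
    unfold k in Hk. replace (0 + - mu * 0%R)%C with (RtoC 0) in Hk by ring.
    rewrite Cexp_0, Cmult_1_r, P0 in Hk.
    assert (E : Cmod (H (phi t)) = Cmod (H x) * exp (Re mu * t)).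
    { rewrite <- Hk, Cmod_mult, Cmod_Cexp.
      replace (Re (0 + - mu * t)%C) with (- (Re mu * t)) by (destruct mu; simpl; ring).
      rewrite Rmult_assoc, <- exp_plus, Rplus_opp_l, exp_0. ring. }
    destruct (HB (phi t)) as [B1 _]; [specialize (Hs t ltac:(lra)); lra|].
    destruct (HB x) as [_ B2]; [lra|].
    pose proof (exp_pos (Re mu * t)). rewrite E in B1. nra. }
  destruct (apriori F HF x b A) as [phi [P0 P]].
  - lra.
  - intros phi t P0 Ht P Hs. specialize (Hest phi t P0 Ht P Hs). specialize (Hexp1 t Ht).
    pose proof (Cmod_ge_0 (x - b)%C). pose proof (exp_pos (Re mu * t)). nra.
  - intros t Ht. exists (phi t). split; [|split].
    + apply solves_reach; auto. intros s Hs. apply P. lra.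
    + destruct (P t Ht). lra.
    + apply Hest; auto; intros s Hs; [apply P | left; apply P]; lra.
Qed.

Lemma stable_attracting F b mu : holo F -> F b = 0 -> cder F b mu -> Re mu < 0 -> attracting F b.
Proof.
  intros HF Hb Hmu Hre. assert (Hmu0 : mu <> 0).
  { intros ->. simpl in Hre. lra. }
  apply attracting_conv; [exact HF|].
  destruct (stable_zero F b mu HF Hb Hmu Hmu0 ltac:(lra) 1 Rlt_0_1) as [d [Hd H]].
  exists d. split; [exact Hd|]. intros x Hx eps Heps.
  set (T := / (- Re mu) * (4 * Cmod (x - b)%C / eps)). exists (Rmax 0 T). intros t Ht.
  assert (Ht0 : 0 <= t) by (pose proof (Rmax_l 0 T); lra).
  assert (HtT : T <= t) by (pose proof (Rmax_r 0 T); lra).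
  destruct (H x Hx t Ht0) as (v & Hv & _ & Hle). exists v. split; [exact Hv|].
  eapply Rle_lt_trans; [exact Hle|].
  (* The decay follows from [u < exp u] alone. *)
  set (u := - Re mu * t).
  assert (Hu : 4 * Cmod (x - b)%C / eps <= u).
  { unfold u. apply Rmult_le_reg_l with (/ - Re mu); [apply Rinv_0_lt_compat; lra|].
    rewrite <- Rmult_assoc, Rinv_l by lra. fold T. lra. }
  assert (Hexp : u < exp u) by (pose proof (exp_ineq1_le u); lra).
  replace (Re mu * t) with (- u) by (unfold u; ring). rewrite exp_Ropp.
  assert (Hpu := exp_pos u). apply Rmult_lt_reg_r with (exp u); [exact Hpu|].
  rewrite Rmult_assoc, Rinv_l, Rmult_1_r by lra.
  apply Rle_lt_trans with (eps * u); [|nra].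
  apply Rmult_le_reg_r with (/ eps); [apply Rinv_0_lt_compat, Heps|].
  replace (eps * u * / eps) with u by (field; lra). exact Hu.
Qed.

Lemma neg_cder F G z l : (forall z, G z = (- F z)%C) -> cder F z l -> cder G z (- l)%C.
Proof.
  intros HFG Hl. apply (der_ext _ (fun w => - F w)%C G z (- l)%C _ 1); [lra| |reflexivity | apply der_opp, Hl].
  intros w _. symmetry. apply HFG.
Qed.

(** If [Re mu >= 0] the zero is stable in backward time, so an orbit that comes
    very close to it must have started very close to it. *)
Lemma attracting_Re_neg F b mu : holo F -> F b = 0 -> cder F b mu -> mu <> 0 -> attracting F b -> Re mu < 0.
Proof.
  intros HF Hb Hmu Hmu0 Hat. apply Rnot_le_lt. intro Hre.
  set (G := fun z => (- F z)%C).
  assert (HFG : forall z, G z = (- F z)%C) by reflexivity.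
  assert (HG := neg_holo F G HFG HF).
  destruct (stable_zero G b (- mu)%C HG) with (eps := 1) as [d [Hd H]].
  - unfold G. rewrite Hb. ring.
  - apply (neg_cder F G); assumption.
  - intro E. apply Hmu0. replace mu with (- - mu)%C by ring. rewrite E. ring.
  - rewrite re_opp. lra.
  - lra.
  - apply (attracting_conv F HF) in Hat. destruct Hat as [r [Hr Hat]].
    set (x := (b + RtoC (r / 2))%C).
    assert (Hxb : Cmod (x - b)%C = r / 2).
    { unfold x. replace (b + RtoC (r / 2) - b)%C with (RtoC (r / 2)) by ring.
      rewrite Cmod_R, Rabs_pos_eq; lra. }
    specialize (Hat x ltac:(lra)).
    destruct (Hat (Rmin d (r / 16))) as [T HT]; [apply Rmin_pos; lra|].
    destruct (HT (Rmax 0 T) (Rmax_r 0 T)) as [v [Hv Hvb]].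
    pose proof (Rmin_l d (r / 16)). pose proof (Rmin_r d (r / 16)).
    destruct (H v ltac:(lra) (Rmax 0 T) (Rmax_l 0 T)) as (w & Hw & _ & Hle).
    assert (w = x).
    { apply (reach_unique G HG v (Rmax 0 T)); [exact Hw|].
      apply reach_sym in Hv. apply (reach_neg F G _ _ _ HFG) in Hv. rewrite Ropp_involutive in Hv. exact Hv. }
    subst w. rewrite Hxb in Hle.
    assert (exp (Re (- mu)%C * Rmax 0 T) <= 1).
    { rewrite re_opp. rewrite <- exp_0. pose proof (Rmax_l 0 T).
      destruct (Req_dec (- Re mu * Rmax 0 T) 0) as [->|]; [lra|]. left. apply exp_increasing. nra. }
    pose proof (exp_pos (Re (- mu)%C * Rmax 0 T)). pose proof (Cmod_ge_0 (v - b)%C). nra.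
Qed.

Lemma stays_not_conv F a b eps x : holo F -> 2 * eps <= Cmod (a - b)%C -> 
  (forall t, 0 <= t -> exists v, reach F x t v /\ Cmod (v - b)%C < eps) -> ~ conv F x a.
Proof.
  intros HF Hab H Hc. destruct (H 0 (Rle_refl 0)) as [w [_ Hw]].
  pose proof (Cmod_ge_0 (w - b)%C).
  destruct (Hc eps) as [T HT]; [lra|].
  destruct (HT (Rmax 0 T) (Rmax_r 0 T)) as [v [Hv Hva]].
  destruct (H (Rmax 0 T) (Rmax_l 0 T)) as [v' [Hv' Hvb]].
  rewrite (reach_unique F HF _ _ _ _ Hv' Hv) in Hvb.
  pose proof (Cmod_sub_triangle a v b). rewrite (Cmod_sub_sym a v) in H1. lra.
Qed.

(** * Repelling zeros on the boundary *)

Lemma seg_cont_at p q s : cont_at RtoC (seg p q) s.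
Proof. apply (der_cont _ _ _ _ (rder_seg p q s)). Qed.

Lemma seg_0 p q : seg p q 0 = p.
Proof. unfold seg. ring. Qed.

Lemma seg_1 p q : seg p q 1 = q.
Proof. unfold seg. ring. Qed.

Lemma boundary_on_segment N p q : N p -> ~ N q -> exists s, 0 <= s <= 1 /\ boundary N (seg p q s).
Proof.
  intros Hp Hq. apply boundary_on_path.
  - intros s _. apply seg_cont_at.
  - rewrite seg_0. exact Hp.
  - rewrite seg_1. exact Hq.
Qed.

Lemma seg_disc_lt p q s c r : Cmod (p - c)%C < r -> Cmod (q - c)%C < r -> 0 <= s <= 1 ->
  Cmod (seg p q s - c)%C < r.
Proof.
  intros Hp Hq Hs. apply Rle_lt_trans with (Rmax (Cmod (p - c)%C) (Cmod (q - c)%C)).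
  - apply seg_disc; [apply Rmax_l | apply Rmax_r | exact Hs].
  - apply Rmax_lub_lt; assumption.
Qed.

(** A punctured disc is connected. *)
Lemma punctured_boundary N b d y z :
  y <> b -> z <> b -> Cmod (y - b)%C < d -> Cmod (z - b)%C < d -> N y -> ~ N z ->
  exists x, x <> b /\ Cmod (x - b)%C < d /\ boundary N x.
Proof.
  intros Hy Hz Hyd Hzd HNy HNz.
  destruct (classic (exists s, 0 <= s <= 1 /\ seg y z s = b)) as [[s [Hs E]]|Hno].
  2:{ destruct (boundary_on_segment N y z HNy HNz) as [s [Hs Hb]]. exists (seg y z s).
      split; [|split; [apply seg_disc_lt; auto | exact Hb]]. intro E. apply Hno. exists s. auto. }
  (* The segment meets [b]: go around through the quarter turn [p] of [y]. *)
  assert (E1 : ((1 - s)%R * (y - b) + s * (z - b))%C = 0).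
  { replace ((1 - s)%R * (y - b) + s * (z - b))%C with (seg y z s - b)%C
      by (unfold seg; rewrite RtoC_minus; ring).
    rewrite E. ring. }
  assert (Hyb := sub_neq_0 y b Hy). assert (Hzb := sub_neq_0 z b Hz).
  assert (Hs0 : s <> 0).
  { intros ->. apply Hyb. rewrite <- E1. rewrite RtoC_minus. ring. }
  assert (Hs1 : s <> 1).
  { intros ->. apply Hzb. rewrite <- E1. rewrite RtoC_minus. ring. }
  set (p := (b + Ci * (y - b))%C).
  assert (Hpd : Cmod (p - b)%C < d).
  { unfold p. replace (b + Ci * (y - b) - b)%C with (Ci * (y - b))%C by ring.
    rewrite Cmod_mult, Cmod_Ci, Rmult_1_l. exact Hyd. }
  assert (Hcomb : forall u v : R, ((u + v * Ci) * (y - b))%C = 0 -> u = 0 /\ v = 0).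
  { intros u v Huv.
    assert (Huv' : (u + v * Ci)%C = 0).
    { apply NNPP. intro Hn. apply (Cmult_neq_0 _ _ Hn Hyb). exact Huv. }
    injection Huv' as U V. simpl in U, V. lra. }
  destruct (classic (N p)) as [HNp|HNp].
  - destruct (boundary_on_segment N p z HNp HNz) as [u [Hu Hb]]. exists (seg p z u).
    split; [|split; [apply seg_disc_lt; auto | exact Hb]]. intro E2.
    destruct (Hcomb (- (u * (1 - s))) (s * (1 - u))) as [U V].
    { assert (E3 : (s * (seg p z u - b))%C = 0) by (rewrite E2; ring).
      rewrite <- E3. unfold seg, p.
      replace (s * (b + Ci * (y - b) + (z - (b + Ci * (y - b))) * u - b))%C with
        (s * (1 - u) * Ci * (y - b) + u * (s * (z - b)))%C by ring.
      replace (s * (z - b))%C with (- ((1 - s)%R * (y - b)))%C.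
      - rewrite RtoC_opp, !RtoC_mult, !RtoC_minus. ring.
      - replace (s * (z - b))%C with ((1 - s)%R * (y - b) + s * (z - b) - (1 - s)%R * (y - b))%C by ring.
        rewrite E1. ring. }
    apply Rmult_integral in V. destruct V as [V|V]; [contradiction|].
    assert (u = 1) by lra. subst u. lra.
  - destruct (boundary_on_segment N y p HNy HNp) as [u [Hu Hb]]. exists (seg y p u).
    split; [|split; [apply seg_disc_lt; auto | exact Hb]]. intro E2.
    destruct (Hcomb (1 - u) u) as [U V]; [|lra].
    assert (E3 : (seg y p u - b)%C = 0) by (rewrite E2; ring).
    rewrite <- E3. unfold seg, p. rewrite RtoC_minus. ring.
Qed.

Section BoundedBasin.
Variable F : C -> C.
Hypothesis HF : holo F.

(** Orbits near that of [x] follow it, up to a time at which they are so close to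
    [a] that stability takes over. *)
Lemma basin_locally_bounded a mu x : F a = 0 -> cder F a mu -> Re mu < 0 -> conv F x a ->
  exists d K, 0 < d /\ forall y, Cmod (y - x)%C < d ->
    forall t v, 0 <= t -> reach F y t v -> Cmod v <= K.
Proof.
  intros Ha Hmu Hre Hx. assert (Hmu0 : mu <> 0) by (intros ->; simpl in Hre; lra).
  destruct (stable_zero F a mu HF Ha Hmu Hmu0 ltac:(lra) 1 Rlt_0_1) as [r [Hr Hst]].
  destruct (Hx (r / 2)) as [T0 HT]; [lra|]. set (T := Rmax 0 T0).
  destruct (HT T (Rmax_r 0 T0)) as [w [Hw Hwa]]. assert (HT0 : 0 <= T) by apply Rmax_l.
  destruct (reach_continuous F HF x T w Hw) as [K HK].
  destruct (HK (r / 2)) as [d [Hd H]]; [lra|]. exists d, (Rmax K (Cmod a + 1)). split; [exact Hd|].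
  intros y Hy t v Ht Hv. destruct (H y Hy) as [[w' [Hw' Hww]] Hbd].
  destruct (Rle_dec t T) as [HtT|HtT].
  - eapply Rle_trans; [apply (Hbd t v); [|exact Hv] | apply Rmax_l].
    rewrite Rmin_left, Rmax_right; lra.
  - assert (Hw'a : Cmod (w' - a)%C < r) by (pose proof (Cmod_sub_triangle w' w a); lra).
    destruct (Hst w' Hw'a (t - T) ltac:(lra)) as (v' & Hv' & Hva & _).
    assert (v = v').
    { apply (reach_unique F HF y t); [exact Hv|]. replace t with (T + (t - T)) by ring.
      apply reach_trans with w'; assumption. }
    subst v'. pose proof (Cmod_le_add v a). eapply Rle_trans; [|apply Rmax_r]. lra.
Qed.

Variable G : C -> C.
Hypothesis HFG : forall z, G z = (- F z)%C.

Let HG : holo G := neg_holo F G HFG HF.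

(** If the basin of [a] contains a punctured neighbourhood of a repelling zero
    [b], then every orbit that comes from [b] crosses a fixed circle around [b],
    and from this compact subset of the basin only a bounded set is reached. *)
Lemma backward_basin_bounded a b mu d : F a = 0 -> cder F a mu -> Re mu < 0 -> 0 < d ->
  (forall z, z <> b -> Cmod (z - b)%C < d -> conv F z a) ->
  exists K, forall x, conv G x b -> Cmod x <= K.
Proof.
  intros Ha Hmu Hre Hd HN. set (rho := d / 2).
  destruct (locally_bounded_bounded
    (fun K w => Cmod (w - b)%C = rho -> forall t v, 0 <= t -> reach F w t v -> Cmod v <= K)
    (Cmod b + rho)) as [K HK].
  - intros K K' w HKK H Hw t v Ht Hv. specialize (H Hw t v Ht Hv). lra.
  - intro z. destruct (Req_dec (Cmod (z - b)%C) rho) as [E|E].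
    + destruct (basin_locally_bounded a mu z Ha Hmu Hre) as (e & K & He & H).
      * apply HN; [|rewrite E; unfold rho; lra]. intros ->. rewrite Cmod_sub_self in E. unfold rho in E. lra.
      * exists e, K. split; [exact He|]. intros w Hw _ t v Ht Hv. apply (H w Hw t v Ht Hv).
    + exists (Rabs (Cmod (z - b)%C - rho)), 0. split; [apply Rabs_pos_lt; lra|].
      intros w Hw Ew. exfalso. rewrite <- Ew in Hw.
      pose proof (Rabs_Cmod_sub z w b). rewrite (Cmod_sub_sym z w) in H. lra.
  - exists (Rmax K (Cmod b + rho)). intros x Hx.
    destruct (Rle_dec (Cmod (x - b)%C) rho) as [Hxr|Hxr].
    { pose proof (Cmod_le_add x b). eapply Rle_trans; [|apply Rmax_r]. lra. }
    assert (Hcross : exists t, 0 <= t /\ Cmod (flow_map G x t - b)%C = rho).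
    { apply NNPP. intro Hn.
      assert (Hfar : forall t, 0 <= t -> - Cmod (flow_map G x t - b)%C < - rho).
      { apply (bootstrap (fun t => - Cmod (flow_map G x t - b)%C)).
        - intros t Ht e He.
          assert (Hdt : rder (flow_map G x) t (G (flow_map G x t))).
          { apply (flow_map_der G HG). apply (conv_dom G HG x b); assumption. }
          destruct (der_cont_Cmod _ t _ Hdt e He) as [d1 [Hd1 Hs]].
          exists d1. split; [exact Hd1|]. intros s Hsd. specialize (Hs s Hsd).
          pose proof (Rabs_Cmod_sub (flow_map G x s) (flow_map G x t) b).
          rewrite <- Rabs_Ropp. eapply Rle_lt_trans; [|exact Hs]. eapply Rle_trans; [|exact H].
          right. f_equal. ring.
        - rewrite (flow_map_eq G HG x 0 x (reach_0 G HG x)). lra.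
        - intros t Ht Hs. specialize (Hs t ltac:(lra)).
          destruct (Req_dec (Cmod (flow_map G x t - b)%C) rho); [|lra].
          exfalso. apply Hn. exists t. auto. }
      destruct (Hx rho) as [T HT]; [unfold rho; lra|].
      destruct (HT (Rmax 0 T) (Rmax_r 0 T)) as [v [Hv Hvb]].
      specialize (Hfar (Rmax 0 T) (Rmax_l 0 T)). rewrite (flow_map_eq G HG x _ v Hv) in Hfar. lra. }
    destruct Hcross as [t [Ht Hc]]. set (w := flow_map G x t) in *.
    assert (Hw : reach F w t x).
    { rewrite <- (Ropp_involutive t). apply reach_sym. apply (reach_neg G F); [apply neg_sym, HFG|].
      apply flow_map_reach, (conv_dom G HG x b); assumption. }
    eapply Rle_trans; [|apply Rmax_l]. apply (HK w) with (t := t); auto.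
    pose proof (Cmod_le_add w b). lra.
Qed.

(** A bounded backward basin has only zeros of [F] on its boundary.  These are
    isolated, so that its closure is open as well. *)
Lemma bounded_basin_absurd b K : attracting G b -> (exists z, F z <> 0) -> F b = 0 ->
  (forall x, conv G x b -> Cmod x <= K) -> False.
Proof.
  intros Hat Hne Hb HK. set (U := fun x => conv G x b).
  assert (HU : is_open U) by apply (conv_open G HG b Hat).
  assert (HUb : U b).
  { apply (attracting_conv G HG) in Hat. destruct Hat as [r [Hr Hat]]. apply Hat.
    rewrite Cmod_sub_self. exact Hr. }
  assert (HbdK : forall x, boundary U x -> Cmod x <= K).
  { intros x Hx. apply le_epsilon. intros e He. destruct (Hx e He) as [[y [Hy1 Hy2]] _].
    unfold disc in Hy1. specialize (HK y Hy2). pose proof (Cmod_le_add x y).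
    rewrite (Cmod_sub_sym x y) in H. lra. }
  assert (HbdF : forall x, boundary U x -> F x = 0).
  { intros x Hx. apply NNPP. intro Hx0.
    destruct (boundary_forward_unbounded G HG b x K Hat Hx) as (t & v & _ & Hv & HKv).
    - rewrite HFG. intro E. apply Hx0. replace (F x) with (- - F x)%C by ring. rewrite E. ring.
    - assert (Hbv := boundary_invariant G HG U (conv_invariant G HG b) x t v Hv Hx).
      specialize (HbdK v Hbv). lra. }
  set (cl := fun z => U z \/ boundary U z).
  set (far := RtoC (Rabs K + 1)).
  assert (Hfar : ~ cl far).
  { assert (Hf : K < Cmod far).
    { unfold far. rewrite Cmod_R, Rabs_pos_eq; pose proof (Rle_abs K); pose proof (Rabs_pos K); lra. }
    intros [H|H]; [specialize (HK far H) | specialize (HbdK far H)]; lra. }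
  destruct (boundary_on_segment cl b far (or_introl HUb) Hfar) as [s [_ Hq]].
  set (q := seg b far s) in *.
  assert (Hclq : cl q).
  { destruct (classic (U q)) as [Hu|Hu]; [left; exact Hu|]. right. intros eps Heps. split.
    - destruct (Hq (eps / 2)) as [[y [Hy1 Hy2]] _]; [lra|]. unfold disc in *. destruct Hy2 as [Hy2|Hy2].
      + exists y. split; [lra | exact Hy2].
      + destruct (Hy2 (eps / 2)) as [[w [Hw1 Hw2]] _]; [lra|]. unfold disc in *. exists w.
        split; [|exact Hw2]. pose proof (Cmod_sub_triangle w y q). lra.
    - exists q. split; [|exact Hu]. unfold disc. rewrite Cmod_sub_self. exact Heps. }
  assert (Hnb : exists e, 0 < e /\ forall z, Cmod (z - q)%C < e -> cl z).
  { destruct Hclq as [Hu|Hu].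
    - destruct (HU q Hu) as [e [He H]]. exists e. split; [exact He|]. intros z Hz. left. auto.
    - assert (Hnu := boundary_not_open U q HU Hu).
      destruct (isolated_zero F q HF Hne) as [e [He H]]. exists e. split; [exact He|].
      intros z Hz. destruct (classic (z = q)) as [->|Hzq]; [right; exact Hu|]. left. apply NNPP. intro Hnz.
      destruct (Hu e He) as [[y [Hy1 Hy2]] _]. unfold disc in Hy1.
      assert (Hyq : y <> q) by (intros ->; contradiction).
      destruct (punctured_boundary U q e y z Hyq Hzq Hy1 Hz Hy2 Hnz) as (x & Hx1 & Hx2 & Hx3).
      apply (H x Hx1 Hx2), HbdF, Hx3. }
  destruct Hnb as [e [He H]]. destruct (Hq e He) as [_ [z [Hz1 Hz2]]]. apply Hz2, H, Hz1.
Qed.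

Lemma repelling_zero_boundary a b mua mu :
  F a = 0 -> cder F a mua -> Re mua < 0 -> attracting F a -> (exists z, F z <> 0) ->
  F b = 0 -> cder F b mu -> 0 < Re mu -> boundary (fun x => conv F x a) b ->
  exists x, boundary (fun x => conv F x a) x /\ F x <> 0 /\ conv G x b.
Proof.
  intros Ha Hmua Hrea Hata Hne Hb Hmu Hre Hbd.
  assert (HatG : attracting G b).
  { apply (stable_attracting G b (- mu)%C HG).
    - rewrite HFG, Hb. ring.
    - apply (neg_cder F G); assumption.
    - rewrite re_opp. lra. }
  assert (Hbn := boundary_not_open _ b (conv_open F HF a Hata) Hbd). cbv beta in Hbn.
  destruct (isolated_zero F b HF Hne) as [d1 [Hd1 H1]].
  destruct (proj1 (attracting_conv G HG b) HatG) as [d2 [Hd2 H2]].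
  assert (Hd : 0 < Rmin d1 d2) by (apply Rmin_pos; assumption).
  pose proof (Rmin_l d1 d2). pose proof (Rmin_r d1 d2).
  destruct (Hbd (Rmin d1 d2) Hd) as [[y [Hy1 Hy2]] _]. unfold disc in Hy1.
  assert (Hyb : y <> b) by (intros ->; contradiction).
  destruct (classic (forall z, z <> b -> Cmod (z - b)%C < Rmin d1 d2 -> conv F z a)) as [Hall|Hnot].
  - exfalso.
    destruct (backward_basin_bounded a b mua (Rmin d1 d2) Ha Hmua Hrea Hd Hall) as [K HK].
    apply (bounded_basin_absurd b K HatG Hne Hb HK).
  - apply not_all_ex_not in Hnot. destruct Hnot as [z Hz].
    apply imply_to_and in Hz. destruct Hz as [Hzb Hz].
    apply imply_to_and in Hz. destruct Hz as [Hzd HNz].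
    destruct (punctured_boundary (fun x => conv F x a) b (Rmin d1 d2) y z Hyb Hzb Hy1 Hzd Hy2 HNz)
      as (x & Hx1 & Hx2 & Hx3).
    exists x. split; [exact Hx3|]. split; [apply H1; [exact Hx1 | lra] | apply H2; lra].
Qed.

End BoundedBasin.

(** * Multiple zeros *)

Lemma Cexp_pow z n : (Cexp z ^ n)%C = Cexp (INR n * z)%C.
Proof.
  induction n as [|n IH].
  - simpl. replace (0 * z)%C with (RtoC 0) by ring. symmetry. apply Cexp_0.
  - change (Cexp z ^ S n)%C with (Cexp z * Cexp z ^ n)%C.
    rewrite IH, <- Cexp_plus, S_INR, RtoC_plus. f_equal. ring.
Qed.

Lemma Cexp_pi : Cexp (PI * Ci)%C = (- (1))%C.
Proof.
  unfold Cexp, Ci, RtoC, Cmult, Copp. simpl.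
  replace (PI * 0 - 0 * 1) with 0 by ring. replace (PI * 1 + 0 * 0) with PI by ring.
  rewrite exp_0, cos_PI, sin_PI. f_equal; ring.
Qed.

Section MultipleZero.
Variables (F g : C -> C) (b : C) (k : nat).
Hypothesis HF : holo F.
Hypothesis Hg : holo g.
Hypothesis Hgb : g b <> 0.
Notation n := (S k).
Hypothesis HFg : forall z, F z = ((z - b) ^ S n * g z)%C.

Definition wcoef : C := (- / (INR n * g b))%C.

(** In the coordinate [W], which sends [b] to infinity, the field is a small
    perturbation of the constant field [1]. *)
Definition W (z : C) : C := (wcoef * / (z - b) ^ n)%C.

Lemma INRn_neq_0 : RtoC (INR n) <> 0.
Proof. intro E. apply RtoC_inj in E. revert E. apply not_0_INR. discriminate. Qed.

Lemma wcoef_neq_0 : wcoef <> 0.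
Proof.
  intro E. assert (H : (wcoef * (INR n * g b))%C = (- (1))%C).
  { unfold wcoef. field. split; [exact Hgb | apply INRn_neq_0]. }
  rewrite E in H. apply (f_equal Re) in H. rewrite Cmult_0_l in H. simpl in H. lra.
Qed.

Lemma W_der z : z <> b -> exists l, cder W z l /\ (l * F z = g z / g b)%C.
Proof.
  intro Hz. assert (Hzb := sub_neq_0 z b Hz).
  assert (Hp : ((z - b) ^ n)%C <> 0) by (apply Cpow_nz, Hzb).
  assert (Hpk : ((z - b) ^ k)%C <> 0) by (apply Cpow_nz, Hzb).
  eexists. split.
  - apply (der_scal _ wcoef (fun z => / (z - b) ^ n)%C).
    apply (der_inv _ (fun z => (z - b) ^ n)%C z); [exact Hp|].
    apply (der_pow _ (fun z => z - b)%C z 1 k). apply cder_sub_const.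
  - rewrite HFg. unfold wcoef. pose proof INRn_neq_0.
    change ((z - b) ^ S n)%C with ((z - b) * ((z - b) * (z - b) ^ k))%C.
    change ((z - b) ^ n)%C with ((z - b) * (z - b) ^ k)%C.
    field. repeat split; assumption.
Qed.

Lemma Cmod_W z : z <> b -> Cmod (W z) = Cmod wcoef / Cmod (z - b)%C ^ n.
Proof.
  intro Hz. unfold W. rewrite Cmod_mult, Cmod_inv by (apply Cpow_nz, sub_neq_0, Hz).
  rewrite Cmod_pow. reflexivity.
Qed.

(** The modulus of [W] on the circle of radius [A] around [b]. *)
Definition level (A : R) : R := Cmod wcoef / A ^ n.

Lemma wcoef_pos : 0 < Cmod wcoef.
Proof. apply Cmod_gt_0, wcoef_neq_0. Qed.

Lemma level_pos A : 0 < A -> 0 < level A.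
Proof. intro HA. apply Rdiv_lt_0_compat; [apply wcoef_pos | apply pow_lt, HA]. Qed.

Lemma W_gt_level z A : 0 < A -> z <> b -> level A < Cmod (W z) -> Cmod (z - b)%C < A.
Proof.
  intros HA Hz H. apply Rnot_le_lt. intro Hle. rewrite Cmod_W in H by exact Hz.
  apply (Rlt_irrefl (level A)). eapply Rlt_le_trans; [exact H|].
  unfold level, Rdiv. apply Rmult_le_compat_l; [apply Cmod_ge_0|].
  apply Rinv_le_contravar; [apply pow_lt, HA | apply pow_incr; lra].
Qed.

Lemma W_large z A : 0 < A -> z <> b -> Cmod (z - b)%C <= A / 4 -> 4 * level A <= Cmod (W z).
Proof.
  intros HA Hz H. rewrite Cmod_W by exact Hz.
  assert (Hm := Cmod_sub_pos z b Hz). assert (HAn : 0 < A ^ n) by (apply pow_lt, HA).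
  assert (Hzn : 0 < Cmod (z - b)%C ^ n) by (apply pow_lt, Hm).
  assert (H4 : 4 * Cmod (z - b)%C ^ n <= A ^ n).
  { simpl. assert (Cmod (z - b)%C ^ k <= A ^ k) by (apply pow_incr; lra).
    assert (0 < Cmod (z - b)%C ^ k) by (apply pow_lt, Hm). nra. }
  unfold level. apply Rmult_le_reg_r with (A ^ n * Cmod (z - b)%C ^ n); [nra|].
  replace (4 * (Cmod wcoef / A ^ n) * (A ^ n * Cmod (z - b)%C ^ n)) with
    (Cmod wcoef * (4 * Cmod (z - b)%C ^ n)) by (field; lra).
  replace (Cmod wcoef / Cmod (z - b)%C ^ n * (A ^ n * Cmod (z - b)%C ^ n)) with
    (Cmod wcoef * A ^ n) by (field; lra).
  apply Rmult_le_compat_l; [apply Cmod_ge_0 | exact H4].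
Qed.

(** The radii [A] up to which [b] is the only zero and the field is close to [1] in
    the coordinate [W]. *)
Definition flat (A : R) : Prop := 0 < A /\
  (forall z, Cmod (z - b)%C <= A -> Cmod (g z / g b - 1)%C <= / 10) /\
  (forall z, z <> b -> Cmod (z - b)%C <= A -> F z <> 0).

Lemma flat_small e : 0 < e -> exists A, flat A /\ A <= e.
Proof.
  intro He. destruct (Hg b) as [l Hl]. assert (Hm := proj1 (Cmod_gt_0 _) Hgb).
  destruct (der_cont _ _ _ _ Hl (Cmod (g b) / 10)) as [d [Hd H]]; [lra|].
  assert (Hmin : 0 < Rmin e d) by (apply Rmin_pos; assumption).
  pose proof (Rmin_l e d). pose proof (Rmin_r e d).
  assert (Hgd : forall z, Cmod (z - b)%C <= Rmin e d / 2 -> Cmod (g z / g b - 1)%C <= / 10).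
  { intros z Hz. replace (g z / g b - 1)%C with ((g z - g b) * / g b)%C by (field; exact Hgb).
    rewrite Cmod_mult, Cmod_inv by exact Hgb. specialize (H z ltac:(lra)).
    apply Rmult_le_reg_r with (Cmod (g b)); [exact Hm|].
    rewrite Rmult_assoc, Rinv_l by lra. lra. }
  exists (Rmin e d / 2). split; [|lra]. split; [lra|]. split; [exact Hgd|].
  intros z Hz Hzd. rewrite HFg. apply Cmult_neq_0; [apply Cpow_nz, sub_neq_0, Hz|].
  intro E. specialize (Hgd z Hzd). rewrite E in Hgd.
  replace (0 / g b - 1)%C with (- (1))%C in Hgd by (field; exact Hgb).
  rewrite Cmod_opp, Cmod_1 in Hgd. lra.
Qed.

(** The derivative of [W] along solutions is [sg g / g b], close to [sg]; the sign
    [sg] is [1] for the field [F] and [-1] for [- F]. *)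
Lemma W_drift (G : C -> C) (sg : R) A phi x t : holo G -> flat A -> (forall z, G z = (sg * F z)%C) ->
  Rabs sg = 1 -> x <> b -> Cmod (x - b)%C <= A ->
  phi 0 = x -> 0 <= t -> solves G phi 0 t -> (forall s, 0 <= s <= t -> Cmod (phi s - b)%C <= A) ->
  phi t <> b /\ Cmod (W (phi t) - W x - RtoC (sg * t))%C <= t / 10.
Proof.
  intros HG (HA & Hgd & HFn) HGF Hsg Hxb HxA P0 Ht P Hs.
  assert (Hsg0 : RtoC sg <> 0).
  { intro E. apply RtoC_inj in E. rewrite E, Rabs_R0 in Hsg. lra. }
  assert (Hne : forall s, 0 <= s <= t -> phi s <> b).
  { intros s Hst E. assert (Hr : reach G x s (phi s)).
    { apply solves_reach; [exact P0 | lra|]. intros u Hu. apply P. lra. }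
    apply (reach_nonequilibrium G HG x s _ Hr).
    - rewrite HGF. apply Cmult_neq_0; auto.
    - rewrite HGF, E, HFg. simpl. ring. }
  split; [apply Hne; lra|].
  set (h := fun s : R => (W (phi s) - (0 + sg * s))%C).
  replace (W (phi t) - W x - RtoC (sg * t))%C with (h t - h 0)%C
    by (unfold h; rewrite P0, RtoC_mult; ring).
  replace (t / 10) with (/ 10 * (t - 0)) by field.
  apply mean_value; [exact Ht|]. intros s Hst.
  destruct (W_der (phi s) (Hne s Hst)) as [l [Hl El]].
  exists (l * G (phi s) - sg)%C. split.
  - apply (der_minus _ (fun s => W (phi s))); [|apply der_affine].
    apply (der_comp _ W phi); [exact Hl | apply P, Hst].
  - rewrite HGF. replace (l * (sg * F (phi s)) - sg)%C with (sg * (l * F (phi s) - 1))%C by ring.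
    rewrite El, Cmod_mult, Cmod_R, Hsg, Rmult_1_l. apply Hgd, Hs, Hst.
Qed.

(** Outside a cone around the negative axis the translation leads away from
    the origin, that is, orbits stay close to [b]. *)
Lemma forward_stay A x : flat A -> x <> b -> Cmod (x - b)%C <= A / 4 ->
  - (4 / 5) * Cmod (W x) <= Re (W x) ->
  forall t, 0 <= t -> exists v, reach F x t v /\ Cmod (v - b)%C < A.
Proof.
  intros HAf Hxb HxA Hre. assert (HA := proj1 HAf).
  assert (Hw := W_large x A HA Hxb HxA). assert (Hlev := level_pos A HA).
  destruct (apriori F HF x b A) as [phi [P0 P]]; [lra| |].
  - intros phi t P0 Ht P Hs.
    destruct (W_drift F 1 A phi x t HF HAf) as [Hne Hd]; auto.
    + intro z. ring.
    + apply Rabs_R1.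
    + lra.
    + apply W_gt_level; [exact HA | exact Hne|].
      set (w := Cmod (W x)) in *. rewrite Rmult_1_l in Hd.
      assert (E : Cmod (W x + RtoC t)%C ^ 2 = w ^ 2 + 2 * t * Re (W x) + t ^ 2).
      { unfold w. rewrite !Cmod2_alt. destruct (W x). simpl. ring. }
      assert (B : (w / 4 + t / 10) ^ 2 < Cmod (W x + RtoC t)%C ^ 2).
      { rewrite E. assert (0 < w) by lra. assert (- (8 / 5) * (t * w) <= 2 * t * Re (W x)) by nra.
        (* The difference is a positive definite form in [w] and [t]; complete the square. *)
        pose proof (pow2_ge_0 (w - 55 / 62 * t)). pose proof (pow2_ge_0 t).
        assert (0 < w ^ 2) by (apply pow_lt; assumption). nra. }
      assert (B' : w / 4 + t / 10 < Cmod (W x + RtoC t)%C).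
      { pose proof (Cmod_ge_0 (W x + RtoC t)%C). nra. }
      pose proof (Cmod_le_add (W x + RtoC t)%C (W (phi t))) as D.
      rewrite Cmod_sub_sym in D. replace (W (phi t) - (W x + RtoC t))%C with (W (phi t) - W x - RtoC t)%C in D by ring.
      lra.
  - intros t Ht. exists (phi t). split; [|apply P, Ht].
    apply solves_reach; auto. intros s Hs. apply P. lra.
Qed.

(** The time reversed field translates [W] to the left, away from the origin. *)
Lemma backward_conv (G : C -> C) A x : (forall z, G z = (- F z)%C) -> flat A -> x <> b ->
  Cmod (x - b)%C <= A -> Re (W x) < - level A -> conv G x b.
Proof.
  intros HFG HAf Hxb HxA Hre. assert (HA := proj1 HAf). assert (HG := neg_holo F G HFG HF).
  assert (Hdrift : forall phi t, phi 0 = x -> 0 <= t -> solves G phi 0 t ->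
    (forall s, 0 <= s <= t -> Cmod (phi s - b)%C <= A) ->
    phi t <> b /\ level A + 9 / 10 * t < Cmod (W (phi t))).
  { intros phi t P0 Ht P Hs.
    destruct (W_drift G (-1) A phi x t HG HAf) as [Hne Hd]; auto.
    - intro z. rewrite HFG. ring.
    - rewrite Rabs_left; lra.
    - split; [exact Hne|].
      pose proof (re_le_Cmod (W (phi t) - W x - RtoC (-1 * t))%C) as D. apply Rabs_le_between in D.
      pose proof (re_le_Cmod (W (phi t))) as D'. apply Rabs_le_between in D'.
      destruct (W (phi t)), (W x). simpl in *. lra. }
  destruct (apriori G HG x b A HxA) as [phi [P0 P]].
  - intros phi t P0 Ht P Hs. destruct (Hdrift phi t P0 Ht P Hs) as [Hne Hl].
    apply W_gt_level; [exact HA | exact Hne | lra].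
  - intros eps Heps. exists (2 * level eps). intros t HtT.
    pose proof (level_pos eps Heps). pose proof (level_pos A HA).
    assert (Ht : 0 <= t) by lra.
    exists (phi t). split.
    + apply solves_reach; auto. intros s Hs. apply P. lra.
    + destruct (Hdrift phi t P0 Ht) as [Hne Hl].
      * intros s Hs. apply P. lra.
      * intros s Hs. left. apply P. lra.
      * apply W_gt_level; [exact Heps | exact Hne | lra].
Qed.

(** Near [b] the basin of another point lies in the cone around the negative
    axis.  Rotating a point of the basin around [b] until [W] changes sign leads
    out of the basin, and the boundary point met on the way is still in the
    cone, hence comes from [b]. *)
Lemma multiple_zero_boundary (G : C -> C) a : (forall z, G z = (- F z)%C) -> attracting F a -> a <> b ->
  boundary (fun x => conv F x a) b ->
  exists x, boundary (fun x => conv F x a) x /\ F x <> 0 /\ conv G x b.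
Proof.
  intros HFG0 Hat Hab Hbd. assert (Habp := Cmod_sub_pos a b Hab).
  destruct (flat_small (Cmod (a - b)%C / 2)) as [A [HAf HAe]]; [lra|].
  assert (HA := proj1 HAf).
  assert (Hbn := boundary_not_open _ b (conv_open F HF a Hat) Hbd). cbv beta in Hbn.
  assert (Hcone : forall z, z <> b -> Cmod (z - b)%C <= A / 4 -> conv F z a ->
    Re (W z) < - (4 / 5) * Cmod (W z)).
  { intros z Hz HzA Hc. apply Rnot_le_lt. intro Hle.
    apply (stays_not_conv F a b A z HF); [lra | | exact Hc].
    apply forward_stay; assumption. }
  destruct (Hbd (A / 4)) as [[x [Hx Hcx]] _]; [lra|]. unfold disc in Hx.
  assert (Hxb : x <> b) by (intros ->; contradiction).
  assert (Hxp := Cmod_sub_pos x b Hxb).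
  set (c0 := (PI / INR n * Ci)%C).
  set (path := fun s : R => (b + (x - b) * Cexp (0 + c0 * s))%C).
  assert (Hc0 : (INR n * c0)%C = (PI * Ci)%C).
  { unfold c0. field. apply INRn_neq_0. }
  assert (Hpd : forall s, Cmod (path s - b)%C = Cmod (x - b)%C).
  { intro s. unfold path. replace (b + (x - b) * Cexp (0 + c0 * s) - b)%C with ((x - b) * Cexp (0 + c0 * s))%C by ring.
    rewrite Cmod_mult, Cmod_Cexp.
    assert (E : Re (0 + c0 * s)%C = 0).
    { unfold c0. rewrite <- RtoC_div by (apply not_0_INR; discriminate). simpl. ring. }
    rewrite E, exp_0. ring. }
  assert (Hp0 : path 0 = x).
  { unfold path. replace (0 + c0 * 0%R)%C with (RtoC 0) by ring. rewrite Cexp_0. ring. }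
  assert (Hpb : forall s, path s <> b).
  { intros s E. specialize (Hpd s). rewrite E, Cmod_sub_self in Hpd. lra. }
  assert (HW1 : W (path 1) = (- W x)%C).
  { unfold W. replace (path 1 - b)%C with ((x - b) * Cexp c0)%C.
    - rewrite Cpow_mult_l, Cexp_pow, Hc0, Cexp_pi. field. apply Cpow_nz, sub_neq_0, Hxb.
    - unfold path. replace (0 + c0 * 1%R)%C with c0 by ring. ring. }
  destruct (boundary_on_path (fun x => conv F x a) path) as [s [_ Hs]].
  - intros s _. apply (der_cont RtoC path s ((x - b) * (Cexp (0 + c0 * s) * c0))%C).
    apply der_eq with (0 + (x - b) * (Cexp (0 + c0 * s) * c0))%C; [ring|].
    apply der_plus; [apply der_const|]. apply der_scal.
    apply (der_comp _ Cexp (fun s : R => (0 + c0 * s)%C)); [apply cder_Cexp | apply der_affine].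
  - rewrite Hp0. exact Hcx.
  - intro H1. assert (B1 := Hcone _ (Hpb 1) ltac:(rewrite Hpd; lra) H1).
    assert (B0 := Hcone x Hxb ltac:(lra) Hcx).
    rewrite HW1, re_opp, Cmod_opp in B1. pose proof (Cmod_ge_0 (W x)). lra.
  - set (y := path s) in *. assert (Hyb : y <> b) by apply Hpb.
    assert (Hyd : Cmod (y - b)%C = Cmod (x - b)%C) by apply Hpd.
    exists y. split; [exact Hs|]. split; [apply HAf; [exact Hyb | lra]|].
    assert (Hy : Re (W y) <= - (4 / 5) * Cmod (W y)).
    { apply Rnot_lt_le. intro Hlt. set (e := Re (W y) + 4 / 5 * Cmod (W y)).
      assert (He : 0 < e) by (unfold e; lra).
      destruct (W_der y Hyb) as [l [Hl _]].
      destruct (der_cont _ _ _ _ Hl (e / 4)) as [d [Hd Hc]]; [lra|].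
      set (r := Rmin d (Rmin (A / 4 - Cmod (x - b)%C) (Cmod (x - b)%C))).
      assert (Hr : 0 < r) by (repeat apply Rmin_pos; lra).
      assert (R1 : r <= d) by apply Rmin_l.
      assert (R2 : r <= A / 4 - Cmod (x - b)%C) by (eapply Rle_trans; [apply Rmin_r | apply Rmin_l]).
      assert (R3 : r <= Cmod (x - b)%C) by (eapply Rle_trans; [apply Rmin_r | apply Rmin_r]).
      destruct (Hs r Hr) as [[z [Hz Hcz]] _]. unfold disc in Hz.
      assert (Hzb : z <> b).
      { intros ->. rewrite Cmod_sub_sym in Hz. lra. }
      assert (Hzd : Cmod (z - b)%C <= A / 4) by (pose proof (Cmod_sub_triangle z y b); lra).
      specialize (Hcone z Hzb Hzd Hcz). specialize (Hc z ltac:(lra)).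
      pose proof (re_le_Cmod (W z - W y)%C) as D. apply Rabs_le_between in D.
      assert (E : Re (W z - W y)%C = Re (W z) - Re (W y)) by (destruct (W z), (W y); reflexivity).
      rewrite E in D. pose proof (Cmod_le_add (W y) (W z)) as D2. rewrite (Cmod_sub_sym (W y)) in D2.
      unfold e in *. lra. }
    apply (backward_conv G A y HFG0 HAf Hyb); [lra|].
    pose proof (W_large y A HA Hyb ltac:(lra)). pose proof (level_pos A HA). lra.
Qed.

End MultipleZero.

(** * Unbounded boundary orbits *)

Section Conclusion.
Variables F G : C -> C.
Hypothesis HF : holo F.
Hypothesis HFG : forall z, G z = (- F z)%C.
Hypothesis Hne : exists z, F z <> 0.
Variables a mua : C.
Hypothesis Ha : F a = 0.
Hypothesis Hmua : cder F a mua.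
Hypothesis Hmua0 : mua <> 0.
Hypothesis Hat : attracting F a.

Let HG : holo G := neg_holo F G HFG HF.
Notation N := (fun x => conv F x a).

Lemma boundary_point_from_zero b : boundary N b -> F b = 0 ->
  exists x, boundary N x /\ F x <> 0 /\ conv G x b.
Proof.
  intros Hbd Hb.
  assert (Hab : a <> b).
  { intros <-. apply (boundary_not_open _ a (conv_open F HF a Hat) Hbd).
    destruct (proj1 (attracting_conv F HF a) Hat) as [r [Hr H]]. apply H.
    rewrite Cmod_sub_self. exact Hr. }
  assert (Habp := Cmod_sub_pos a b Hab).
  destruct (finite_order F b HF Hne) as (m & g & Hg & Hgb & E).
  destruct m as [|[|k]].
  - exfalso. apply Hgb. rewrite <- Hb, E. simpl. ring.
  - assert (Hmu : cder F b (g b)).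
    { destruct (Hg b) as [l Hl].
      apply (der_ext _ (fun z => (z - b) * g z)%C F b (1 * g b + (b - b) * l)%C _ 1); [lra| |ring|].
      - intros y _. rewrite E. simpl. ring.
      - apply (der_mult _ (fun z => z - b)%C g); [apply cder_sub_const | exact Hl]. }
    destruct (Rle_dec (Re (g b)) 0) as [Hre|Hre].
    + exfalso.
      destruct (stable_zero F b (g b) HF Hb Hmu Hgb Hre (Cmod (a - b)%C / 2)) as [d [Hd H]]; [lra|].
      destruct (Hbd d Hd) as [[y [Hy Hcy]] _].
      apply (stays_not_conv F a b (Cmod (a - b)%C / 2) y HF); [lra | | exact Hcy].
      intros t Ht. destruct (H y Hy t Ht) as (v & Hv & Hvb & _). exists v. auto.
    + apply (repelling_zero_boundary F HF G HFG a b mua (g b)); auto; [|lra].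
      apply (attracting_Re_neg F a mua); assumption.
  - apply (multiple_zero_boundary F g b k HF Hg Hgb E G a); assumption.
Qed.

Lemma boundary_zero_not_isolated b : boundary N b -> F b = 0 -> forall rho, 0 < rho ->
  exists z, disc b rho z /\ boundary N z /\ z <> b.
Proof.
  intros Hbd Hb rho Hrho. destruct (boundary_point_from_zero b Hbd Hb) as (x & Hx & Hx0 & Hc).
  destruct (Hc rho Hrho) as [T HT]. destruct (HT T (Rle_refl T)) as [v [Hv Hvb]].
  apply (reach_neg G F _ _ _ (neg_sym F G HFG)) in Hv.
  exists v. split; [exact Hvb|]. split.
  - apply (boundary_invariant F HF N (conv_invariant F HF a) x (- T)); assumption.
  - intros ->. apply (reach_nonequilibrium F HF x (- T) b); assumption.
Qed.

Lemma boundary_orbit_from_zero b : boundary N b -> F b = 0 ->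
  exists x, unbounded (orbit F x) /\ (forall y, orbit F x y -> boundary N y) /\ w_minus F x b.
Proof.
  intros Hbd Hb. destruct (boundary_point_from_zero b Hbd Hb) as (x & Hx & Hx0 & Hc).
  exists x. split; [|split].
  - intro M. destruct (boundary_forward_unbounded F HF a x M Hat Hx Hx0) as (t & v & _ & Hv & Hm).
    exists v. split; [|exact Hm]. apply orbit_reach; [exact HF|]. exists t. exact Hv.
  - intros y Hy. apply (orbit_reach F HF) in Hy. destruct Hy as [t Ht].
    apply (boundary_invariant F HF N (conv_invariant F HF a) x t); assumption.
  - apply (w_plus_neg G F x b (neg_sym F G HFG)). apply (conv_w_plus G HG x b b Hc). reflexivity.
Qed.

End Conclusion.

(** ** Both kinds of nodes and foci *)

Lemma repelling_neg F G a : (forall z, G z = (- F z)%C) -> repelling F a <-> attracting G a.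
Proof.
  intro HFG. unfold repelling, attracting. split; apply filter_imp; intro x.
  - apply tends_backward_neg, HFG.
  - apply (tends_forward_neg G F), neg_sym, HFG.
Qed.

Lemma orbit_neg F G x y : holo F -> (forall z, G z = (- F z)%C) -> orbit G x y <-> orbit F x y.
Proof.
  intros HF HFG. assert (HG := neg_holo F G HFG HF).
  rewrite (orbit_reach F HF), (orbit_reach G HG). split; intros [t Ht]; exists (- t).
  - apply (reach_neg G F); [apply neg_sym, HFG | exact Ht].
  - apply (reach_neg F G); assumption.
Qed.

Theorem proposition4p4 :
  forall (F : C -> C) (a : C),
    entire F ->
    (exists z : C, F z <> RtoC 0) ->
    node_or_focus F a ->
    (forall b : C, boundary (basin F a) b -> F b = RtoC 0 ->
       forall rho : R, 0 < rho ->
         exists z : C, disc b rho z /\ boundary (basin F a) z /\ z <> b) /\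
    (forall b : C, boundary (basin F a) b -> F b = RtoC 0 ->
       exists x : C,
         unbounded (orbit F x) /\
         (forall y : C, orbit F x y -> boundary (basin F a) y) /\
         (w_plus F x b \/ w_minus F x b)).
Proof.
  intros F a Hent Hne [[Ha [mu [Hmu Hmu0]]] Hnode].
  apply cder_is_derive in Hmu.
  assert (HF : holo F).
  { intro z. destruct (Hent z) as [l Hl]. exists l. apply cder_is_derive, Hl. }
  set (G := fun z => (- F z)%C).
  assert (HFG : forall z, G z = (- F z)%C) by reflexivity.
  assert (HG := neg_holo F G HFG HF). assert (HGF := neg_sym F G HFG).
  assert (Ga : G a = 0) by (rewrite HFG, Ha; ring).
  assert (Gmu := neg_cder F G a mu HFG Hmu).
  assert (Gmu0 : (- mu)%C <> 0).
  { intro E. apply Hmu0. replace mu with (- - mu)%C by ring. rewrite E. ring. }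
  (* The sign of [Re mu] separates the two kinds of basin. *)
  assert (Hexcl : attracting F a -> repelling F a -> False).
  { intros H1 H2. apply (repelling_neg F G a HFG) in H2.
    assert (A1 := attracting_Re_neg F a mu HF Ha Hmu Hmu0 H1).
    assert (A2 := attracting_Re_neg G a (- mu) HG Ga Gmu Gmu0 H2).
    rewrite re_opp in A2. lra. }
  destruct Hnode as [Hat|Hrep].
  - assert (HN : forall x, basin F a x <-> conv F x a).
    { intro x. rewrite <- (attracting_basin F HF a x Hat). unfold basin. split.
      - intros [[_ H]|[H _]]; [exact H | destruct (Hexcl Hat H)].
      - intro H. left. auto. }
    assert (HN' : forall x, conv F x a <-> basin F a x) by (intro; symmetry; apply HN).
    split; intros b Hbd Hb; apply (boundary_ext _ _ b HN) in Hbd.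
    + intros rho Hrho.
      destruct (boundary_zero_not_isolated F G HF HFG Hne a mu Ha Hmu Hmu0 Hat b Hbd Hb rho Hrho)
        as (z & H1 & H2 & H3).
      exists z. split; [exact H1|]. split; [apply (boundary_ext _ _ z HN'), H2 | exact H3].
    + destruct (boundary_orbit_from_zero F G HF HFG Hne a mu Ha Hmu Hmu0 Hat b Hbd Hb) as (x & H1 & H2 & H3).
      exists x. split; [exact H1|]. split; [|right; exact H3].
      intros y Hy. apply (boundary_ext _ _ y HN'), H2, Hy.
  - assert (HatG := proj1 (repelling_neg F G a HFG) Hrep).
    assert (HneG : exists z, G z <> 0).
    { destruct Hne as [z Hz]. exists z. rewrite HFG. intro E. apply Hz.
      replace (F z) with (- - F z)%C by ring. rewrite E. ring. }
    assert (HN : forall x, basin F a x <-> conv G x a).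
    { intro x. rewrite <- (attracting_basin G HG a x HatG). unfold basin. split.
      - intros [[H _]|[_ H]]; [destruct (Hexcl H Hrep)|]. intro p. rewrite <- (H p).
        split; [apply (w_plus_neg G F), HGF | apply (w_minus_neg F G), HFG].
      - intro H. right. split; [exact Hrep|]. intro p. rewrite <- (H p).
        split; [apply (w_minus_neg F G), HFG | apply (w_plus_neg G F), HGF]. }
    assert (HN' : forall x, conv G x a <-> basin F a x) by (intro; symmetry; apply HN).
    split; intros b Hbd Hb; apply (boundary_ext _ _ b HN) in Hbd;
      (assert (Gb : G b = 0) by (rewrite HFG, Hb; ring)).
    + intros rho Hrho.
      destruct (boundary_zero_not_isolated G F HG HGF HneG a (- mu) Ga Gmu Gmu0 HatG b Hbd Gb rho Hrho)
        as (z & H1 & H2 & H3).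
      exists z. split; [exact H1|]. split; [apply (boundary_ext _ _ z HN'), H2 | exact H3].
    + destruct (boundary_orbit_from_zero G F HG HGF HneG a (- mu) Ga Gmu Gmu0 HatG b Hbd Gb) as (x & H1 & H2 & H3).
      exists x. split; [|split].
      * intro M. destruct (H1 M) as [y [Hy Hm]]. exists y. split; [|exact Hm].
        apply (orbit_neg F G x y HF HFG), Hy.
      * intros y Hy. apply (boundary_ext _ _ y HN'), H2. apply (orbit_neg F G x y HF HFG), Hy.
      * left. revert H3. apply (w_minus_neg G F), HGF.
Qed.
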